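(* Let $n,m\ge1$ be integers, let $\mu=\bigotimes_{k=1}^n\mu_k$ be an unconditional product measure with decreasing density on $\mathbb{R}^n$, and let $A,B_1,\ldots,B_m\subset\mathbb{R}^n_+$ be anti-blocking bodies. Then, for every choice of signs, $$\mu(A)^{m-1}\,\mu(A\pm B_1\pm B_2\pm\cdots\pm B_m)\le\zeta_{n,m}\prod_{i=1}^m\mu(A-B_i),$$ where $$\zeta_{n,m}:=\max\frac{\prod_{i=1}^m\binom{\alpha_i}{N}}{\binom{n}{N}^{m-1}},\qquad N=\sum_{i=1}^m\alpha_i-n(m-1),$$ the maximum being over all integers $0\le\alpha_1,\dots,\alpha_m\le n$ with $N\ge0$.
   Context: $\mathbb{R}^n_+=[0,\infty)^n$. A convex body is a nonempty compact convex set. A coordinate subspace is one spanned by a subset of the standard basis $e_1,\dots,e_n$. A convex body $K\subset\mathbb{R}^n_+$ is anti-blocking if $P_EK=K\cap E$ for every coordinate subspace $E$, where $P_E$ is the orthogonal projection onto $E$. Sums and differences are Minkowski sums, $K\pm L=\{x\pm y:x\in K,y\in L\}$. An unconditional product measure with decreasing density is $\mu=\bigotimes_{k=1}^n\mu_k$, where each $\mu_k$ is a Borel measure on $\mathbb{R}$ with locally integrable density $\phi_k\ge0$ that is even and non-increasing on $[0,\infty)$; thus the density $\phi(x)=\prod_k\phi_k(x_k)$ of $\mu$ is invariant under sign changes of coordinates and non-increasing on $[0,\infty)$ in each coordinate. *)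

(* Defs.v *)
From HB Require Import structures.
From mathcomp Require Import all_boot all_order all_algebra.
From mathcomp Require Import all_classical all_reals all_analysis.
Set Implicit Arguments.
Unset Strict Implicit.
Unset Printing Implicit Defensive.
Import Order.TTheory GRing.Theory Num.Theory.
Import numFieldNormedType.Exports.

Local Open Scope classical_set_scope.
Local Open Scope ring_scope.

Definition convex_body (R : realType) (n : nat) (K : set 'rV[R]_n) : Prop :=
  [/\ K !=set0, compact K & convex_set K].

Definition nonneg_orthant (R : realType) (n : nat) : set 'rV[R]_n :=
  [set x | forall i, 0 <= x 0 i].

Definition dotv (R : realType) (n : nat) (x y : 'rV[R]_n) : R :=
  \sum_(i < n) x 0 i * y 0 i.

Definition coord_subspace (R : realType) (n : nat) (I : {set 'I_n}) :
    {vspace 'rV[R]_n} :=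
  <<[seq delta_mx 0%R i | i <- enum I]>>%VS.

Definition is_orth_proj (R : realType) (n : nat) (E : {vspace 'rV[R]_n})
    (x y : 'rV[R]_n) : Prop :=
  y \in E /\ forall z, z \in E -> dotv (x - y) z = 0.

Definition orth_proj_set (R : realType) (n : nat) (E : {vspace 'rV[R]_n})
    (K : set 'rV[R]_n) : set 'rV[R]_n :=
  [set y | exists2 x, K x & is_orth_proj E x y].

Definition anti_blocking (R : realType) (n : nat) (K : set 'rV[R]_n) : Prop :=
  [/\ convex_body K, K `<=` @nonneg_orthant R n &
      forall I : {set 'I_n},
        orth_proj_set (coord_subspace R I) K =
        K `&` [set x | x \in coord_subspace R I]].

Definition minkowski_add (R : realType) (n : nat) (A B : set 'rV[R]_n) :
    set 'rV[R]_n := [set x + y | x in A & y in B].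

Definition minkowski_sub (R : realType) (n : nat) (A B : set 'rV[R]_n) :
    set 'rV[R]_n := [set x - y | x in A & y in B].

(* ((A +- B_1) +- B_2) +- ... +- B_m, with a minus sign in front of B_i exactly
   when [s i] is true; [enum 'I_m] lists the indices in increasing order. *)
Definition minkowski_signed (R : realType) (n m : nat) (s : 'I_m -> bool)
    (A : set 'rV[R]_n) (B : 'I_m -> set 'rV[R]_n) : set 'rV[R]_n :=
  foldl (fun K i => if s i then minkowski_sub K (B i)
                    else minkowski_add K (B i)) A (enum 'I_m).

Notation borel_rV R n := (g_sigma_algebraType (@open 'rV[R]_n)).

(* The density takes values in [0, +oo], because a locally integrable density
   which is unbounded near 0 (such as |x|^(-1/2)) is non-increasing on
   [0, +oo[ only if its value at 0 is +oo; real-valued densities are the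
   special case [EFin \o f]. *)
Definition even_decreasing_density (R : realType)
    (phi : measurableTypeR R -> \bar R) : Prop :=
  [/\ forall x : R, (0 <= phi x)%E,
      forall K : set R, compact K ->
        (@lebesgue_measure R).-integrable K phi,
      forall x : R, phi (- x) = phi x &
      forall x y : R, 0 <= x -> x <= y -> (phi y <= phi x)%E].

Definition has_density (R : realType)
    (mu : {measure set (measurableTypeR R) -> \bar R})
    (phi : measurableTypeR R -> \bar R) : Prop :=
  forall A, measurable A -> mu A = (\int[@lebesgue_measure R]_(x in A) phi x)%E.

(* For sigma-finite factors this determines mu. *)
Definition is_product_measure (R : realType) (n : nat)
    (mu_ : 'I_n -> {measure set (measurableTypeR R) -> \bar R})
    (mu : {measure set (borel_rV R n) -> \bar R}) : Prop :=
  forall A : 'I_n -> set (measurableTypeR R), (forall k, measurable (A k)) ->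
    mu [set x : 'rV[R]_n | forall k, A k (x 0 k)] =
    (\prod_(k < n) mu_ k (A k))%E.

Definition unconditional_decreasing_product (R : realType) (n : nat)
    (mu : {measure set (borel_rV R n) -> \bar R}) : Prop :=
  exists2 mu_ : 'I_n -> {measure set (measurableTypeR R) -> \bar R},
    forall k, exists2 phi, even_decreasing_density phi & has_density (mu_ k) phi
    & is_product_measure mu_ mu.

Section Zeta.
Variables (R : realType) (n m : nat).

Definition zeta_adm (alpha : {ffun 'I_m -> 'I_n.+1}) : bool :=
  (n * m.-1 <= \sum_(i < m) alpha i)%N.

Definition zeta_N (alpha : {ffun 'I_m -> 'I_n.+1}) : nat :=
  (\sum_(i < m) alpha i - n * m.-1)%N.

(* The terms are nonnegative, and for 0 < m the choice of all alpha_i equal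
   to n is admissible with value 1, so the default value 0 of the iterated
   maximum is immaterial. *)
Definition zeta : R :=
  \big[Num.max/0]_(alpha : {ffun 'I_m -> 'I_n.+1} | zeta_adm alpha)
    ((\prod_(i < m) 'C(alpha i, zeta_N alpha)%:R) /
     'C(n, zeta_N alpha)%:R ^+ m.-1).

End Zeta.

(* Main.v *)
Require Import Defs.
From HB Require Import structures.
From mathcomp Require Import all_boot all_order all_algebra.
From mathcomp Require Import all_classical all_reals all_analysis.
From mathcomp Require Import measurable_realfun ring lra zify.
Import Order.TTheory GRing.Theory Num.Theory.
Import numFieldNormedType.Exports.
Local Open Scope classical_set_scope.
Local Open Scope ring_scope.

Set Implicit Arguments.
Unset Strict Implicit.
Unset Printing Implicit Defensive.

(* For a map c from the coordinates to {None} + {0, ..., m}, let S_c be the set of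
   the vectors whose k-th coordinate is the signed sum of the k-th coordinates of
   the points a in A and b_i in B_i if c k = None, and the k-th coordinate of one
   of these points, selected by c k, otherwise. Since x |-> mu_k [0, x] is
   subadditive and mu_k [-y, x] = mu_k [0, y] + mu_k [0, x], Fubini shows that
   assigning one more coordinate in all possible ways does not decrease the total
   measure, hence mu (A +- B_1 +- ... +- B_m) is at most the sum over ordered
   partitions (F_0, ..., F_m) of the coordinates of
   mu_{F_0}(A) prod_i mu_{F_i}(B_i), where mu_F is the measure of the section by
   the coordinate subspace F (as anti-blocking bodies have sections equal to
   projections). For A - B_i alone, the reverse inequality holds.

   The two expansions are compared through
     mu(A)^(m-1) mu_{F_0}(A) <= zeta prod_i mu_{F_i^c}(A).
   With N = #|F_0|, let Phi (x) be the measure of the section of A over F_0 at x.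
   Its N-th root is concave, so that its superlevel sets shrink at a controlled
   rate. The Loomis-Whitney inequality on each superlevel set reduces the claim to
   an inequality of Berwald type for functions of the height, in which extremal
   functions are powers of 1 - s^(1/N), with Beta integrals as moments. *)

(** * Iterated integrals *)

(** Expanding [prod_i mu (A - B_i)] gives a sum over all families of coordinate sets [G_i] of
    [prod_i mu_{G_i}(A) mu_{G_i^c}(B_i)]. Keeping only the families [G_i = F_i^c] that come from an
    ordered partition [(F_0, ..., F_m)] leaves exactly the factors of the [B_i] in the upper
    expansion, so that an inequality for [A] alone remains. With [alpha_i = #|F_i^c|] one has
    [sum_i alpha_i = n (m - 1) + N], which explains the range of the maximum. The binomials in
    [zeta] are inverse moments: the integral of [(1 - s^(1/N))^r] over [[0, 1]] is
    [1 / 'C(N + r, N)]. The reverse expansion is available for [A - B_i] because there is only one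
    summand of each sign: a slice is then an interval [[-y, x]] up to endpoints, with independently
    attainable ends, and its measure is exactly a sum. Several summands of the same sign give only
    subadditivity. The measures are not homogeneous. What replaces homogeneity is the concavity of
    [a |-> mu_k [0, a]]; this is a Brunn-Minkowski inequality for intervals starting at 0, and no
    others occur because all sets and functions involved are monotone in each coordinate. *)

Section IteratedIntegral.
Local Open Scope ereal_scope.
Context d (T : measurableType d) (R : realType) (I : eqType).
Variable nu : I -> {sigma_finite_measure set (measurableTypeR R) -> \bar R}.
Variables (D : I -> set (measurableTypeR R)) (upd : I -> T -> R -> T).
Hypothesis mD : forall k, measurable (D k).
Hypothesis mupd : forall k,
  measurable_fun setT (fun p : T * measurableTypeR R => upd k p.1 p.2).
Hypothesis updC : forall k l x s t, k != l ->
  upd k (upd l x s) t = upd l (upd k x t) s.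

(** The space [T] and the update map are kept abstract because two instances occur: row vectors, and
    pairs of a row vector and a height. *)
Definition pint k (f : T -> \bar R) (x : T) : \bar R :=
  \int[nu k]_(t in D k) f (upd k x t).

Definition pints (l : seq I) (f : T -> \bar R) : T -> \bar R := foldr pint f l.

(** These are the points at which [pints l f x] evaluates [f]; integrands need to be compared only
    there, for instance only on the orthant. *)
Fixpoint reach (l : seq I) (x y : T) : Prop :=
  if l is k :: l' then exists2 t, D k t & reach l' (upd k x t) y else y = x.

Definition mnonneg (f : T -> \bar R) :=
  measurable_fun (setT : set T) f /\ forall x, 0 <= f x.

Lemma measurable_upd k x : measurable_fun setT (upd k x : measurableTypeR R -> T).
Proof.
have := measurableT_comp (mupd k) (measurable_fun_pair (measurable_cst x) (@measurable_id _ (measurableTypeR R) setT)).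
exact.
Qed.

Lemma mnonneg_upd k f x : mnonneg f ->
  measurable_fun setT (fun t : measurableTypeR R => f (upd k x t)).
Proof. by move=> [mf _]; exact: measurableT_comp mf (measurable_upd k x). Qed.

Lemma mnonneg_updD k f x A : mnonneg f ->
  measurable_fun A (fun t : measurableTypeR R => f (upd k x t)).
Proof. by move=> hf; exact: measurable_funTS (mnonneg_upd k x hf). Qed.

Lemma pint_ge0 k f x : (forall x, 0 <= f x) -> 0 <= pint k f x.
Proof. by move=> f0; apply: integral_ge0. Qed.

Lemma pints_nonneg l f x : (forall x, 0 <= f x) -> 0 <= pints l f x.
Proof. by move=> f0; elim: l x => //= k l IH x; exact: pint_ge0. Qed.

Lemma mnonneg_pint k f : mnonneg f -> mnonneg (pint k f).
Proof.
move=> [mf f0]; split; last by move=> x; exact: pint_ge0.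
pose g (p : T * measurableTypeR R) := f (upd k p.1 p.2) * (\1_(D k) p.2)%:E.
have mg : measurable_fun setT g.
  apply: emeasurable_funM; first exact: measurableT_comp mf (mupd k).
  apply/measurable_EFinP; apply: measurableT_comp => //.
have g0 p : 0 <= g p by rewrite mule_ge0// lee_fin.
have := measurable_fun_fubini_tonelli_F (m2 := nu k) g mg g0.
congr measurable_fun; apply/funext => x.
rewrite /fubini_F /pint [RHS]integral_mkcond; apply: eq_integral => t _.
by rewrite patchE /g /= indicE; case: ifPn => _; rewrite ?mule1 ?mule0.
Qed.

Lemma mnonneg_pints l f : mnonneg f -> mnonneg (pints l f).
Proof. by elim: l => //= k l IH hf; apply: mnonneg_pint; exact: IH. Qed.

Lemma pints_ge0 l f x : mnonneg f -> 0 <= pints l f x.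
Proof. by move=> /(mnonneg_pints l)[]. Qed.

Lemma le_pint k f g x : mnonneg f -> mnonneg g ->
  (forall t, D k t -> f (upd k x t) <= g (upd k x t)) -> pint k f x <= pint k g x.
Proof.
move=> hf hg fg; apply: ge0_le_integral => //.
- by move=> t _; case: hf.
- exact: mnonneg_updD.
- exact: mnonneg_updD.
Qed.

Lemma eq_pint k f g x : (forall t, D k t -> f (upd k x t) = g (upd k x t)) ->
  pint k f x = pint k g x.
Proof. by move=> fg; apply: eq_integral => t; rewrite inE => /fg. Qed.

Lemma le_pints l f g x : mnonneg f -> mnonneg g ->
  (forall y, reach l x y -> f y <= g y) -> pints l f x <= pints l g x.
Proof.
move=> hf hg; elim: l x => [|k l IH] x /= fg; first exact: fg.
apply: le_pint; [exact: mnonneg_pints..|] => t Dt; apply: IH => y xy.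
by apply: fg; exists t.
Qed.

Lemma eq_pints l f g x : (forall y, reach l x y -> f y = g y) ->
  pints l f x = pints l g x.
Proof.
elim: l x => [|k l IH] x /= fg; first exact: fg.
by apply: eq_pint => t Dt; apply: IH => y xy; apply: fg; exists t.
Qed.

Lemma pintC k l f : mnonneg f -> pint k (pint l f) = pint l (pint k f).
Proof.
have [->//|kl] := eqVneq k l; move=> [mf f0]; apply/funext => x; rewrite /pint.
pose g (p : measurableTypeR R * measurableTypeR R) :=
  f (upd l (upd k x p.1) p.2) * ((\1_(D k) p.1)%:E * (\1_(D l) p.2)%:E).
have mg : measurable_fun setT g.
  apply: emeasurable_funM.
    apply: measurableT_comp mf _.
    have := measurableT_comp (mupd l) (measurable_fun_pair (measurableT_comp (measurable_upd k x) (@measurable_fst _ _ (measurableTypeR R) (measurableTypeR R))) (@measurable_snd _ _ _ _)).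
    exact.
  by apply: emeasurable_funM; apply/measurable_EFinP; apply: measurableT_comp.
have g0 p : 0 <= g p by rewrite mule_ge0// mule_ge0// lee_fin.
have := fubini_tonelli (m1 := nu k) (m2 := nu l) g mg g0.
have -> : \int[nu k]_s \int[nu l]_t g (s, t) =
    \int[nu k]_(s in D k) \int[nu l]_(t in D l) f (upd l (upd k x s) t).
  rewrite [RHS]integral_mkcond; apply: eq_integral => s _.
  rewrite patchE /g /= indicE; case: ifPn => _.
    rewrite [RHS]integral_mkcond; apply: eq_integral => t _.
    by rewrite patchE indicE; case: ifPn => _; rewrite ?mul1e ?mule1 ?mule0.
  by apply: integral0_eq => t _; rewrite mul0e mule0.
move=> ->; rewrite [RHS]integral_mkcond; apply: eq_integral => t _.
rewrite patchE /g /= indicE; case: ifPn => _.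
  rewrite [RHS]integral_mkcond; apply: eq_integral => s _.
  rewrite patchE indicE updC 1?eq_sym//.
  by case: ifPn => _; rewrite ?mul1e ?mule1 ?mule0 ?mul0e.
by apply: integral0_eq => s _; rewrite !mule0.
Qed.

Lemma pints_cat l1 l2 f : pints (l1 ++ l2) f = pints l1 (pints l2 f).
Proof. by rewrite /pints foldr_cat. Qed.

Lemma pint_pintsC k l f : mnonneg f -> pint k (pints l f) = pints l (pint k f).
Proof.
move=> hf; elim: l => //= j l IH.
by rewrite pintC ?IH//; exact: mnonneg_pints.
Qed.

(** Tonelli for two variables suffices: [l2] is rotated until its head is that of [l1], and a
    rotation changes nothing because each single integration commutes with a block of others. *)
Lemma perm_pints l1 l2 f : mnonneg f -> perm_eq l1 l2 -> pints l1 f = pints l2 f.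
Proof.
move=> hf; elim: l1 l2 => [|k l1 IH] l2.
  by move=> /perm_size/esym/size0nil ->.
move=> kl; have : k \in l2 by rewrite -(perm_mem kl) mem_head.
move=> /rot_to[i l3 e].
have {}kl : perm_eq l1 l3.
  by rewrite -(perm_cons k) (perm_trans kl)// -e perm_sym perm_rot.
rewrite (_ : pints l2 f = pints (drop i l2 ++ take i l2) f).
  by rewrite -/(rot i l2) e /= (IH _ kl).
rewrite -[in LHS](cat_take_drop i l2) !pints_cat.
elim: (drop i l2) => //= j s <-.
by rewrite (pint_pintsC _ (take i l2))//; exact: mnonneg_pints.
Qed.

Lemma pintsZl l (c : \bar R) f x : 0 <= c -> mnonneg f ->
  pints l (fun y => c * f y) x = c * pints l f x.
Proof.
move=> c0 hf; elim: l x => //= k l IH x.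
rewrite {1}/pint; under eq_integral do rewrite IH.
rewrite ge0_integralZl//; first by apply: mnonneg_updD; exact: mnonneg_pints.
by move=> t _; exact: pints_ge0.
Qed.

Lemma mnonneg_sum (J : Type) (s : seq J) (f : J -> T -> \bar R) :
  (forall j, mnonneg (f j)) -> mnonneg (fun x => \sum_(j <- s) f j x).
Proof.
move=> hf; split; last by move=> x; apply: sume_ge0 => j _; case: (hf j).
by apply: emeasurable_sum => j; case: (hf j).
Qed.

Lemma pints_sum (J : Type) (s : seq J) l (f : J -> T -> \bar R) x :
  (forall j, mnonneg (f j)) ->
  pints l (fun y => \sum_(j <- s) f j y) x = \sum_(j <- s) pints l (f j) x.
Proof.
move=> hf; elim: l x => //= k l IH x.
rewrite {1}/pint; under eq_integral do rewrite IH.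
rewrite ge0_integral_sum//.
  by move=> j; apply: mnonneg_updD; exact: mnonneg_pints.
by move=> j t _; exact: pints_ge0.
Qed.

Lemma pints_nneseries l (f : (T -> \bar R)^nat) x : (forall j, mnonneg (f j)) ->
  pints l (fun y => \sum_(j <oo) f j y) x = \sum_(j <oo) pints l (f j) x.
Proof.
move=> hf; elim: l x => //= k l IH x.
rewrite {1}/pint; under eq_integral do rewrite IH.
rewrite integral_nneseries//.
  by move=> j; apply: mnonneg_updD; exact: mnonneg_pints.
by move=> j t _; exact: pints_ge0.
Qed.

Lemma pints_upd_id k l f x t : k \notin l ->
  (forall y s, f (upd k y s) = f y) -> pints l f (upd k x t) = pints l f x.
Proof.
move=> + fk; elim: l x => [|j l IH] x /=; first by rewrite fk.
rewrite in_cons negb_or => /andP[kj kl].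
by apply: eq_integral => s _; rewrite updC 1?eq_sym// IH.
Qed.

(** Fubini for disjoint blocks of variables: [f j] depends only on the coordinates of block [j], so
    for the integration over [k] all factors except the one with index [c k] are constants. *)
Lemma pints_prod (J : finType) (c : I -> J) l (f : J -> T -> \bar R) x :
  (forall j, mnonneg (f j)) ->
  (forall j k y t, c k != j -> f j (upd k y t) = f j y) ->
  pints l (fun y => \prod_j f j y) x =
  \prod_j pints [seq k <- l | c k == j] (f j) x.
Proof.
move=> hf fc; elim: l x => [//|k l IH] x.
rewrite /pints /= -/(pints _ _) {1}/pint; under eq_integral do rewrite IH.
rewrite (bigD1 (c k))//= eqxx /= {2}/pint.
under eq_integral => t _.
  rewrite (bigD1 (c k))//=.
  under eq_bigr => j jk.
    rewrite pints_upd_id; last 2 first.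
    - by rewrite mem_filter (eq_sym (c k)) (negbTE jk).
    - by move=> y s; rewrite fc// eq_sym.
    over.
  over.
rewrite ge0_integralZr//.
- congr (_ * _); apply: eq_bigr => j jk.
  by rewrite [c k == j]eq_sym (negbTE jk).
- by apply: mnonneg_updD; exact: mnonneg_pints.
- by move=> t _; exact: pints_ge0.
- by apply: prode_ge0 => j _; exact: pints_ge0.
Qed.

End IteratedIntegral.

(** * Borel sets of row vectors *)

Section RowVectors.
Context (R : realType) (n : nat).
Notation V := (borel_rV R n).

Definition upd (k : 'I_n) (x : 'rV[R]_n) (t : R) : 'rV[R]_n :=
  \row_j (if j == k then t else x 0 j).

Definition box (A : 'I_n -> set R) : set 'rV[R]_n :=
  [set x | forall k, A k (x 0 k)].

Lemma updE k x t j : upd k x t 0 j = if j == k then t else x 0 j.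
Proof. by rewrite mxE. Qed.

Lemma upd_comm k l x s t : k != l ->
  upd k (upd l x s) t = upd l (upd k x t) s.
Proof.
move=> kl; apply/rowP => j; rewrite !updE.
by case: eqVneq => [->|//]; rewrite (negbTE kl).
Qed.

Lemma measurable_coord (k : 'I_n) :
  measurable_fun setT (fun x : V => x 0 k : measurableTypeR R).
Proof.
apply: (measurability _ (RGenOpens.measurableE R)) => _ [_ [a [b ->] <-]].
rewrite setTI; apply: sub_sigma_algebra => /=.
by have /continuousP := @coord_continuous R 1 n 0 k; apply; exact: interval_open.
Qed.

Lemma measurable_box (A : 'I_n -> set (measurableTypeR R)) :
  (forall k, measurable (A k)) -> measurable (box A : set V).
Proof.
move=> mA; rewrite (_ : box A = \bigcap_(k in setT) (fun x : V => x 0 k) @^-1` A k).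
  apply: fin_bigcap_measurable => // k _.
  by rewrite -[X in measurable X]setTI; exact: measurable_coord.
by apply/seteqP; split => [x Ax k _|x Ax k]; exact: Ax.
Qed.

(** Second countability by rational boxes, enumerated through [pickle]. The second set of each
    intersection is everything or empty; it discards the boxes not contained in [U] while the index
    still runs over all of [nat]. *)
Lemma open_bigcup_box (U : set 'rV[R]_n) : open U ->
  exists F : nat -> ('I_n -> R * R),
    U = \bigcup_i (box (fun k => `](F i k).1, (F i k).2[%classic) `&`
        [set _ | box (fun k => `](F i k).1, (F i k).2[%classic) `<=` U]).
Proof.
move=> oU.
pose dec i : 'I_n -> R * R := fun k =>
  if (unpickle i : option {ffun 'I_n -> rat * rat}) is Some f
  then (ratr (f k).1, ratr (f k).2) else (0, 0).
exists dec; apply/seteqP; split => [x Ux|x [i _ [xi /= iU]]]; last exact: iU.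
have [P Px PU] : nbhs x U by exact: open_nbhs_nbhs.
have hb k : exists q : rat * rat,
    ratr q.1 < x 0 k < ratr q.2 /\ `](ratr q.1), (ratr q.2)[ `<=` P 0 k.
  have /nbhs_ballP[e /= e0 eP] := Px 0 k.
  have /rat_in_itvoo[q1] : x 0 k - e < x 0 k by rewrite ltrBlDr ltrDl.
  rewrite in_itv /= => /andP[q1l q1r].
  have /rat_in_itvoo[q2] : x 0 k < x 0 k + e by rewrite ltrDl.
  rewrite in_itv /= => /andP[q2l q2r].
  exists (q1, q2); split => /=; first by rewrite q1r q2l.
  move=> y; rewrite /= in_itv => /andP[y1 y2]; apply: eP => /=.
  rewrite /ball /= ltr_distlC; apply/andP; split; first exact: lt_trans y1.
  exact: lt_trans q2r.
pose f : {ffun 'I_n -> rat * rat} := [ffun k => projT1 (cid (hb k))].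
exists (pickle f) => //; rewrite /dec pickleK /=; split => [k|y /= yf].
  by rewrite /= ffunE in_itv /=; case: (cid (hb k)) => q [].
apply: PU => i j; rewrite (ord1 i); have := yf j; rewrite /= ffunE.
by case: (cid (hb j)) => q /= [_]; apply.
Qed.

Lemma measurable_rV d (T : measurableType d) (f : T -> V) :
  (forall k, measurable_fun setT (fun x => f x 0 k : measurableTypeR R)) ->
  measurable_fun setT f.
Proof.
move=> mf; apply: (@measurability _ _ T V setT f (@open 'rV[R]_n) erefl) => _ [U oU <-].
rewrite setTI; have [F ->] := open_bigcup_box oU.
rewrite preimage_bigcup; apply: bigcupT_measurable => i.
have [h|h] := pselect (box (fun k => `](F i k).1, (F i k).2[%classic) `<=` U);
  last by rewrite (_ : _ @^-1` _ = set0)//; apply/seteqP; split => // x /= [].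
rewrite (_ : _ @^-1` _ = \bigcap_(k in setT) (fun x => f x 0 k) @^-1` `](F i k).1, (F i k).2[%classic).
  apply: fin_bigcap_measurable => // k _.
  by rewrite -[X in measurable X]setTI; apply: mf => //; exact: measurable_itv.
apply/seteqP; split => x /=; first by move=> [xF _] k _; exact: xF.
by move=> xF; split => // k; exact: (xF k).
Qed.

Lemma measurable_upd2 k :
  measurable_fun setT (fun p : V * measurableTypeR R => upd k p.1 p.2 : V).
Proof.
apply: measurable_rV => j; under eq_fun do rewrite updE.
case: (j == k); first exact: measurable_snd.
exact: measurableT_comp (measurable_coord j) (@measurable_fst _ _ V (measurableTypeR R)).
Qed.

(** A product measure is prescribed on boxes, whereas the Borel sets come from open sets. Boxes are
    stable under intersection, so this generating family allows two measures to be identified. *)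
Lemma borel_rV_boxE : @measurable _ V =
  <<s [set B | exists2 A : 'I_n -> set (measurableTypeR R),
                 (forall k, measurable (A k)) & B = box A] >>.
Proof.
apply/seteqP; split; last first.
  apply: smallest_sub; first exact: sigma_algebra_measurable.
  by move=> _ [A mA ->]; exact: measurable_box.
apply: smallest_sub; first exact: smallest_sigma_algebra.
move=> U oU; have [F ->] := open_bigcup_box oU.
have [_ _ sU] := smallest_sigma_algebra setT [set B | exists2 A : 'I_n -> set (measurableTypeR R),
                 (forall k, measurable (A k)) & B = box A].
apply: sU => i.
have [h|h] := pselect (box (fun k => `](F i k).1, (F i k).2[%classic) `<=` U).
  rewrite (_ : _ `&` _ = box (fun k => `](F i k).1, (F i k).2[%classic)).
    apply: (@sub_sigma_algebra _ setT).
    exists (fun k => `](F i k).1, (F i k).2[%classic) => // k; exact: (@measurable_itv R `](F i k).1, (F i k).2[).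
  by apply/seteqP; split => x /=; [case|].
rewrite (_ : _ `&` _ = set0); last by apply/seteqP; split => // x /= [].
exact: sigma_algebra0.
Qed.

End RowVectors.

(** * Even measures with decreasing density *)

Section DecreasingDensity.
Local Open Scope ereal_scope.
Context (R : realType).

(* What is retained of a decreasing density is the concavity of
   [a |-> nu [0, a]]. *)
Record dec_measure (nu : set (measurableTypeR R) -> \bar R) : Prop := DecMeasure {
  dec_fin : forall a : R, nu `[(- a)%R, a]%classic < +oo ;
  dec_set1 : forall a : R, nu [set a] = 0 ;
  dec_even : forall a : R, nu `[(- a)%R, 0%R]%classic = nu `[0%R, a]%classic ;
  dec_concave : forall a b t : R,
    (0 <= a)%R -> (0 <= b)%R -> (0 <= t)%R -> (t <= 1)%R ->
    (1 - t)%:E * nu `[0%R, a]%classic + t%:E * nu `[0%R, b]%classic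
      <= nu `[0%R, ((1 - t) * a + t * b)%R]%classic }.

Variable phi : measurableTypeR R -> \bar R.
Variable nu : {measure set (measurableTypeR R) -> \bar R}.
Hypothesis hphi : even_decreasing_density phi.
Hypothesis hnu : has_density nu phi.

Lemma measurable_density (a b : R) (X : set R) : X `<=` `[a, b] ->
  measurable_fun (X : set (measurableTypeR R)) phi.
Proof.
case: hphi => _ hi _ _ Xab.
have /hi /integrableP[mphi _] : compact `[a, b]%classic by exact: segment_compact.
by apply: measurable_funS mphi => //; exact: measurable_itv.
Qed.

Lemma density_fin (a : R) : nu `[(- a)%R, a]%classic < +oo.
Proof.
case: hphi => h0 hi _ _; rewrite hnu; last exact: measurable_itv.
have /hi /integrableP[_] : compact `[(- a)%R, a]%classic by exact: segment_compact.
by under eq_integral do rewrite gee0_abs//.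
Qed.

Lemma density_set1 (a : R) : nu [set a] = 0.
Proof. by rewrite hnu ?integral_set1//; exact: measurable_set1. Qed.

Lemma density_even (a : R) : nu `[(- a)%R, 0%R]%classic = nu `[0%R, a]%classic.
Proof.
case: hphi => h0 _ he _; rewrite !hnu; try exact: measurable_itv.
pose opp : measurableTypeR R -> measurableTypeR R := -%R.
have mopp : measurable_fun setT opp by exact: oppr_measurable.
transitivity (\int[pushforward (@lebesgue_measure R) opp]_(x in `[(- a)%R, 0%R]) phi x).
  apply: eq_measure_integral => A mA _; exact/esym/lebesgue_measureN.
rewrite ge0_integral_pushforward//; last first.
  exact: (@measurable_density (- a)%R 0%R).
rewrite (_ : _ @^-1` _ = `[0%R, a]%classic).
  by apply: eq_integral => x _ /=; rewrite he.
by apply/seteqP; split => x /=; rewrite !in_itv /= /opp lerN2 oppr_le0 andbC.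
Qed.

(** Monotonicity of [phi] compares both pieces with the constant [phi c]: the mass of []a, c]] is at
    least [phi c * (c - a)], that of []c, b]] is at most [phi c * (b - c)], and
    [t * (b - c) = (1 - t) * (c - a)]. *)
Lemma density_concave (a b t : R) :
  (0 <= a)%R -> (a <= b)%R -> (0 <= t)%R -> (t <= 1)%R ->
  (1 - t)%:E * nu `[0%R, a]%classic + t%:E * nu `[0%R, b]%classic
      <= nu `[0%R, ((1 - t) * a + t * b)%R]%classic.
Proof.
move=> a0 ab t0 t1; set c := ((1 - t) * a + t * b)%R.
have ac : (a <= c)%R by rewrite /c; nra.
have cb : (c <= b)%R by rewrite /c; nra.
case: hphi => h0 hi _ hd.
have fin x y : (0 <= x)%R -> (y <= b)%R -> nu `]x, y]%classic \is a fin_num /\ nu `[x, y]%classic \is a fin_num.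
  move=> x0 yb; split; rewrite ge0_fin_numE//; apply: le_lt_trans (density_fin b);
  apply: le_measure; rewrite ?inE; try exact: measurable_itv;
  move=> z /=; rewrite !in_itv /=; lra.
have split2 x y : (0 <= x)%R -> (x <= y)%R -> (y <= b)%R ->
    nu `[0%R, y]%classic = nu `[0%R, x]%classic + nu `]x, y]%classic.
  move=> x0 xy yb; rewrite -measureU; try exact: measurable_itv.
    congr (nu _); apply/seteqP; split => z /=; rewrite !in_itv /=; last by case; lra.
    by move=> /andP[z0 zy]; have [zx|zx] := leP z x; [left|right]; rewrite ?z0 ?zy.
  by apply/seteqP; split => // z /=; rewrite !in_itv /=; lra.
have lo : phi c * (c - a)%:E <= nu `]a, c]%classic.
  rewrite hnu; last exact: measurable_itv.
  apply: (@le_trans _ _ (\int[@lebesgue_measure R]_(x in `]a, c]) cst (phi c) x)).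
    rewrite integral_cst; last exact: measurable_itv.
    rewrite /= lebesgue_measure_itv /= lte_fin -EFinB; case: ltP => [//|ca]; rewrite (_ : (c - a = 0)%R) ?mule0//; lra.
  apply: ge0_le_integral => //; first by move=> x _; exact: h0.
    apply: (@measurable_density a c) => z /=; rewrite !in_itv /=; lra.
  by move=> x /=; rewrite in_itv /= => /andP[ax xc]; apply: hd => //; lra.
have hi2 : nu `]c, b]%classic <= phi c * (b - c)%:E.
  rewrite hnu; last exact: measurable_itv.
  apply: (@le_trans _ _ (\int[@lebesgue_measure R]_(x in `]c, b]) cst (phi c) x)).
    apply: ge0_le_integral => //.
      apply: (@measurable_density c b) => z /=; rewrite !in_itv /=; lra.
    move=> x /=; rewrite in_itv /= => /andP[ax xc]; apply: hd => //; first lra.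
    exact: ltW.
  rewrite integral_cst; last exact: measurable_itv.
  rewrite /= lebesgue_measure_itv /= lte_fin -EFinB; case: ltP => [//|ca]; rewrite (_ : (b - c = 0)%R) ?mule0//; lra.
have key : t%:E * nu `]c, b]%classic <= (1 - t)%:E * nu `]a, c]%classic.
  apply: (@le_trans _ _ (t%:E * (phi c * (b - c)%:E))).
    by apply: lee_wpmul2l => //; rewrite lee_fin.
  apply: (@le_trans _ _ ((1 - t)%:E * (phi c * (c - a)%:E))); last first.
    by apply: lee_wpmul2l => //; rewrite lee_fin subr_ge0.
  (* [phi c] may be infinite, so it is kept as a common factor and only its two real coefficients
     are identified. *)
  rewrite muleCA [leRHS]muleCA -!EFinM (_ : t * (b - c) = (1 - t) * (c - a))%R//.
  by rewrite /c; ring.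
have [f1 f2] := fin 0%R a (lexx _) ab.
have [f3 _] := fin a c a0 cb.
have [f4 _] := fin c b (le_trans a0 ac) (lexx _).
rewrite (split2 c b)//; last exact: le_trans ac.
rewrite (split2 a c)//; move: key.
rewrite -(fineK f2) -(fineK f3) -(fineK f4) -!(EFinM, EFinD) !lee_fin; nra.
Qed.

Lemma density_dec_measure : dec_measure nu.
Proof.
split=> [a|a|a|a b t a0 b0 t0 t1].
- exact: density_fin.
- exact: density_set1.
- exact: density_even.
have [ab|ba] := leP a b; first exact: density_concave.
have h := @density_concave b a (1 - t) b0 (ltW ba).
rewrite subKr in h; rewrite addeC (addrC ((1 - t) * a)%R); apply: h; lra.
Qed.

Lemma density_sigma_finite : sigma_finite setT nu.
Proof.
exists (fun k => `[(- k%:R)%R, k%:R]%classic).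
  apply/esym; rewrite -subTset => x _.
  exists (Num.bound `|x|%R) => //=; rewrite in_itv /= -ler_norml.
  exact/ltW/archi_boundP.
by move=> k; split; [exact: measurable_itv|exact: density_fin].
Qed.

End DecreasingDensity.

Section SigmaFinite.
Context (R : realType) (nu : {measure set (measurableTypeR R) -> \bar R}).
Hypothesis nu_sf : sigma_finite setT nu.

(* The proof is an argument of the copy so that the sigma-finite structure can be
   attached to it. *)
Definition sigma_finite_copy of sigma_finite setT nu := Measure.sort nu.
Notation copy := (sigma_finite_copy nu_sf).
HB.instance Definition _ := Measure.on copy.
HB.instance Definition _ := Measure_isSigmaFinite.Build _ _ _ copy nu_sf.

Lemma sigma_finite_copy_exists :
  exists nu' : {sigma_finite_measure set (measurableTypeR R) -> \bar R},
    nu' = nu :> (set _ -> \bar R).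
Proof. by exists copy. Qed.

End SigmaFinite.

(** * Product measures on row vectors *)

Section ProductMeasure.
Local Open Scope ereal_scope.
Context (R : realType) (n : nat).
Notation V := (borel_rV R n).
Variable nu : 'I_n -> {sigma_finite_measure set (measurableTypeR R) -> \bar R}.

Definition eindic (S : set V) (x : V) : \bar R := (\1_S x)%:E.

Lemma mnonneg_eindic (S : set V) : measurable S -> mnonneg (eindic S).
Proof.
move=> mS; split; last by move=> x; rewrite lee_fin.
by apply/measurable_EFinP; exact: measurable_indic.
Qed.

Notation fullints := (pints nu (fun=> setT) (@upd R n : 'I_n -> V -> R -> V)).

(** The product measure is taken as an iterated integral so that every use of Fubini becomes an
    operation on lists of coordinates. *)
Definition prodmeas (S : set V) : \bar R := fullints (enum 'I_n) (eindic S) 0%R.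

Let mD (k : 'I_n) : measurable (setT : set (measurableTypeR R)).
Proof. exact: measurableT. Qed.

Lemma eindic_box (A : 'I_n -> set R) (x : V) :
  eindic (box A) x = \prod_k (\1_(A k) (x 0%R k))%:E.
Proof.
rewrite /eindic prodEFin; congr _%:E; rewrite indicE.
have [|/asboolPn/asboolP xA] := boolP (x \in box A).
  by rewrite inE => xA; rewrite big1// => k _; rewrite indicE mem_set.
have /existsNP[k xk] : ~ (forall k, A k (x 0%R k)) by move: xA; rewrite in_setE.
by rewrite (bigD1 k)//= indicE memNset// mul0r.
Qed.

Lemma mnonneg_coord (k : 'I_n) (A : set (measurableTypeR R)) : measurable A ->
  mnonneg (fun x : V => (\1_A (x 0%R k))%:E : \bar R).
Proof.
move=> mA; split; last by move=> x; rewrite lee_fin.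
apply/measurable_EFinP.
have := measurableT_comp (measurable_indic (D := setT) mA) (measurable_coord k).
by move=> h; apply: h.
Qed.

Lemma prodmeas_box (A : 'I_n -> set (measurableTypeR R)) :
  (forall k, measurable (A k)) -> prodmeas (box A) = \prod_k nu k (A k).
Proof.
move=> mA; transitivity (fullints (enum 'I_n) (fun x => \prod_k (\1_(A k) (x 0%R k))%:E) 0%R).
  by apply: eq_pints => y _; rewrite eindic_box.
rewrite (pints_prod _ mD (@measurable_upd2 R n) (@upd_comm R n) (c := id)).
- apply: eq_bigr => k _.
  rewrite (_ : [seq _ <- _ | _] = [:: k]).
    rewrite /= /pint; under eq_integral do rewrite updE eqxx.
    by rewrite integral_indic// setIT.
  rewrite (eq_filter (a2 := pred1 k))// filter_pred1_uniq// ?enum_uniq//.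
  by rewrite mem_enum.
- by move=> k; exact: mnonneg_coord.
- by move=> j k y t kj; rewrite updE eq_sym (negbTE kj).
Qed.

Let prodmeas0 : prodmeas set0 = 0.
Proof.
rewrite /prodmeas (_ : eindic set0 = fun x => 0 * eindic set0 x).
  by rewrite (pintsZl _ mD (@measurable_upd2 R n))// ?mul0e//; exact: mnonneg_eindic.
by apply/funext => x; rewrite /eindic indic0 mul0e.
Qed.

Let prodmeas_ge0 S : 0 <= prodmeas S.
Proof.
by apply: pints_nonneg => x; rewrite lee_fin. Qed.

Let prodmeas_sigma_additive : semi_sigma_additive prodmeas.
Proof.
move=> F mF tF mUF.
rewrite [X in _ --> X](_ : _ = \sum_(k <oo) prodmeas (F k)).
  by apply: is_cvg_nneseries => k _.
rewrite /prodmeas -(pints_nneseries _ mD (@measurable_upd2 R n)); last first.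
  by move=> k; exact: mnonneg_eindic.
apply: eq_pints => x _; rewrite /eindic.
rewrite -[LHS]/(\d_x (\bigcup_k F k)) measure_bigcup//=.
rewrite (eq_eseriesl (Q := xpredT)) => [|k]; last by rewrite in_setT.
by apply: eq_eseriesr => k _; rewrite diracE indicE.
Qed.

HB.instance Definition _ := isMeasure.Build _ _ _ prodmeas
  prodmeas0 prodmeas_ge0 prodmeas_sigma_additive.

(** Boxes form a generating pi-system on which both measures agree, and the cubes [[-i, i]^n]
    exhaust the space with finite measure by [dec_fin]. *)
Lemma prodmeas_unique (mu : {measure set V -> \bar R}) :
  (forall k, dec_measure (nu k)) ->
  (forall A : 'I_n -> set (measurableTypeR R), (forall k, measurable (A k)) ->
    mu (box A) = \prod_k nu k (A k)) ->
  forall S, measurable S -> mu S = prodmeas S.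
Proof.
move=> hnu hmu S mS.
pose pm : {measure set V -> \bar R} := prodmeas.
rewrite -[RHS]/(pm S).
apply: (@measure_unique _ R V [set B | exists2 A : 'I_n -> set (measurableTypeR R),
                 (forall k, measurable (A k)) & B = box A]
   (fun i => box (fun=> `[(- i%:R)%R, i%:R]%classic)) _ _ _ _ mu pm) => //.
- exact: borel_rV_boxE.
- move=> _ _ [A mA ->] [B mB ->]; exists (fun k => A k `&` B k).
    by move=> k; exact: measurableI.
  apply/seteqP; split => x /=; first by move=> [xA xB] k.
  by move=> xAB; split => k; have [] := xAB k.
- by move=> i; exists (fun=> `[(- i%:R)%R, i%:R]%classic).
- rewrite -subTset => x _; exists (\max_k Num.bound `|x 0%R k|) => //= k /=.
  rewrite in_itv /= -ler_norml; apply: (@le_trans _ _ (Num.bound `|x 0%R k|)%:R).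
    exact/ltW/archi_boundP.
  by rewrite ler_nat; exact: leq_bigmax.
- by move=> _ [A mA ->]; rewrite hmu//= prodmeas_box.
- move=> i; rewrite hmu//.
  have : \prod_k nu k `[(- i%:R)%R, i%:R]%classic \is a fin_num.
    by apply: prode_fin_num => k _; rewrite ge0_fin_numE//; exact: dec_fin.
  by rewrite ge0_fin_numE//; apply: prode_ge0.
Qed.

End ProductMeasure.

(** * One-dimensional inequalities *)

Section LayerCake.
Local Open Scope ereal_scope.
Context (R : realType).
Local Notation leb := (@lebesgue_measure R).

Definition half : set (measurableTypeR R) := `[0%R, +oo[%classic.

(** Relative heights. The height 0 is left out because the superlevel set there is the whole space,
    whose measure may be infinite. *)
Definition unit_itv : set (measurableTypeR R) := `]0%R, 1%R]%classic.

Definition level (e : \bar R) (c s : R) : \bar R :=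
  (\1_[set s : R | ((s * c)%:E <= e)%E] s)%:E.

Lemma level_ge0 e c s : 0 <= level e c s.
Proof. by rewrite lee_fin. Qed.

Lemma measurable_unit_itv : measurable unit_itv.
Proof. exact: measurable_itv. Qed.

Lemma mnonneg_level d (T : measurableType d) (f : T -> \bar R) c :
  mnonneg f ->
  mnonneg (fun p : T * measurableTypeR R => level (f p.1) c p.2).
Proof.
move=> [mf _]; split; last by move=> p; exact: level_ge0.
rewrite (_ : (fun _ => _) = fun p : T * measurableTypeR R =>
    (\1_[set p : T * measurableTypeR R | ((p.2 * c)%:E <= f p.1)%E] p)%:E).
  apply/measurable_EFinP; apply: measurable_indic.
  rewrite -[X in measurable X]setTI; apply: measurable_lee => //.
    apply/measurable_EFinP; apply: measurable_funM => //.
  exact: measurableT_comp mf (@measurable_fst _ _ T (measurableTypeR R)).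
by apply/funext => p; rewrite /level !indicE; congr (_%:R%:E); apply/idP/idP; rewrite !inE.
Qed.

Lemma integral_level (e : \bar R) (c : R) : (0 < c)%R -> 0 <= e ->
  c%:E * \int[leb]_(s in unit_itv) level e c s = Order.min e c%:E.
Proof.
move=> c0 e0.
have -> : \int[leb]_(s in unit_itv) level e c s =
    leb ([set s : R | ((s * c)%:E <= e)%E] `&` unit_itv).
  rewrite /level integral_indic//; first exact: measurable_unit_itv.
  rewrite -[X in measurable X]setTI.
  apply: (@measurable_lee _ (measurableTypeR R)) => //.
  by apply/measurable_EFinP; apply: measurable_funM.
case: e e0 => [e e0| _|//]; last first.
  rewrite (_ : _ `&` _ = unit_itv); last first.
    by apply/seteqP; split => x /=; [case|move=> ?; split => //; rewrite leey].
  rewrite /unit_itv lebesgue_measure_itv /= lte_fin ltr01 sube0 mule1.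
  by rewrite min_r// leey.
have [ec|ce] := leP e%:E c%:E.
  rewrite (_ : _ `&` _ = `]0%R, (e / c)%R]%classic); last first.
    apply/seteqP; split => x /=; rewrite /unit_itv /= ?in_itv /= ?lee_fin ler_pdivlMr//.
      by move=> [-> /andP[-> _]].
    move=> /andP[x0 xe]; split => //; rewrite x0 /=.
    by rewrite -(ler_pM2r c0) mul1r (le_trans xe).
  rewrite lebesgue_measure_itv /= lte_fin.
  move: e0; rewrite lee_fin le_eqVlt => /predU1P[<-|e0].
    by rewrite mul0r ltxx mule0.
  by rewrite divr_gt0// sube0 -EFinM mulrC divfK// gt_eqF.
rewrite (_ : _ `&` _ = unit_itv); last first.
  apply/seteqP; split => x /=; first by case.
  move=> x01; split => //; move: x01 ce; rewrite /unit_itv /= in_itv /= !lte_fin => /andP[x0 x1] ce.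
  rewrite lee_fin (le_trans _ (ltW ce))// -[leRHS]mul1r ler_wpM2r//; exact: ltW.
by rewrite /unit_itv lebesgue_measure_itv /= lte_fin ltr01 sube0 mule1.
Qed.

End LayerCake.
Arguments unit_itv : clear implicits.
Arguments half : clear implicits.


Section OneDim.
Local Open Scope ereal_scope.
Context (R : realType).
Local Notation leb := (@lebesgue_measure R).
Variable nu : {sigma_finite_measure set (measurableTypeR R) -> \bar R}.

Lemma measurable_half : measurable (half R).
Proof. exact: measurable_itv. Qed.

Lemma measurable_level_measure (f : measurableTypeR R -> \bar R) (c : R) :
  mnonneg f -> measurable_fun (setT : set (measurableTypeR R))
    (fun s : measurableTypeR R => nu (half R `&` [set x | ((s * c)%:E <= f x)%E])).
Proof.
move=> hf.
pose g (p : measurableTypeR R * measurableTypeR R) :=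
  (\1_(half R) p.1)%:E * level (f p.1) c p.2.
have mg : measurable_fun setT g.
  apply: emeasurable_funM; last by case: (mnonneg_level c hf).
  apply/measurable_EFinP; apply: measurableT_comp => //.
  by apply: measurable_indic; exact: measurable_half.
have g0 p : 0 <= g p by rewrite mule_ge0 ?level_ge0 ?lee_fin.
have := measurable_fun_fubini_tonelli_G (m1 := nu) g mg g0.
congr measurable_fun; apply/funext => s; rewrite /fubini_G /g /=.
have ms : measurable (half R `&` [set x | ((s * c)%:E <= f x)%E]).
  by apply: emeasurable_fun_c_infty; [exact: measurable_half|apply: measurable_funTS; case: hf].
rewrite -[in RHS](setIT (half R `&` _)) -integral_indic//; apply: eq_integral => x _.
rewrite -EFinM; congr _%:E; rewrite !indicE -natrM mulnb; congr (_%:R).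
by rewrite in_setI; congr (_ && _); apply/idP/idP; rewrite !inE.
Qed.

(** Tonelli for the region below the graph; only heights up to [c] are integrated, hence the
    truncation at [c]. *)
Lemma layer_cake (f : measurableTypeR R -> \bar R) (c : R) :
  mnonneg f -> (0 < c)%R ->
  \int[nu]_(x in (half R)) Order.min (f x) c%:E =
  c%:E * \int[leb]_(s in (unit_itv R)) nu ((half R) `&` [set x | ((s * c)%:E <= f x)%E]).
Proof.
move=> hf c0.
pose g (p : measurableTypeR R * measurableTypeR R) :=
  (\1_(half R) p.1)%:E * (level (f p.1) c p.2 * (\1_(unit_itv R) p.2)%:E).
have mg : measurable_fun setT g.
  apply: emeasurable_funM.
    apply/measurable_EFinP; apply: measurableT_comp => //.
    by apply: measurable_indic; exact: measurable_half.
  apply: emeasurable_funM; first by case: (mnonneg_level c hf).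
  apply/measurable_EFinP; apply: measurableT_comp => //.
  by apply: measurable_indic; exact: measurable_unit_itv.
have g0 p : 0 <= g p by rewrite mule_ge0 ?mule_ge0 ?level_ge0 ?lee_fin.
have := fubini_tonelli (m1 := nu) (m2 := leb) g mg g0.
have -> : \int[nu]_x \int[leb]_s g (x, s) =
    \int[nu]_(x in (half R)) \int[leb]_(s in (unit_itv R)) level (f x) c s.
  rewrite [RHS]integral_mkcond; apply: eq_integral => x _.
  rewrite patchE /g /= indicE; case: ifPn => _; last first.
    by apply: integral0_eq => s _; rewrite mul0e.
  rewrite [RHS]integral_mkcond; apply: eq_integral => s _.
  by rewrite patchE indicE mul1e; case: ifPn => _; rewrite ?mule1 ?mule0.
have -> : \int[leb]_s \int[nu]_x g (x, s) =
    \int[leb]_(s in (unit_itv R)) nu ((half R) `&` [set x | ((s * c)%:E <= f x)%E]).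
  rewrite [RHS]integral_mkcond; apply: eq_integral => s _.
  rewrite patchE /g /= indicE; case: ifPn => _; last first.
    by apply: integral0_eq => x _; rewrite !mule0.
  have ms : measurable ((half R) `&` [set x | ((s * c)%:E <= f x)%E]).
    by apply: emeasurable_fun_c_infty; [exact: measurable_half|apply: measurable_funTS; case: hf].
  rewrite -[in RHS](setIT ((half R) `&` _)) -integral_indic//; apply: eq_integral => x _.
  rewrite mule1 -EFinM; congr _%:E; rewrite !indicE -natrM mulnb; congr (_%:R).
  by rewrite in_setI; congr (_ && _); apply/idP/idP; rewrite !inE.
move=> <-.
have [mf f0] := hf.
under [in RHS]eq_integral => x _.
  rewrite (_ : \int[leb]_(s in _) _ = (c^-1)%:E * Order.min (f x) c%:E); last first.
    by rewrite -integral_level// muleA -EFinM mulVf ?gt_eqF// mul1e.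
  over.
have min0 x : 0 <= Order.min (f x) c%:E by rewrite le_min f0 lee_fin ltW.
rewrite ge0_integralZl ?lee_fin ?invr_ge0 ?(ltW c0)//.
- by rewrite muleA -EFinM mulfV ?gt_eqF// mul1e.
- exact: measurable_half.
- by apply: measurable_funTS; exact: measurable_mine.
Qed.

Hypothesis hnu : dec_measure nu.

(** On the half-line a bounded set closed downwards is an interval starting at 0, and [a] is its
    supremum. As [a] need not belong to the set, only the points [r * a] with [r < 1] are
    claimed. *)
Lemma measure_downset_le (X : set R) (M : R) :
  measurable (half R `&` X) -> X 0%R ->
  (forall a, X a -> (a <= M)%R) ->
  (forall a b, X a -> (0 <= b)%R -> (b <= a)%R -> X b) ->
  exists a : R, [/\ (0 <= a)%R, nu (half R `&` X) <= nu `[0%R, a]%classic &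
    forall r, (0 <= r)%R -> (r < 1)%R -> X (r * a)%R].
Proof.
move=> mX X0 XM Xd.
have hX : has_sup (half R `&` X).
  split; first by exists 0%R; split => //; rewrite /half /= in_itv /= lexx.
  by exists M => x [_]; exact: XM.
have h0 : (half R `&` X) 0%R by split => //; rewrite /half /= in_itv /= lexx.
have a0 : (0 <= sup (half R `&` X))%R by exact: sup_upper_bound.
exists (sup (half R `&` X)); split => //.
  apply: le_measure; rewrite ?inE//.
  move=> x [x0 xX]; rewrite /= in_itv /=; apply/andP; split.
    by move: x0; rewrite /half /= in_itv /= andbT.
  exact: sup_upper_bound.
move=> r r0 r1; have [->|/negbTE an0] := eqVneq (sup (half R `&` X)) 0%R; first by rewrite mulr0.
have {}a0 : (0 < sup (half R `&` X))%R by rewrite lt_neqAle a0 eq_sym an0.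
have [|x [x0 xX] xs] := @sup_adherent _ (half R `&` X) (sup (half R `&` X) * (1 - r))%R _ hX.
  by rewrite mulr_gt0// subr_gt0.
apply: Xd xX _ _; first by rewrite mulr_ge0// ltW.
by apply/ltW; move: xs; lra.
Qed.

(** One-dimensional Brunn-Minkowski for [nu]: up to endpoints [X] and [Y] are intervals [[0, a]] and
    [[0, b]], so that the claim reduces to [dec_concave]. *)
Lemma dec_measure_conv (X Y Z : set R) (M t : R) :
  (0 <= t)%R -> (t <= 1)%R ->
  measurable (half R `&` X) -> measurable (half R `&` Y) ->
  measurable (half R `&` Z) -> X 0%R -> Y 0%R ->
  (forall a, X a -> (a <= M)%R) -> (forall a, Y a -> (a <= M)%R) ->
  (forall a b, X a -> (0 <= b)%R -> (b <= a)%R -> X b) ->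
  (forall a b, Y a -> (0 <= b)%R -> (b <= a)%R -> Y b) ->
  (forall a b, (0 <= a)%R -> (0 <= b)%R -> X a -> Y b -> Z ((1 - t) * a + t * b)%R) ->
  (1 - t)%:E * nu (half R `&` X) + t%:E * nu (half R `&` Y) <= nu (half R `&` Z).
Proof.
move=> t0 t1 mX mY mZ X0 Y0 XM YM Xd Yd XYZ.
have [a [a0 Xa ra]] := measure_downset_le mX X0 XM Xd.
have [b [b0 Yb rb]] := measure_downset_le mY Y0 YM Yd.
set c := ((1 - t) * a + t * b)%R.
have c0 : (0 <= c)%R by rewrite /c; nra.
apply: (@le_trans _ _ (nu `[0%R, c]%classic)).
  apply: le_trans (dec_concave hnu a0 b0 t0 t1).
  by apply: leeD; apply: lee_wpmul2l => //; rewrite lee_fin// subr_ge0.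
(* The endpoints need not be attained, so the claim is proved up to a factor [r < 1]; concavity
   again gives [r * nu [0, c] <= nu [0, r * c]]. *)
apply/lee_mul01Pr => // r /andP[r0 r1].
apply: (@le_trans _ _ (nu `[0%R, (r * c)%R]%classic)).
  have := dec_concave hnu (lexx 0%R) c0 (ltW r0) (ltW r1).
  rewrite mulr0 add0r; apply: le_trans.
  by rewrite leeDr// mule_ge0// lee_fin subr_ge0 ltW.
apply: le_measure; rewrite ?inE//.
move=> s; rewrite /= in_itv /= => /andP[s0 sc]; split.
  by rewrite /half /= in_itv /= s0.
have [c00|cn0] := eqVneq c 0%R.
  have -> : s = ((1 - t) * 0 + t * 0)%R by move: sc; rewrite c00; lra.
  exact: XYZ.
have {}c0 : (0 < c)%R by rewrite lt_neqAle eq_sym cn0.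
have h0 : (0 <= s / c)%R by rewrite divr_ge0// ltW.
have h1 : (s / c <= r)%R by rewrite ler_pdivrMr.
(* [s] is the same convex combination of [(s / c) * a] and [(s / c) * b], which lie in [X] and [Y]
   because [s / c <= r < 1]. *)
have -> : s = ((1 - t) * (s / c * a) + t * (s / c * b))%R.
  by rewrite mulrCA [X in (_ + X)%R]mulrCA -mulrDr -/c divfK.
have h2 : (s / c < 1)%R by apply: le_lt_trans r1.
by apply: XYZ; [exact: mulr_ge0|exact: mulr_ge0|exact: ra|exact: rb].
Qed.

(** The superlevel sets of [f], [g], [h] are compared at the same relative height [s], with units
    [f0], [g0], [h0]. [dec_measure_conv] applies at each [s], and integration over [s] gives a bound
    that is linear in the two integrals. *)
Lemma integral_conv (f g h : measurableTypeR R -> \bar R) (f0 g0 h0 M t : R) :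
  (0 <= t)%R -> (t <= 1)%R -> (0 < f0)%R -> (0 < g0)%R -> (0 < h0)%R ->
  mnonneg f -> mnonneg g -> mnonneg h ->
  f 0%R = f0%:E -> g 0%R = g0%:E ->
  (forall a, (M < a)%R -> f a = 0) -> (forall a, (M < a)%R -> g a = 0) ->
  (forall a b, (0 <= b)%R -> (b <= a)%R -> f a <= f b) ->
  (forall a b, (0 <= b)%R -> (b <= a)%R -> g a <= g b) ->
  (forall s a b, (0 < s)%R -> (s <= 1)%R -> (0 <= a)%R -> (0 <= b)%R ->
    (s * f0)%:E <= f a -> (s * g0)%:E <= g b ->
    (s * h0)%:E <= h ((1 - t) * a + t * b)%R) ->
  h0%:E * (((1 - t) / f0)%:E * \int[nu]_(x in half R) f x +
           (t / g0)%:E * \int[nu]_(x in half R) g x) <=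
  \int[nu]_(x in half R) h x.
Proof.
move=> t0 t1 f0p g0p h0p hf hg hh f00 g00 fM gM fd gd fgh.
have lay (u : measurableTypeR R -> \bar R) (c : R) : mnonneg u -> (0 < c)%R ->
    u 0%R = c%:E -> (forall a b, (0 <= b)%R -> (b <= a)%R -> u a <= u b) ->
    \int[nu]_(x in half R) u x = c%:E * \int[@lebesgue_measure R]_(s in unit_itv R) nu (half R `&` [set x | ((s * c)%:E <= u x)%E]).
  move=> hu c0 u0 ud; rewrite -layer_cake//; apply: eq_integral => x.
  rewrite inE /half /= in_itv /= andbT => x0.
  by rewrite min_l// -u0 ud.
rewrite (lay f f0)// (lay g g0)// !muleA -!EFinM !divfK ?gt_eqF//.
(* [h] may exceed [h0]; only its part below that height is used. *)
apply: (@le_trans _ _ (\int[nu]_(x in half R) Order.min (h x) h0%:E)); last first.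
  apply: ge0_le_integral => //; first exact: measurable_half.
  - by move=> x _; rewrite le_min lee_fin (ltW h0p) andbT; case: hh.
  - by apply: measurable_funTS; apply: measurable_mine => //; case: hh.
  - by apply: measurable_funTS; case: hh.
  - by move=> x _; rewrite ge_min lexx.
rewrite layer_cake//; apply: lee_wpmul2l; first by rewrite lee_fin ltW.
have mm u c : mnonneg u -> measurable_fun (unit_itv R)
    (fun s : measurableTypeR R => nu (half R `&` [set x | ((s * c)%:E <= u x)%E])).
  by move=> hu; apply: measurable_funTS; exact: measurable_level_measure.
have mset u c s : mnonneg u -> measurable (half R `&` [set x | ((s * c)%:E <= u x)%E]).
  move=> hu; apply: emeasurable_fun_c_infty; first exact: measurable_half.
  by apply: measurable_funTS; case: hu.
rewrite -!ge0_integralZl ?lee_fin ?subr_ge0//; try by [exact: measurable_unit_itv|exact: mm].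
rewrite -ge0_integralD//; last 5 first.
- exact: measurable_unit_itv.
- by move=> s _; rewrite mule_ge0// lee_fin subr_ge0.
- by apply: emeasurable_funM => //; exact: mm.
- by move=> s _; rewrite mule_ge0// lee_fin.
- by apply: emeasurable_funM => //; exact: mm.
apply: ge0_le_integral.
- exact: measurable_unit_itv.
- by move=> s _; rewrite adde_ge0// mule_ge0// lee_fin ?subr_ge0.
- by apply: emeasurable_funD; apply: emeasurable_funM => //; exact: mm.
- exact: mm.
move=> s; rewrite /unit_itv /= in_itv /= => /andP[s0 s1].
have bd (u : measurableTypeR R -> \bar R) c : (0 < c)%R -> (forall a, (M < a)%R -> u a = 0) ->
    forall a, (s * c)%:E <= u a -> (a <= M)%R.
  move=> c0 uM a; have [//|/uM ->] := leP a M.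
  by rewrite lee_fin leNgt mulr_gt0.
apply: (@dec_measure_conv _ _ _ M) => //=; try exact: mset.
- by rewrite f00 lee_fin ler_piMl// ltW.
- by rewrite g00 lee_fin ler_piMl// ltW.
- exact: bd.
- exact: bd.
- by move=> a b fa b0 ba; apply: le_trans fa _; exact: fd.
- by move=> a b fa b0 ba; apply: le_trans fa _; exact: gd.
- by move=> a b a0 b0 fa gb; exact: fgh.
Qed.

End OneDim.

(** * Inequalities of Hoelder and Berwald type *)

Lemma exists_root (R : realType) (k : nat) (c : R) : (0 < k)%N -> 0 <= c ->
  exists2 r : R, 0 <= r & r ^+ k = c.
Proof.
move=> k0 c0; exists (c `^ k%:R^-1); first exact: powR_ge0.
by rewrite -powR_mulrn ?powR_ge0// -powRrM mulVf ?powRr1// pnatr_eq0 -lt0n.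
Qed.

Section Hoelder.
Local Open Scope ereal_scope.
Context d (T : measurableType d) (R : realType).
Variables (mu : {measure set T -> \bar R}) (D : set T) (mD : measurable D).

Lemma integral_eq0_le (f g : T -> \bar R) :
  measurable_fun D f -> measurable_fun D g ->
  (forall x, D x -> 0 <= f x) -> (forall x, D x -> 0 <= g x) ->
  (forall x, D x -> f x = 0 -> g x = 0) ->
  \int[mu]_(x in D) f x = 0 -> \int[mu]_(x in D) g x = 0.
Proof.
move=> mf mg f0 g0 fg If.
have /ae_eq_integral_abs : \int[mu]_(x in D) `|f x| = 0.
  by rewrite -[RHS]If; apply: eq_integral => x; rewrite inE => Dx; rewrite gee0_abs ?f0.
move=> /(_ mD mf) f00.
rewrite (ge0_ae_eq_integral mD mg (measurable_cst 0)) ?integral0//.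
by apply: filterS f00 => x h Dx; apply: fg => //; exact: h.
Qed.

(** A form of Hoelder's inequality for [k.+1] functions. With [I j] the integrals and
    [t ^+ k.+1 = c * \prod_j I j], AM-GM bounds [g] pointwise by [t] times the mean of the functions
    [f j / I j], each of which has integral 1. *)
Lemma integral_prod_le (J : finType) (P : pred J) (k : nat) (g : T -> \bar R)
    (f : J -> T -> \bar R) (c : R) :
  #|P| = k.+1 -> (0 <= c)%R -> measurable_fun D g ->
  (forall j, measurable_fun D (f j)) ->
  (forall x, D x -> 0 <= g x) -> (forall j x, D x -> 0 <= f j x) ->
  (forall j x, D x -> P j -> f j x < +oo) ->
  (forall j, P j -> \int[mu]_(x in D) f j x < +oo) ->
  (forall x, D x -> (g x ^+ k.+1 <= c%:E * \prod_(j | P j) f j x)%E) ->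
  ((\int[mu]_(x in D) g x) ^+ k.+1 <= c%:E * \prod_(j | P j) \int[mu]_(x in D) f j x)%E.
Proof.
move=> cP c0 mg mf g0 f0 ffin Ifin gf.
have If0 j : 0 <= \int[mu]_(x in D) f j x by apply: integral_ge0 => x Dx; exact: f0.
have RHS0 : 0 <= c%:E * \prod_(j | P j) \int[mu]_(x in D) f j x.
  by rewrite mule_ge0// ?lee_fin// prode_ge0.
(* In the degenerate cases [g] has integral 0. Once they are excluded, [t] and all the [I j] are
   positive and can be divided by. *)
have Ig0 : (exists2 j, P j & \int[mu]_(x in D) f j x = 0) \/ c = 0%R ->
    \int[mu]_(x in D) g x = 0.
  move=> [[j Pj Ij]|c00].
    apply: (integral_eq0_le (mf j) mg (f0 j) g0 _ Ij) => x Dx fx.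
    have := gf _ Dx; rewrite (bigD1 j)//= fx mul0e mule0 => gx.
    have : (g x ^+ k.+1)%E == 0 by rewrite eq_le gx expe_ge0// g0.
    by rewrite expe_eq0 => /andP[_ /eqP].
  apply: integral0_eq => x Dx; have := gf _ Dx; rewrite c00 mul0e => gx.
  have : (g x ^+ k.+1)%E == 0 by rewrite eq_le gx expe_ge0// g0.
  by rewrite expe_eq0 => /andP[_ /eqP].
have [z|nz] := pselect ((exists2 j, P j & \int[mu]_(x in D) f j x = 0) \/ c = 0%R).
  by rewrite Ig0// expeS mul0e.
have {}c0 : (0 < c)%R.
  by rewrite lt_neqAle c0 andbT; apply/eqP => c00; apply: nz; right.
pose I j := fine (\int[mu]_(x in D) f j x).
have IE j : P j -> \int[mu]_(x in D) f j x = (I j)%:E.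
  by move=> Pj; rewrite fineK// ge0_fin_numE// Ifin.
have I0 j : P j -> (0 < I j)%R.
  move=> Pj; rewrite -lte_fin -IE// lt_neqAle If0 andbT; apply/eqP => /esym z.
  by apply: nz; left; exists j.
have pI0 : (0 < \prod_(j | P j) I j)%R by exact: prodr_gt0.
have [t t0 tE] := exists_root (isT : (0 < k.+1)%N) (ltW (mulr_gt0 c0 pI0)).
have {}t0 : (0 < t)%R.
  rewrite lt_neqAle t0 andbT; apply/eqP => t00; move: tE; rewrite -t00 expr0n /=.
  by move=> /esym/eqP; rewrite gt_eqF// mulr_gt0.
have gle x : D x -> g x <= \sum_(j | P j) (t / k.+1%:R / I j)%:E * f j x.
  move=> Dx.
  have fE j : P j -> f j x = (fine (f j x))%:E.
    by move=> Pj; rewrite fineK// ge0_fin_numE ?f0// ffin.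
  have := gf _ Dx.
  rewrite (eq_bigr (fun j => (fine (f j x))%:E)) => [|j Pj]; last exact: fE.
  rewrite prodEFin -EFinM.
  have gfin : (g x ^+ k.+1 <= (c * \prod_(j | P j) fine (f j x))%:E)%E -> g x \is a fin_num.
    rewrite ge0_fin_numE ?g0//; case: (g x) (g0 _ Dx) => [r|//|//] _; rewrite ?ltry//.
    rewrite (_ : (+oo ^+ k.+1)%E = +oo)//.
    by elim: k {cP gf tE} => [|k IH] //; rewrite expeS IH.
  move=> h; have := gfin h; move=> /fineK gE; rewrite -gE in h *.
  rewrite (eq_bigr (fun j => (t / k.+1%:R * (fine (f j x) / I j))%:E)) => [|j Pj]; last first.
    by rewrite [in LHS]fE// -EFinM mulrAC -!mulrA.
  rewrite sumEFin lee_fin -mulr_sumr.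
  move: h; rewrite -EFin_expe lee_fin => h.
  have e0 j : P j -> (0 <= fine (f j x) / I j)%R.
    by move=> Pj; rewrite divr_ge0 ?fine_ge0 ?f0// ltW// I0.
  have := leif_AGM (A := P) (E := fun j => (fine (f j x) / I j)%R) => /(_ _)[|agm _].
    by move=> j; exact: e0.
  rewrite -mulrA [leRHS]mulrC -ler_pdivrMr// [leRHS]mulrC.
  rewrite -(@ler_pXn2r _ k.+1)// ?nnegrE; last 2 first.
  - by rewrite divr_ge0 ?fine_ge0 ?g0// ltW.
  - by rewrite divr_ge0// sumr_ge0.
  move: agm; rewrite cP => agm; apply: le_trans agm.
  rewrite expr_div_n tE ler_pdivrMr ?mulr_gt0//.
  apply: le_trans h _; rewrite prodf_div mulrCA divfK//.
  by rewrite gt_eqF.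
have le_t : \int[mu]_(x in D) g x <= t%:E.
  apply: (@le_trans _ _ (\int[mu]_(x in D) \sum_(j | P j) (t / k.+1%:R / I j)%:E * f j x)).
    apply: ge0_le_integral => //.
    under eq_fun do rewrite -big_filter.
    by apply: emeasurable_sum => j; apply: emeasurable_funM.
  under eq_integral do rewrite -big_filter.
  have a0 j : (0 <= t / k.+1%:R / I j)%R.
    by rewrite divr_ge0 ?divr_ge0 ?(ltW t0)// fine_ge0.
  rewrite ge0_integral_sum//; last 2 first.
  - by move=> j; apply: emeasurable_funM.
  - by move=> j x Dx; rewrite mule_ge0 ?lee_fin ?f0.
  rewrite big_filter (eq_bigr (fun=> (t / k.+1%:R)%:E)) => [|j Pj]; last first.
    rewrite ge0_integralZl ?lee_fin//; last by move=> x; exact: f0.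
    by rewrite IE// -EFinM divfK// gt_eqF// I0.
  rewrite sumEFin lee_fin sumr_const cP -(mulr_natr (t / _)%R) divfK//.
rewrite (eq_bigr (fun j => (I j)%:E)) => [|j Pj]; last exact: IE.
rewrite prodEFin -EFinM -tE.
have : 0 <= \int[mu]_(x in D) g x by exact: integral_ge0.
case: (\int[mu]_(x in D) g x) le_t => [r|//|//].
by rewrite -EFin_expe !lee_fin => rt r0; rewrite lerXn2r// nnegrE ltW.
Qed.

End Hoelder.

(** The unweighted inequality, applied to the family in which [x j] is repeated [k j] times; the
    repetition is indexed by a sigma type. *)
Lemma weighted_AGM (R : realFieldType) (J : finType) (k : J -> nat) (x : J -> R) :
  (0 < \sum_j k j)%N -> (forall j, 0 <= x j) ->
  \prod_j x j ^+ k j <=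
  ((\sum_j (k j)%:R * x j) / (\sum_j k j)%:R) ^+ (\sum_j k j)%N.
Proof.
move=> k0 x0; pose S := {j : J & 'I_(k j)}.
have cS : #|{: S}| = (\sum_j k j)%N.
  rewrite card_tagged sumnE big_map big_enum.
  by apply: eq_bigr => j _; rewrite card_ord.
have sE : \sum_(i : S) x (tag i) = \sum_j (k j)%:R * x j.
  transitivity (\sum_j \sum_(i < k j) x j).
    by rewrite (sig_big_dep (J := fun j => 'I_(k j)) xpredT (fun=> xpredT) (fun j _ => x j)).
  by apply: eq_bigr => j _; rewrite sumr_const card_ord mulr_natl.
have pE : \prod_(i : S) x (tag i) = \prod_j x j ^+ k j.
  transitivity (\prod_j \prod_(i < k j) x j).
    by rewrite (sig_big_dep (J := fun j => 'I_(k j)) xpredT (fun=> xpredT) (fun j _ => x j)).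
  by apply: eq_bigr => j _; rewrite prodr_const card_ord.
rewrite -sE -pE -cS.
have := leif_AGM (A := {: S}) (E := fun i : S => x (tag i)) => /(_ _)[|agm _].
  by move=> i _; exact: x0.
exact: agm.
Qed.

(** The convex function [v |-> v ^ (q / p)] lies above its tangent at [y ^ p]. With integer
    exponents this is AM-GM for [u ^ q] and [y ^ q] with weights [p] and [q - p]. *)
Lemma pow_tangent (R : realFieldType) (p q : nat) (y u : R) :
  (0 < p)%N -> (p <= q)%N -> 0 <= y -> 0 <= u ->
  p%:R * (y ^+ q - u ^+ q) <= q%:R * (y ^+ (q - p) * (y ^+ p - u ^+ p)).
Proof.
move=> p0 pq y0 u0; have q0 : (0 < q)%N := leq_trans p0 pq.
have q0' : 0 < q%:R :> R by rewrite ltr0n.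
have E : (\sum_(b : bool) (if b then p else q - p) = q)%N.
  by rewrite big_bool /= subnKC.
have x0 (b : bool) : 0 <= (if b then u ^+ q else y ^+ q).
  by case: b; rewrite exprn_ge0.
have h := @weighted_AGM R bool (fun b => if b then p else (q - p)%N) _ _ x0.
have {}h := h (eq_ind_r (fun s => (0 < s)%N) q0 E).
rewrite E !big_bool /= in h.
have {h} : u ^+ p * y ^+ (q - p) <= (p%:R * u ^+ q + (q - p)%:R * y ^+ q) / q%:R.
  rewrite -(@ler_pXn2r _ q)// ?nnegrE.
  - by rewrite exprMn -!exprM [(p * q)%N]mulnC [((q - p) * q)%N]mulnC !exprM.
  - by rewrite mulr_ge0// exprn_ge0.
  - by rewrite divr_ge0// addr_ge0// mulr_ge0// exprn_ge0.
rewrite ler_pdivlMr// natrB// => h.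
have -> : y ^+ (q - p) * (y ^+ p - u ^+ p) = y ^+ q - u ^+ p * y ^+ (q - p).
  by rewrite mulrBr -exprD subnK// [u ^+ p * _]mulrC.
nra.
Qed.

Section Berwald.
Context d (T : measurableType d) (R : realType).
Variables (mu : {measure set T -> \bar R}) (D : set T) (mD : measurable D).
Variables (J : finType) (p : J -> nat) (q k : nat).
Variables (u : T -> R) (w : J -> T -> R) (W : T -> R) (I : J -> R) (B : nat -> R).
Hypotheses (cJ : #|J| = k.+2) (p0 : forall j, (0 < p j)%N)
  (pq : forall j, (p j <= q)%N) (sum_p : (\sum_j p j = k.+1 * q)%N).
Hypotheses (mu_ : measurable_fun D u) (mw : forall j, measurable_fun D (w j))
  (mW : measurable_fun D W).
Hypotheses (u0 : forall x, D x -> 0 <= u x) (w0 : forall j x, D x -> 0 <= w j x)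
  (W0 : forall x, D x -> 0 <= W x) (wC : forall j, exists C, forall x, D x -> w j x <= C).
Hypothesis prod_w : forall x, D x -> W x ^+ k.+1 <= \prod_j w j x.
Hypothesis w_nd : forall j x y, D x -> D y -> u x <= u y -> w j x <= w j y.
Hypothesis w_star : forall j x y, D x -> D y -> u x <= u y ->
  w j y * u x ^+ p j <= w j x * u y ^+ p j.
Hypotheses (B0 : forall r, 0 < B r) (I0 : forall j, 0 < I j).
Hypothesis int_u : forall r, (\int[mu]_(x in D) (u x ^+ r)%:E = (B r)%:E)%E.
Hypothesis int_w : forall j, (\int[mu]_(x in D) (w j x)%:E = (I j)%:E)%E.

(** Scaled so that [z j] has the same integral [B (p j)] as [u ^ p j]; a bound by a multiple of
    their difference therefore integrates to 0. *)
Let z j x := w j x * (B (p j) / I j).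
Let y j x := z j x `^ (p j)%:R^-1.

Let c0 j : 0 < B (p j) / I j. Proof. exact: divr_gt0. Qed.

Let z0 j x : D x -> 0 <= z j x.
Proof. by move=> Dx; rewrite mulr_ge0 ?w0// ltW. Qed.

Let y0 j x : 0 <= y j x. Proof. exact: powR_ge0. Qed.

Let yp j x : D x -> y j x ^+ p j = z j x.
Proof.
move=> Dx; rewrite -powR_mulrn ?powR_ge0// -powRrM mulVf ?powRr1 ?z0//.
by rewrite pnatr_eq0 -lt0n.
Qed.

(* [z j - u ^+ p j] changes sign once, from positive to negative as [u] grows,
   while [y j ^+ (q - p j)] is nondecreasing in [u]. *)
Let crossing j : exists2 K, 0 <= K &
  forall x, D x -> y j x ^+ (q - p j) * (z j x - u x ^+ p j) <= K * (z j x - u x ^+ p j).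
Proof.
have y_nd x x' : D x -> D x' -> u x <= u x' -> y j x <= y j x'.
  move=> Dx Dx' xx'; apply: ge0_ler_powR; rewrite ?nnegrE ?invr_ge0 ?z0//.
  by rewrite /z ler_wpM2r ?(ltW (c0 j))// w_nd.
(* By [w_star] the quotient of [z j] by [u ^ p j] does not increase with [u], so the points with
   [u ^ p j < z j] come before those with the reverse inequality. *)
have sep x x' : D x -> D x' -> u x ^+ p j < z j x -> z j x' < u x' ^+ p j -> u x <= u x'.
  move=> Dx Dx' hx hx'; rewrite leNgt; apply/negP => x'x.
  have := w_star j Dx' Dx (ltW x'x).
  rewrite -(ler_pM2r (c0 j)) mulrAC [leRHS]mulrAC -/(z j x) -/(z j x') => h.
  have ux : 0 < u x ^+ p j by rewrite exprn_gt0// (le_lt_trans (u0 Dx')).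
  have : z j x * u x' ^+ p j < u x ^+ p j * u x' ^+ p j.
    by apply: le_lt_trans h _; rewrite [ltRHS]mulrC ltr_pM2r.
  have ux' : 0 < u x' ^+ p j by apply: le_lt_trans hx'; exact: z0.
  by rewrite ltr_pM2r// ltNge (ltW hx).
(* [K] is the supremum of [y j ^ (q - p j)] over the points with positive difference. It is finite
   by [wC], and by [sep] it is at most the values taken at the points with negative difference. *)
pose S := [set y j x ^+ (q - p j) | x in [set x | D x /\ u x ^+ p j < z j x]].
have [[s Ss]|Se] := pselect (S !=set0); last first.
  exists 0 => // x Dx; rewrite mul0r mulr_ge0_le0 ?exprn_ge0// subr_le0 leNgt.
  by apply/negP => h; apply: Se; exists (y j x ^+ (q - p j)); exists x.
have [C HC] := wC j.
have Sub : has_ubound S.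
  exists (((`|C| * (B (p j) / I j)) `^ (p j)%:R^-1) ^+ (q - p j)) => _ [x [Dx _] <-].
  rewrite lerXn2r ?nnegrE ?powR_ge0//; apply: ge0_ler_powR; rewrite ?nnegrE ?invr_ge0 ?z0//.
    by rewrite mulr_ge0// ltW.
  by rewrite ler_wpM2r ?(ltW (c0 j))// (le_trans (HC _ Dx))// ler_norm.
have Ssup : has_sup S by split => //; exists s.
exists (sup S).
  by apply: le_trans (sup_upper_bound Ssup Ss); case: Ss => x _ <-; rewrite exprn_ge0.
move=> x Dx; rewrite -subr_ge0 -mulrBl.
have [h|h] := ltP (u x ^+ p j) (z j x).
  rewrite mulr_ge0 ?subr_ge0 ?(ltW h)//; apply: sup_upper_bound => //.
  by exists x.
move: h; rewrite le_eqVlt => /predU1P[->|h]; first by rewrite subrr mulr0.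
rewrite mulr_le0 ?subr_le0 ?(ltW h)//; apply: ge_sup; first by exists s.
move=> _ [x' [Dx' hx'] <-].
by rewrite lerXn2r ?nnegrE//; apply: y_nd => //; exact: sep hx' h.
Qed.

(* With [z j = w j * (B (p j) / I j)] and [y j = z j ^ (1 / p j)], AM-GM bounds
   [W], up to constants, by [sum_j p j * y j ^ q]. The power tangent inequality
   and [crossing] give [y j ^ q - u ^ q <= K' * (y j ^ p j - u ^ p j)], whose right
   side integrates to [0]. *)
Lemma berwald : ((\int[mu]_(x in D) (W x)%:E) ^+ k.+1 <=
  ((\prod_j (I j / B (p j))) * B q ^+ k.+1)%R%:E)%E.
Proof.
have q0 : (0 < q)%N.
  have [j _] : exists j : J, j \in J by apply/card_gt0P; rewrite cJ.
  exact: leq_trans (p0 j) (pq j).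
have P0 : 0 < \prod_j (I j / B (p j)) by apply: prodr_gt0 => j _; exact: divr_gt0.
(* [L] undoes the scaling: [\prod_j w j = L ^ k.+1 * \prod_j z j], so it is [W / L] that AM-GM
   controls. *)
have [L L0 LE] := exists_root (isT : (0 < k.+1)%N) (ltW P0).
have {}L0 : 0 < L.
  rewrite lt_neqAle L0 andbT; apply/eqP => L00; move: LE; rewrite -L00 expr0n /=.
  by move=> /esym/eqP; rewrite gt_eqF.
pose K j := projT1 (cid2 (crossing j)).
have K0 j : 0 <= K j by rewrite /K; case: cid2.
have KP j x : D x -> y j x ^+ (q - p j) * (z j x - u x ^+ p j) <= K j * (z j x - u x ^+ p j).
  by rewrite /K; case: cid2 => /= K' _ h Dx; exact: h.
(* Only nonnegative terms appear on either side, so that this can be integrated without subtraction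
   of extended reals; the two sums over [j] integrate to the same finite constant and cancel. *)
have key x : D x -> W x / L + (\sum_j K j / k.+1%:R * u x ^+ p j) <=
    u x ^+ q + \sum_j (K j / k.+1%:R * z j x).
  move=> Dx.
  have agm : W x / L <= (\sum_j (p j)%:R * y j x ^+ q) / (k.+1 * q)%:R.
    have N0 : (0 < k.+1 * q)%N by rewrite muln_gt0.
    rewrite -(@ler_pXn2r _ (k.+1 * q))// ?nnegrE; last 2 first.
    - by rewrite divr_ge0 ?W0// ltW.
    - by rewrite divr_ge0// sumr_ge0// => j _; rewrite mulr_ge0// exprn_ge0.
    have := @weighted_AGM R J p (fun j => y j x ^+ q); rewrite sum_p => /(_ N0) agm.
    apply: le_trans (agm _); last by move=> j; rewrite exprn_ge0.
    under eq_bigr do rewrite -exprM mulnC exprM yp//.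
    rewrite prodrXl exprM lerXn2r ?nnegrE//.
    - by rewrite exprn_ge0// divr_ge0 ?W0// ltW.
    - by apply: prodr_ge0 => j _; exact: z0.
    rewrite expr_div_n LE ler_pdivrMr// /z big_split /= -mulrA -big_split /=.
    rewrite [X in _ * X]big1 ?mulr1 ?prod_w// => j _.
    by rewrite mulrA divfK ?gt_eqF// divff ?gt_eqF.
  apply: le_trans (lerD agm (lexx _)) _.
  have k0 : 0 < k.+1%:R :> R by rewrite ltr0n.
  have q0' : 0 < q%:R :> R by rewrite ltr0n.
  rewrite -lerBrDr.
  have step j : (p j)%:R * y j x ^+ q <= (p j)%:R * u x ^+ q + q%:R * (K j * (z j x - u x ^+ p j)).
    rewrite -lerBlDl -mulrBr; apply: le_trans (pow_tangent (p0 j) (pq j) (y0 j x) (u0 Dx)) _.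
    by rewrite ler_wpM2l// yp// KP.
  rewrite ler_pdivrMr ?ltr0n ?muln_gt0//.
  apply: le_trans (ler_sum _ (fun j _ => step j)) _.
  rewrite big_split /= -mulr_suml -natr_sum sum_p -addrA mulrDl mulrC lerD2l.
  rewrite -sumrB mulr_suml; apply: ler_sum => j _.
  rewrite natrM le_eqVlt; apply/orP; left; apply/eqP; field.
  by rewrite gt_eqF.
have mup r : measurable_fun D (fun x => (u x ^+ r)%:E).
  by apply/measurable_EFinP; exact: measurable_funX.
have mz j : measurable_fun D (fun x => (z j x)%:E).
  by apply/measurable_EFinP; exact: measurable_funM.
have Kk j : 0 <= K j / k.+1%:R by rewrite divr_ge0.
have int_lc (f : J -> T -> R) : (forall j, measurable_fun D (fun x => (f j x)%:E)) ->
    (forall j x, D x -> 0 <= f j x) ->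
    (forall j, \int[mu]_(x in D) (f j x)%:E = (B (p j))%:E)%E ->
    (\int[mu]_(x in D) (\sum_j K j / k.+1%:R * f j x)%:E =
     (\sum_j K j / k.+1%:R * B (p j))%:E)%E.
  move=> mf f0 fB; under eq_integral do rewrite -sumEFin.
  rewrite ge0_integral_sum//.
  - rewrite -sumEFin; apply: eq_bigr => j _.
    under eq_integral do rewrite EFinM.
    by rewrite ge0_integralZl ?lee_fin// ?fB//; move=> x Dx; rewrite lee_fin f0.
  - by move=> j; under eq_fun do rewrite EFinM; apply: emeasurable_funM.
  - by move=> j x Dx; rewrite lee_fin mulr_ge0// f0.
have mS (f : J -> T -> R) : (forall j, measurable_fun D (fun x => (f j x)%:E)) ->
    measurable_fun D (fun x => (\sum_j K j / k.+1%:R * f j x)%:E).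
  move=> mf; under eq_fun do rewrite -sumEFin.
  apply: emeasurable_sum => j; under eq_fun do rewrite EFinM.
  exact: emeasurable_funM.
have S0 (f : J -> T -> R) x : (forall j, 0 <= f j x) -> 0 <= \sum_j K j / k.+1%:R * f j x.
  by move=> f0; apply: sumr_ge0 => j _; rewrite mulr_ge0.
have mWL : measurable_fun D (fun x => (W x / L)%:E).
  by apply/measurable_EFinP; exact: measurable_funM.
have intz j : (\int[mu]_(x in D) (z j x)%:E = (B (p j))%:E)%E.
  under eq_integral do rewrite EFinM.
  rewrite ge0_integralZr ?lee_fin ?(ltW (c0 j))//.
  - by rewrite int_w -EFinM mulrC divfK// gt_eqF.
  - exact/measurable_EFinP.
  - by move=> x Dx; rewrite lee_fin w0.
have int_key : (\int[mu]_(x in D) (W x / L)%:E <= (B q)%:E)%E.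
  rewrite -(@leeD2rE _ (\sum_j K j / k.+1%:R * B (p j))%:E)//.
  rewrite -{1}(int_lc (fun j x => u x ^+ p j))//; last first.
    by move=> j x Dx; rewrite exprn_ge0// u0.
  rewrite -(int_lc z)// -int_u -!ge0_integralD//.
  - apply: ge0_le_integral => //.
    + move=> x Dx; rewrite -EFinD lee_fin addr_ge0 ?divr_ge0 ?W0 ?(ltW L0)//.
      by apply: (S0 (fun j x => u x ^+ p j)) => j; rewrite exprn_ge0// u0.
    + by apply: emeasurable_funD => //; exact: (mS (fun j x => u x ^+ p j)).
    + by apply: emeasurable_funD => //; exact: (mS z).
  - by move=> x Dx; rewrite lee_fin exprn_ge0// u0.
  - by move=> x Dx; rewrite lee_fin; apply: (S0 z) => j; exact: z0.
  - exact: (mS z).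
  - by move=> x Dx; rewrite lee_fin divr_ge0 ?W0// ltW.
  - by move=> x Dx; rewrite lee_fin; apply: (S0 (fun j x => u x ^+ p j)) => j; rewrite exprn_ge0// u0.
  - by apply: (mS (fun j x => u x ^+ p j)) => j; exact: mup.
have W1 : (\int[mu]_(x in D) (W x)%:E <= (L * B q)%:E)%E.
  have -> : (\int[mu]_(x in D) (W x)%:E = L%:E * \int[mu]_(x in D) (W x / L)%:E)%E.
    rewrite -ge0_integralZl ?lee_fin ?(ltW L0)//.
      by apply: eq_integral => x _; rewrite -EFinM mulrC divfK// gt_eqF.
    by move=> x Dx; rewrite lee_fin divr_ge0 ?W0// ltW.
  by rewrite EFinM lee_wpmul2l// lee_fin ltW.
have W2 : (0 <= \int[mu]_(x in D) (W x)%:E)%E.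
  by apply: integral_ge0 => x Dx; rewrite lee_fin W0.
rewrite -LE -exprMn.
case: (\int[mu]_(x in D) (W x)%:E)%E W1 W2 => [r|//|//].
rewrite -EFin_expe !lee_fin => rL r0; rewrite lerXn2r// nnegrE.
by rewrite mulr_ge0// ltW.
Qed.

End Berwald.

(** * Monotone functions on the orthant *)

Section Orthant.
Local Open Scope ereal_scope.
Context (R : realType) (n : nat).
Notation V := (borel_rV R n).
Variable nu : 'I_n -> {sigma_finite_measure set (measurableTypeR R) -> \bar R}.
Hypothesis hnu : forall k, dec_measure (nu k).
Variable M : R.
Hypothesis M0 : (0 <= M)%R.

Notation orth := (@nonneg_orthant R n).
Notation hint := (pint nu (fun=> half R) (@upd R n : 'I_n -> V -> R -> V)).
Notation hints := (pints nu (fun=> half R) (@upd R n : 'I_n -> V -> R -> V)).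

Let mD (k : 'I_n) : measurable (half R). Proof. exact: measurable_half. Qed.
Let mupd := @measurable_upd2 R n.
Let updC := @upd_comm R n.

(** A class of functions preserved by integration. [P] stands for the coordinates still available
    for integration, along which the support is bounded; together with monotonicity this keeps the
    integrals finite. *)
Record good (P : pred 'I_n) (f : V -> \bar R) : Prop := Good {
  good_mnonneg : mnonneg f ;
  good_supp : forall k x, P k -> orth x -> (M < x 0%R k)%R -> f x = 0 ;
  good_dec : forall k x t, orth x -> (x 0%R k <= t)%R -> f (upd k x t) <= f x ;
  good_fin : forall x, orth x -> f x < +oo }.

Lemma orth_upd k x (t : R) : orth x -> (0 <= t)%R -> orth (upd k x t).
Proof. by move=> x0 t0 j; rewrite updE; case: ifP. Qed.

Lemma halfE t : half R t = (0 <= t)%R :> Prop.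
Proof. by rewrite /half /= in_itv /= andbT. Qed.

Lemma upd_upd k (x : 'rV[R]_n) s t : upd k (upd k x s) t = upd k x t.
Proof. by apply/rowP => j; rewrite !updE; case: (j == k). Qed.

Lemma upd_id k (x : 'rV[R]_n) : upd k x (x 0%R k) = x.
Proof. by apply/rowP => j; rewrite !updE; case: eqP => [->|]. Qed.

Lemma upd_line k (x y : 'rV[R]_n) (t a b : R) :
  upd k ((1 - t) *: x + t *: y)%R ((1 - t) * a + t * b)%R =
  ((1 - t) *: upd k x a + t *: upd k y b)%R.
Proof. by apply/rowP => j; rewrite !(updE, mxE); case: (j == k). Qed.

Lemma upd_scale k (x : 'rV[R]_n) (t a : R) :
  upd k (t *: x)%R (t * a)%R = (t *: upd k x a)%R.
Proof. by apply/rowP => j; rewrite !(updE, mxE); case: (j == k). Qed.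

Lemma mnonneg_slice (f : V -> \bar R) k x : mnonneg f ->
  mnonneg (fun t : measurableTypeR R => f (upd k x t)).
Proof.
move=> [mf f0]; split => //.
exact: measurableT_comp mf (measurable_upd mupd k x).
Qed.

Lemma good_slice_dec P f k x (a b : R) : good P f -> orth x ->
  (0 <= b)%R -> (b <= a)%R -> f (upd k x a) <= f (upd k x b).
Proof.
move=> gf x0 b0 ba; rewrite -(upd_upd k x b a); apply: (good_dec gf).
  exact: orth_upd.
by rewrite updE eqxx.
Qed.

Lemma good_slice_supp P f k x (a : R) : good P f -> P k -> orth x ->
  (M < a)%R -> f (upd k x a) = 0.
Proof.
move=> gf Pk x0 Ma; apply: (good_supp gf Pk).
  by apply: orth_upd => //; exact: le_trans (ltW Ma).
by rewrite updE eqxx.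
Qed.

Lemma good_hint P f k : good P f -> P k -> good [pred j | P j && (j != k)] (hint k f).
Proof.
move=> gf Pk; split.
- exact: (mnonneg_pint _ mD mupd k (good_mnonneg gf)).
- move=> j x /= /andP[Pj jk] x0 Mj; apply: integral0_eq => t.
  rewrite halfE => t0; apply: (good_supp gf Pj); first exact: orth_upd.
  by rewrite updE (negbTE jk).
- move=> j x t x0 xt; have [->|jk] := eqVneq j k.
    by rewrite le_eqVlt; apply/orP; left; apply/eqP; apply: eq_integral => s _; rewrite upd_upd.
  apply: ge0_le_integral; first exact: measurable_half.
  - by move=> s _; case: (good_mnonneg gf).
  - by apply: measurable_funTS; case: (mnonneg_slice k (upd j x t) (good_mnonneg gf)).
  - by apply: measurable_funTS; case: (mnonneg_slice k x (good_mnonneg gf)).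
  move=> s; rewrite halfE => s0; rewrite updC 1?eq_sym//; apply: (good_dec gf).
    exact: orth_upd.
  by rewrite updE (negbTE jk).
move=> x x0.
have f0 : f (upd k x 0%R) \is a fin_num.
  rewrite ge0_fin_numE; last by case: (good_mnonneg gf).
  by apply: (good_fin gf); exact: orth_upd.
(* Monotonicity and bounded support dominate the slice by its value at 0 times the indicator of
   [[0, M]]. *)
apply: (@le_lt_trans _ _ (\int[nu k]_(t in half R) (f (upd k x 0%R) * (\1_`[0%R, M]%classic t)%:E))).
  apply: ge0_le_integral; first exact: measurable_half.
  - by move=> s _; case: (good_mnonneg gf).
  - by apply: measurable_funTS; case: (mnonneg_slice k x (good_mnonneg gf)).
  - apply: emeasurable_funM => //; apply/measurable_EFinP; apply: measurable_indic.
    exact: measurable_itv.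
  move=> s; rewrite halfE => s0; rewrite indicE.
  have [sM|Ms] := leP s M.
    rewrite mem_set ?mule1; first exact: (good_slice_dec k gf x0).
    by rewrite /= in_itv /= s0.
  by rewrite (good_slice_supp gf Pk x0 Ms) mule_ge0//; case: (good_mnonneg gf).
rewrite ge0_integralZl//; last 3 first.
- exact: measurable_half.
- by apply/measurable_EFinP; apply: measurable_indic; exact: measurable_itv.
- by case: (good_mnonneg gf).
rewrite integral_indic//; last exact: measurable_itv.
rewrite -(fineK f0) lte_mul_pinfty// ?lee_fin ?fine_ge0//; first by case: (good_mnonneg gf).
apply: le_lt_trans (dec_fin (hnu k) M); apply: le_measure; rewrite ?inE//.
  by apply: measurableI => //; exact: measurable_itv.
by move=> s [] /=; rewrite !in_itv /= => /andP[s0 ->] _; rewrite andbT (le_trans _ s0)// oppr_le0.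
Qed.

Lemma eq_good (P Q : pred 'I_n) f : P =1 Q -> good P f -> good Q f.
Proof.
move=> PQ [h1 h2 h3 h4]; split => // k x; rewrite -PQ; exact: h2.
Qed.

Lemma good_hints P f l : uniq l -> {subset l <= P} -> good P f ->
  good [pred j | P j && (j \notin l)] (hints l f).
Proof.
elim: l => [|k l IH] /=.
  by move=> _ _; apply: eq_good => j /=; rewrite andbT.
move=> /andP[kl ul] lP gf.
have gl : good [pred j | P j && (j \notin l)] (hints l f).
  by apply: IH => // j jl; apply: lP; rewrite in_cons jl orbT.
have := good_hint gl (k := k).
rewrite /= kl andbT => /(_ (lP _ (mem_head _ _))); apply: eq_good => j /=.
by rewrite in_cons negb_or -andbA; congr (_ && _); rewrite andbC.
Qed.

(* For [0 < s]: [f ^ (1/s)] is concave on the support of [f] in the orthant. For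
   [s = 0]: the set [1 <= f] is convex there. *)
Definition conc (s : nat) (f : V -> \bar R) :=
  forall x y t F G, orth x -> orth y -> (0 <= t)%R -> (t <= 1)%R ->
    (0 < F)%R -> (0 < G)%R -> (F ^+ s)%:E <= f x -> (G ^+ s)%:E <= f y ->
    (((1 - t) * F + t * G) ^+ s)%:E <= f ((1 - t) *: x + t *: y)%R.

(** Convexity of [v |-> v ^ s.+1], with weights of arbitrary total. The inductive step is
    Chebyshev's sum inequality, that is [0 <= (X - Y) * (X ^ s.+1 - Y ^ s.+1)]. *)
Lemma power_jensen (a b X Y : R) (s : nat) :
  (0 <= a)%R -> (0 <= b)%R -> (0 <= X)%R -> (0 <= Y)%R ->
  ((a * X + b * Y) ^+ s.+1 <= (a + b) ^+ s * (a * X ^+ s.+1 + b * Y ^+ s.+1))%R.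
Proof.
move=> a0 b0 X0 Y0; elim: s => [|s IH]; first by rewrite !expr1 expr0 mul1r.
rewrite exprS; apply: (@le_trans _ _ ((a * X + b * Y) * ((a + b) ^+ s * (a * X ^+ s.+1 + b * Y ^+ s.+1)))%R).
  by rewrite ler_wpM2l// addr_ge0// mulr_ge0.
rewrite mulrCA [in leRHS]exprSr -mulrA ler_wpM2l ?exprn_ge0 ?addr_ge0//.
have h : (0 <= (X - Y) * (X ^+ s.+1 - Y ^+ s.+1))%R.
  have [XY|YX] := leP X Y.
    by rewrite mulr_le0// subr_le0// lerXn2r.
  by rewrite mulr_ge0// subr_ge0 ?lerXn2r// ltW.
rewrite [(X ^+ s.+2)%R]exprS [(Y ^+ s.+2)%R]exprS.
move: (X ^+ s.+1)%R (Y ^+ s.+1)%R h => P Q h.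
have := mulr_ge0 (mulr_ge0 a0 b0) h; lra.
Qed.

(* One-dimensional Brunn-Minkowski, applied to the superlevel sets of the slices
   of [f], raises the exponent by one. *)
Lemma conc_hint P f k s : good P f -> P k -> conc s f ->
  (s = 0%N -> forall x, f x = 0 \/ f x = 1) -> conc s.+1 (hint k f).
Proof.
move=> gf Pk cf f01 x y t F G x0 y0 t0 t1 F0 G0 Fx Gy.
have mf := good_mnonneg gf; have f0 := mf.2.
(* The slice attains its maximum at 0, and this maximum is positive because the integral is. For
   [s = 0] the function takes only the values 0 and 1, so the maximum is 1 and [r = 1] works. *)
have pos w H : orth w -> (0 < H)%R -> (H ^+ s.+1)%:E <= hint k f w ->
    exists2 r : R, (0 < r)%R & f (upd k w 0%R) = (r ^+ s)%:E.
  move=> w0 H0 Hw.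
  have fn0 : f (upd k w 0%R) != 0.
    apply/eqP => f00; move: Hw; rewrite [hint _ _ _]integral0_eq; last first.
      move=> a; rewrite halfE => a0; apply/eqP; rewrite eq_le f0 andbT -f00.
      exact: (good_slice_dec k gf w0).
    by rewrite lee_fin leNgt exprn_gt0.
  have ffin : f (upd k w 0%R) \is a fin_num.
    by rewrite ge0_fin_numE ?f0//; apply: (good_fin gf); exact: orth_upd.
  case: s f01 {cf Fx Gy Hw} => [|s] f01.
    by have [/eqP|->] := f01 erefl (upd k w 0%R); [rewrite (negbTE fn0)|exists 1%R].
  have [r r0 rE] := exists_root (isT : (0 < s.+1)%N) (fine_ge0 (f0 (upd k w 0%R))).
  exists r; last by rewrite rE fineK.
  rewrite lt_neqAle r0 andbT; apply: contra fn0 => /eqP r00.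
  by rewrite -(fineK ffin) -rE -r00 expr0n.
have [F1 F10 F1E] := pos _ _ x0 F0 Fx.
have [G1 G10 G1E] := pos _ _ y0 G0 Gy.
set z := ((1 - t) *: x + t *: y)%R.
have H10 : (0 < (1 - t) * F1 + t * G1)%R.
  have [->|tn0] := eqVneq t 0%R; first by rewrite subr0 mul1r mul0r addr0.
  by rewrite ltr_wpDl// ?mulr_ge0 ?subr_ge0 ?(ltW F10)// mulr_gt0// lt_neqAle eq_sym tn0.
have step r a b : (0 < r)%R -> (r <= 1)%R -> (0 <= a)%R -> (0 <= b)%R ->
    (r * F1 ^+ s)%:E <= f (upd k x a) -> (r * G1 ^+ s)%:E <= f (upd k y b) ->
    (r * ((1 - t) * F1 + t * G1) ^+ s)%:E <= f (upd k z ((1 - t) * a + t * b)%R).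
  move=> r0 r1 a0 b0 ra rb; rewrite upd_line.
  case: s cf f01 {Fx Gy pos F1E G1E} ra rb => [|s] cf f01 ra rb.
    rewrite expr0 mulr1; apply: (@le_trans _ _ 1); first by rewrite lee_fin.
    have one w : (r * 1)%:E <= f w -> (1 ^+ 0)%:E <= f w.
      by have [->|->//] := f01 erefl w; rewrite lee_fin mulr1 leNgt r0.
    rewrite -[1]/((((1 - t) * 1 + t * 1) ^+ 0)%:E).
    by apply: cf => //; try exact: orth_upd; apply: one.
  (* A factor [r] on the values is a factor [q] on their roots, and the concavity condition is
     homogeneous in the roots. *)
  have [q q0 qE] := exists_root (isT : (0 < s.+1)%N) (ltW r0).
  have {}q0 : (0 < q)%R.
    by rewrite lt_neqAle q0 andbT; apply/eqP => q00; move: r0; rewrite -qE -q00 expr0n ltxx.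
  rewrite -qE -exprMn (_ : q * _ = (1 - t) * (q * F1) + t * (q * G1))%R; last by ring.
  by apply: cf; rewrite ?exprMn ?qE ?mulr_gt0//; exact: orth_upd.
have := @integral_conv R (nu k) (hnu k) (fun a => f (upd k x a)) (fun b => f (upd k y b))
  (fun c => f (upd k z c)) (F1 ^+ s) (G1 ^+ s) (((1 - t) * F1 + t * G1) ^+ s) M t
  t0 t1 (exprn_gt0 _ F10) (exprn_gt0 _ G10) (exprn_gt0 _ H10)
  (mnonneg_slice k x mf) (mnonneg_slice k y mf) (mnonneg_slice k z mf) F1E G1E.
move=> /(_ (fun a Ma => good_slice_supp gf Pk x0 Ma) (fun a Ma => good_slice_supp gf Pk y0 Ma)).
move=> /(_ (fun a b => @good_slice_dec P f k x a b gf x0) (fun a b => @good_slice_dec P f k y a b gf y0)).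
move=> /(_ step) h.
apply: le_trans h; rewrite -/(hint k f x) -/(hint k f y).
apply: (@le_trans _ _ ((((1 - t) * F1 + t * G1) ^+ s)%:E *
   (((1 - t) / F1 ^+ s)%:E * (F ^+ s.+1)%:E + (t / G1 ^+ s)%:E * (G ^+ s.+1)%:E))); last first.
  apply: lee_wpmul2l; first by rewrite lee_fin exprn_ge0// ltW.
  apply: leeD; apply: lee_wpmul2l => //; rewrite lee_fin divr_ge0 ?subr_ge0 ?exprn_ge0//; exact: ltW.
rewrite -!(EFinM, EFinD) lee_fin.
(* Convexity with weights [(1 - t) * F1] and [t * G1] at the points [F / F1] and [G / G1]: the
   weighted sum is [(1 - t) * F + t * G], from which the maxima of the slices have disappeared. *)
have h : ((((1 - t) * F1) * (F / F1) + (t * G1) * (G / G1)) ^+ s.+1 <=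
    ((1 - t) * F1 + t * G1) ^+ s *
    (((1 - t) * F1) * (F / F1) ^+ s.+1 + (t * G1) * (G / G1) ^+ s.+1))%R.
  apply: power_jensen.
  - by rewrite mulr_ge0 ?subr_ge0// ltW.
  - by rewrite mulr_ge0// ltW.
  - by rewrite divr_ge0// ltW.
  - by rewrite divr_ge0// ltW.
have e1 (a b c : R) : (0 < b)%R -> (a * b * (c / b) = a * c)%R.
  by move=> b0; field; rewrite gt_eqF.
have e2 (a b c : R) : (0 < b)%R -> (a * b * (c / b) ^+ s.+1 = a / b ^+ s * c ^+ s.+1)%R.
  move=> b0; have bn : b != 0%R by rewrite gt_eqF.
  by rewrite expr_div_n [(b ^+ s.+1)%R]exprS; field; rewrite bn expf_neq0.
by move: h; rewrite !e1// !e2.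
Qed.

Lemma conc_hints P f l : good P f -> uniq l -> {subset l <= P} ->
  (forall x, f x = 0 \/ f x = 1) -> conc 0 f -> conc (size l) (hints l f).
Proof.
move=> gf + + f01 cf; elim: l => [//|k l IH] /= /andP[kl ul] lP.
have lP' : {subset l <= P} by move=> j jl; apply: lP; rewrite in_cons jl orbT.
apply: (conc_hint (good_hints ul lP' gf)); last first.
- by case: l {IH kl ul lP lP'}.
- exact: IH.
- by rewrite /= kl andbT; apply: lP; rewrite mem_head.
Qed.

(** The case of [integral_conv] in which one function is the indicator [e] of the point 0: the
    combination of [0] and [b] is then [t * b]. The term with the integral of [e] is nonnegative and
    is dropped, which leaves one new factor [t]. *)
Lemma hint_scale P (f g : V -> \bar R) k t (c : R) : good P f -> P k -> mnonneg g ->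
  (0 < t)%R -> (t <= 1)%R -> (0 < c)%R ->
  (forall x, orth x -> c%:E * f x <= g (t *: x)%R) ->
  forall x, orth x -> (t * c)%:E * hint k f x <= hint k g (t *: x)%R.
Proof.
move=> gf Pk mg t0 t1 c0 fg x x0.
have mf := good_mnonneg gf; have f0 := mf.2.
have g0 y : 0 <= hint k g y by apply: integral_ge0 => s _; exact: mg.2.
have [f00|fn0] := eqVneq (f (upd k x 0%R)) 0.
  rewrite [hint _ f _]integral0_eq ?mule0//.
  move=> a; rewrite halfE => a0; apply/eqP; rewrite eq_le f0 andbT -f00.
  exact: (good_slice_dec k gf x0).
have ffin : f (upd k x 0%R) \is a fin_num.
  by rewrite ge0_fin_numE ?f0//; apply: (good_fin gf); exact: orth_upd.
set r := fine (f (upd k x 0%R)).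
have rE : f (upd k x 0%R) = r%:E by rewrite fineK.
have r0 : (0 < r)%R by rewrite -lte_fin -rE lt_neqAle eq_sym fn0 f0.
pose e (a : measurableTypeR R) : \bar R := (\1_[set 0%R : R] a)%:E.
have me : mnonneg e.
  split; last by move=> a; rewrite lee_fin.
  by apply/measurable_EFinP; apply: measurable_indic; exact: measurable_set1.
have e0 : e 0%R = 1%:E by rewrite /e indicE mem_set.
have en a : a != 0%R -> e a = 0.
  by move=> an; rewrite /e indicE memNset//; exact/eqP.
have eM a : (M < a)%R -> e a = 0 by move=> Ma; rewrite en// gt_eqF// (le_lt_trans M0).
have ed a b : (0 <= b)%R -> (b <= a)%R -> e a <= e b.
  have [->|a0] := eqVneq a 0%R.
    by move=> b0 b1; rewrite (_ : b = 0%R)//; apply/eqP; rewrite eq_le b0 b1.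
  by move=> _ _; rewrite en// lee_fin.
have step s a b : (0 < s)%R -> (s <= 1)%R -> (0 <= a)%R -> (0 <= b)%R ->
    (s * 1)%:E <= e a -> (s * r)%:E <= f (upd k x b) ->
    (s * (c * r))%:E <= g (upd k (t *: x)%R ((1 - t) * a + t * b)%R).
  move=> s0 s1 a0 b0; have [->|an] := eqVneq a 0%R; last first.
    by rewrite en// lee_fin mulr1 leNgt s0.
  move=> _ sf; rewrite mulr0 add0r upd_scale; apply: le_trans (fg _ (orth_upd k x0 b0)).
  by rewrite mulrCA EFinM lee_wpmul2l// lee_fin ltW.
have := @integral_conv R (nu k) (hnu k) e (fun b => f (upd k x b))
  (fun c => g (upd k (t *: x)%R c)) 1 r (c * r) M t (ltW t0) t1 ltr01 r0 (mulr_gt0 c0 r0)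
  me (mnonneg_slice k x mf) (mnonneg_slice k _ mg) e0 rE eM
  (fun a Ma => good_slice_supp gf Pk x0 Ma) ed (fun a b => @good_slice_dec P f k x a b gf x0) step.
rewrite -/(hint k f x); apply: le_trans.
apply: (@le_trans _ _ ((c * r)%:E * ((t / r)%:E * hint k f x))).
  rewrite muleA -EFinM (_ : c * r * (t / r) = t * c)%R//.
  by field; rewrite gt_eqF.
apply: lee_wpmul2l; first by rewrite lee_fin mulr_ge0// ltW.
rewrite leeDr// mule_ge0//; first by rewrite lee_fin divr_ge0 ?subr_ge0.
by apply: integral_ge0 => a _; exact: me.2.
Qed.

Lemma hints_scale P (f g : V -> \bar R) l (t : R) : good P f -> uniq l -> {subset l <= P} -> mnonneg g ->
  (0 < t)%R -> (t <= 1)%R -> (forall x, orth x -> f x <= g (t *: x)%R) ->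
  forall x, orth x -> (t ^+ size l)%:E * hints l f x <= hints l g (t *: x)%R.
Proof.
move=> gf + + mg t0 t1 fg; elim: l => [_ _ x x0|k l IH /= /andP[kl ul] lP].
  by rewrite /= expr0 mul1e fg.
have lP' : {subset l <= P} by move=> j jl; apply: lP; rewrite in_cons jl orbT.
rewrite exprS; apply: (hint_scale (good_hints ul lP' gf)) => //.
- by rewrite /= kl andbT; apply: lP; rewrite mem_head.
- exact: (mnonneg_pints _ mD mupd).
- exact: exprn_gt0.
- exact: IH.
Qed.

(** Induction on the coordinates. Exactly one function, that of index [c k], does not depend on the
    coordinate [k]; it is a constant in the integration over [k], and Hoelder for the other [r]
    functions gives the step. *)
Lemma loomis_whitney (J : finType) (c : 'I_n -> J) (Q : pred 'I_n) (r : nat) (l : seq 'I_n)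
    (g : V -> \bar R) (f : J -> V -> \bar R) :
  #|J| = r.+1 -> (0 < r)%N -> uniq l -> {subset l <= Q} -> mnonneg g ->
  (forall j, good [pred k | Q k && (c k != j)] (f j)) ->
  (forall j k y t, Q k -> c k = j -> f j (upd k y t) = f j y) ->
  (forall x, orth x -> (g x ^+ r <= \prod_j f j x)%E) ->
  forall x, orth x ->
    (hints l g x ^+ r <= \prod_j hints [seq k <- l | c k != j] (f j) x)%E.
Proof.
move=> cJ r0 + + mg gf fc gP; elim: l => [_ _ //|k l IH] /= /andP[kl ul] lQ x x0.
have Qk : Q k by apply: lQ; rewrite mem_head.
have {}lQ : {subset l <= Q} by move=> i il; apply: lQ; rewrite in_cons il orbT.
pose h j := hints [seq i <- l | c i != j] (f j).
have gh j : good [pred i | [&& Q i, c i != j & i \notin l]] (h j).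
  apply: eq_good (good_hints _ _ (gf j)); last 2 first.
  - exact: filter_uniq.
  - by move=> i; rewrite mem_filter => /andP[cij il]; rewrite /in_mem /= cij andbT; exact: lQ.
  by move=> i /=; rewrite mem_filter; case: (c i == j); case: (Q i).
have hk y t : h (c k) (upd k y t) = h (c k) y.
  rewrite /h; apply: (@pints_upd_id _ V R _ nu (fun=> half R) (@upd R n) updC); last by move=> y' s; rewrite fc.
  by rewrite mem_filter eqxx.
have hfin : h (c k) x \is a fin_num.
  by rewrite ge0_fin_numE; [exact: (good_fin (gh (c k)))|exact: (good_mnonneg (gh (c k))).2].
have h0 : (0 <= fine (h (c k) x))%R by apply: fine_ge0; exact: (good_mnonneg (gh (c k))).2.
rewrite (bigD1 (c k))//= eqxx /= -/(h (c k)) -(fineK hfin).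
rewrite (eq_bigr (fun j => hint k (h j) x)) => [|j jk]; last first.
  by rewrite eq_sym jk.
have cP : #|[pred j | j != c k]| = r.
  by have := cardC1 (c k); rewrite cJ /= => <-; apply: eq_card => j; rewrite !inE.
case: r r0 {cJ gP} IH cP => // r _ IH cP.
apply: (integral_prod_le _ cP h0).
- exact: measurable_half.
- apply: measurable_funTS; apply: (mnonneg_slice k x _).1.
  exact: (mnonneg_pints _ mD mupd).
- move=> j; apply: measurable_funTS.
  exact: (mnonneg_slice k x (good_mnonneg (gh j))).1.
- by move=> s _; apply: (mnonneg_pints _ mD mupd l mg).2.
- by move=> j s _; exact: (good_mnonneg (gh j)).2.
- by move=> j s; rewrite halfE => s0 _; apply: (good_fin (gh j)); exact: orth_upd.
- move=> j /= jk; apply: (good_fin (good_hint (gh j) _)) => //=.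
  by rewrite Qk kl eq_sym jk.
- move=> s; rewrite halfE => s0; apply: le_trans (IH ul lQ _ (orth_upd k x0 s0)) _.
  by rewrite (bigD1 (c k))//= -/(h (c k)) hk fineK.
Qed.

End Orthant.

(** * Beta integrals, Tonelli in the height, Loomis-Whitney for sets *)

Section Beta.
Local Open Scope ereal_scope.
Context (R : realType).
Local Notation leb := (@lebesgue_measure R).

(* If [Phi ^ (1/N)] is concave with maximum [V0] at [0], the superlevel sets
   [L_s] of [Phi] at height [s * V0] satisfy
   [depth s / depth s' * L_s' <= L_s] for [depth s <= depth s']. *)
Definition depth (N : nat) (s : R) : R := (1 - s `^ N%:R^-1)%R.

(** The substitution [s = x ^ N] turns the integral into that of [N * x ^ (N - 1) * (1 - x) ^ r]
    over [[0, 1]], which is [N] times the Beta function at [N] and [r + 1]. *)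
Lemma integral_depth (N r : nat) : (0 < N)%N ->
  \int[leb]_(s in unit_itv R) (depth N s ^+ r)%:E = ('C(N + r, N)%:R^-1)%:E.
Proof.
move=> N0; have Ninv0 : (0 < N%:R^-1 :> R)%R by rewrite invr_gt0 ltr0n.
have cpow (s : R) : (0 < s)%R -> {for s, continuous (fun s : R => s `^ N%:R^-1)%R}.
  move=> s0; apply/differentiable_continuous/derivable1_diffP.
  by apply: derivable_powR; rewrite in_itv /= s0.
have cG : {within `[0%R, 1%R], continuous (fun s : R => (depth N s ^+ r)%R)}.
  have lim (F : set_system R) (FF : Filter F) (s : R) : (x `^ N%:R^-1)%R @[x --> F] --> (s `^ N%:R^-1)%R ->
      (depth N x ^+ r)%R @[x --> F] --> (depth N s ^+ r)%R.
    move=> Fs; apply: (cvg_comp (fun x => depth N x) (fun y : R => (y ^+ r)%R)); last exact: exprn_continuous.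
    by apply: cvgB => //; exact: cvg_cst.
  apply/continuous_within_itvP => //; split.
  - move=> s; rewrite in_itv /= => /andP[s0 _]; apply: lim; exact: cpow.
  - by apply: lim; rewrite powR0 ?gt_eqF//; exact: powR_cvg0.
  - by apply: lim; apply: cvg_at_left_filter; exact: cpow.
have mG : measurable_fun (`[0%R, 1%R]%classic : set (measurableTypeR R))
    (fun s => (depth N s ^+ r)%:E).
  apply/measurable_EFinP; apply: subspace_continuous_measurable_fun => //.
rewrite /unit_itv integral_itv_obnd_cbnd; last first.
  apply: measurable_funS mG => //.
  by move=> s /=; rewrite !in_itv /= => /andP[/ltW -> ->].
have dE : (fun x : R => x ^+ N)%R^`()%classic = (fun x : R => N%:R * x ^+ N.-1)%R.
  by apply/funext => x; rewrite exp_derive1.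
have cd : continuous (fun x : R => N%:R * x ^+ N.-1)%R.
  by move=> x; apply: cvgM; [exact: cvg_cst|exact: exprn_continuous].
have := @integration_by_substitution_increasing R (fun x : R => x ^+ N)%R (fun s => depth N s ^+ r)%R 0%R 1%R ler01.
rewrite expr0n expr1n gtn_eqF//= => -> //; last first.
- split.
  + by move=> x _; exact: exprn_derivable.
  + by apply/cvg_at_right_filter/exprn_continuous.
  + by apply/cvg_at_left_filter/exprn_continuous.
- by rewrite dE; apply/cvg_ex; eexists; apply/cvg_at_left_filter; exact: cd.
- by rewrite dE; apply/cvg_ex; eexists; apply/cvg_at_right_filter; exact: cd.
- by rewrite dE => x _; exact: cd.
- move=> x y; rewrite !in_itv /= => /andP[x0 _] /andP[y0 _] xy.
  by rewrite ltrXn2r// -lt0n.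
rewrite dE.
transitivity (\int[leb]_(x in `[0%R, 1%R]) (N%:R%:E * (XMonemX N.-1 r x)%:E)).
  apply: eq_integral => x; rewrite inE /= in_itv /= => /andP[x0 x1].
  have e : ((x ^+ N) `^ N%:R^-1 = x)%R.
    by rewrite -(powR_mulrn N x0) -powRrM mulfV ?powRr1// pnatr_eq0 -lt0n.
  rewrite -EFinM; congr _%:E; rewrite fctE /= /depth e /XMonemX.
  by rewrite mulrCA; congr (_ * _)%R; rewrite mulrC.
rewrite ge0_integralZl//; last 2 first.
- by apply/measurable_EFinP; exact: measurable_XMonemX.
- by move=> x x01; rewrite lee_fin XMonemX_ge0.
have := @EFin_beta_fun R N r.+1; rewrite integral_XMonemX_restrict setTI => <-.
rewrite -EFinM; congr _%:E; case: N N0 {Ninv0 cpow cG mG dE cd} => // N _.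
rewrite beta_fun_fact -(bin_fact (leq_addr r N.+1)) addKn addSn !factS !natrM.
have fN : (N`!%:R : R) != 0%R by rewrite pnatr_eq0 -lt0n fact_gt0.
have fr : (r`!%:R : R) != 0%R by rewrite pnatr_eq0 -lt0n fact_gt0.
have fC : ('C((N + r).+1, N.+1)%:R : R) != 0%R.
  by rewrite pnatr_eq0 -lt0n bin_gt0 ltnS leq_addr.
by field; rewrite fr fN fC /= nat1r pnatr_eq0.
Qed.

End Beta.

Section Swap.
Local Open Scope ereal_scope.
Context (R : realType) (n : nat).
Notation V := (borel_rV R n).
Notation leb := (@lebesgue_measure R).
Variable nu : 'I_n -> {sigma_finite_measure set (measurableTypeR R) -> \bar R}.

Notation hints := (pints nu (fun=> half R) (@upd R n : 'I_n -> V -> R -> V)).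

(** The height is added as one more coordinate, with index [None], Lebesgue measure and domain
    [unit_itv]. Exchanging it with the other integrations is then an instance of [pint_pintsC]. *)
Let nu' (o : option 'I_n) : {sigma_finite_measure set (measurableTypeR R) -> \bar R} :=
  if o is Some k then nu k else leb.
Let D' (o : option 'I_n) := if o is Some _ then half R else unit_itv R.
Let upd' (o : option 'I_n) (p : V * measurableTypeR R) (t : R) : V * measurableTypeR R :=
  if o is Some k then (upd k p.1 t, p.2) else (p.1, t).

Let mD' o : measurable (D' o).
Proof. by case: o => [k|]; [exact: measurable_half|exact: measurable_unit_itv]. Qed.

Let mupd' o : measurable_fun setT
  (fun p : (V * measurableTypeR R) * measurableTypeR R => upd' o p.1 p.2).
Proof.
have m11 : measurable_fun setT
    (fun p : (V * measurableTypeR R) * measurableTypeR R => p.1.1).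
  exact: measurableT_comp measurable_fst measurable_fst.
have m12 : measurable_fun setT
    (fun p : (V * measurableTypeR R) * measurableTypeR R => p.1.2).
  exact: measurableT_comp measurable_snd measurable_fst.
have m2 : measurable_fun setT
    (fun p : (V * measurableTypeR R) * measurableTypeR R => p.2).
  exact: measurable_snd.
case: o => [k|] /=; apply: measurable_fun_pair => //.
exact: measurableT_comp (@measurable_upd2 R n k) (measurable_fun_pair m11 m2).
Qed.

Let updC' o o' p s t : o != o' -> upd' o (upd' o' p s) t = upd' o' (upd' o p t) s.
Proof.
by case: o o' => [k|] [k'|] //= kk'; congr pair; exact: upd_comm.
Qed.

Let pints' := pints nu' D' upd'.

Let pints'E l f p : pints' (map some l) f p = hints l (fun x => f (x, p.2)) p.1.
Proof.
elim: l p => [|k l IH] p; first by case: p.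
by rewrite /pints' /= -/pints' /pint; apply: eq_integral => t _; exact: IH.
Qed.

Variable F : V -> R -> \bar R.
Hypothesis hF : mnonneg (fun p : V * measurableTypeR R => F p.1 p.2).

Lemma hints_integral l x :
  hints l (fun y => \int[leb]_(s in unit_itv R) F y s) x =
  \int[leb]_(s in unit_itv R) hints l (fun y => F y s) x.
Proof.
have := pint_pintsC nu' mD' mupd' updC' None (map some l) hF.
move=> /(congr1 (fun h => h (x, 0%R))); rewrite -/pints' pints'E /= => <-.
by apply: eq_integral => s _; rewrite pints'E.
Qed.

Lemma measurable_hints_param l x :
  measurable_fun (setT : set (measurableTypeR R)) (fun s => hints l (fun y => F y s) x).
Proof.
have [mp _] := mnonneg_pints nu' mD' mupd' (map some l) hF.
have := measurableT_comp mp (measurable_fun_pair (measurable_cst x) (@measurable_id _ (measurableTypeR R) setT)).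
by congr measurable_fun; apply/funext => s; rewrite /= -/pints' pints'E.
Qed.

End Swap.

Section ZeroOn.
Local Open Scope ereal_scope.
Context (R : realType) (n : nat).
Notation V := (borel_rV R n).
Notation leb := (@lebesgue_measure R).
Variable nu : 'I_n -> {sigma_finite_measure set (measurableTypeR R) -> \bar R}.
Hypothesis hnu : forall k, dec_measure (nu k).
Variable M : R.
Hypothesis M0 : (0 <= M)%R.

Notation orth := (@nonneg_orthant R n).
Notation hints := (pints nu (fun=> half R) (@upd R n : 'I_n -> V -> R -> V)).

Let mD (k : 'I_n) : measurable (half R). Proof. exact: measurable_half. Qed.
Let mupd := @measurable_upd2 R n.
Let updC := @upd_comm R n.

Lemma reachE l (x y : V) : reach (fun=> half R) (@upd R n : 'I_n -> V -> R -> V) l x y ->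
  orth x -> orth y /\ forall k, k \notin l -> y 0%R k = x 0%R k.
Proof.
elim: l x => [|k l IH] x /=; first by move=> ->.
move=> [t]; rewrite halfE => t0 /IH h x0.
have [y0 yE] := h (orth_upd k x0 t0); split => // j.
by rewrite in_cons negb_or => /andP[jk /yE ->]; rewrite updE (negbTE jk).
Qed.

Lemma good_mono P (f : V -> \bar R) (x y : V) : good M P f -> orth x ->
  (forall k, (x 0%R k <= y 0%R k)%R) -> f y <= f x.
Proof.
move=> gf x0 xy.
pose z (s : seq 'I_n) : 'rV[R]_n := \row_k (if k \in s then y 0%R k else x 0%R k).
have -> : y = z (enum 'I_n) by apply/rowP => k; rewrite mxE mem_enum.
have z0 s : orth (z s) by move=> k; rewrite mxE; case: ifP => // _; exact: le_trans (x0 k) (xy k).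
elim: (enum 'I_n) => [|k s IH].
  by rewrite (_ : z [::] = x)//; apply/rowP => k; rewrite mxE.
apply: le_trans IH.
have -> : z (k :: s) = upd k (z s) (y 0%R k).
  by apply/rowP => j; rewrite !mxE in_cons; case: eqVneq => [->|].
by apply: (good_dec gf) => //; rewrite mxE; case: ifP.
Qed.

(** The orthogonal projection onto the coordinate subspace of the coordinates outside [P]. *)
Definition zero_on (P : pred 'I_n) (x : V) : V :=
  \row_k (if P k then 0%R else x 0%R k).

Lemma orth_zero_on P x : orth x -> orth (zero_on P x).
Proof. by move=> x0 k; rewrite mxE; case: ifP. Qed.

Lemma measurable_zero_on P : measurable_fun setT (zero_on P).
Proof.
apply: measurable_rV => k; rewrite /zero_on; under eq_fun do rewrite mxE.
by case: (P k); [exact: measurable_cst|exact: measurable_coord].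
Qed.

Lemma good_zero_on (P Q : pred 'I_n) f : good M Q f ->
  good M [pred k | Q k && ~~ P k] (f \o zero_on P).
Proof.
move=> gf; split.
- split; first exact: measurableT_comp (good_mnonneg gf).1 (@measurable_zero_on P).
  by move=> x; exact: (good_mnonneg gf).2.
- move=> k x /= /andP[Qk Pk] x0 Mx; apply: (good_supp gf Qk); first exact: orth_zero_on.
  by rewrite mxE (negbTE Pk).
- move=> k x t x0 xt; apply: (good_mono gf); first exact: orth_zero_on.
  move=> j; rewrite !mxE; case: (P j) => //.
  by case: eqVneq => [->|].
- by move=> x x0; apply: (good_fin gf); exact: orth_zero_on.
Qed.

(** [f j] tests the projection of a point along block [j]. In the orthant [L] is closed downwards
    and contains these projections of its points, so its indicator is at most the product of the
    [f j]. Integrating [f j] from the origin over the coordinates outside block [j] sees only a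
    section of [L], which is why sections replace projections in the bound. *)
Lemma loomis_whitney_set (J : finType) (c : 'I_n -> J) (Q : pred 'I_n) (r : nat)
    (l : seq 'I_n) (L : set V) :
  #|J| = r.+1 -> (0 < r)%N -> uniq l -> {subset l <= Q} -> good M Q (eindic L) ->
  (hints l (eindic L) 0%R ^+ r <=
   \prod_j hints [seq k <- l | c k != j] (eindic L) 0%R)%E.
Proof.
move=> cJ r0 ul lQ gL.
pose f j := eindic L \o zero_on [pred k | c k == j].
have orth0 : orth (0%R : 'rV[R]_n) by move=> k; rewrite mxE.
have -> : \prod_j hints [seq k <- l | c k != j] (eindic L) 0%R =
    \prod_j hints [seq k <- l | c k != j] (f j) 0%R.
  apply: eq_bigr => j _; apply: eq_pints => y /reachE[]// _ yE.
  rewrite /f /=; congr (eindic L _); apply/rowP => k; rewrite mxE /=.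
  by case: ifPn => // /eqP ck; rewrite yE ?mxE// mem_filter ck eqxx.
apply: (loomis_whitney hnu M0 (c := c) (f := f) cJ r0 ul lQ (good_mnonneg gL)) => //.
- by move=> j; apply: eq_good (good_zero_on [pred k | c k == j] gL) => k.
- move=> j k y t _ ck; rewrite /f /=; congr (eindic L _); apply/rowP => i.
  by rewrite !mxE /=; case: eqVneq => // ci; case: eqVneq => // ik; move: ci; rewrite ik ck eqxx.
move=> x x0; rewrite {1}/eindic indicE; have [xL|xL] := boolP (x \in L).
  rewrite -EFin_expe expr1n big1// => j _; apply/eqP; rewrite eq_le; apply/andP; split.
    by rewrite /f /= /eindic lee_fin indicE; case: (_ \in _).
  have : eindic L x <= f j x.
    apply: (good_mono gL); first exact: orth_zero_on.
    by move=> k; rewrite mxE; case: ifP.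
  by rewrite {1}/eindic indicE xL.
rewrite -EFin_expe expr0n gtn_eqF//=; apply: prode_ge0 => j _.
by rewrite lee_fin.
Qed.

End ZeroOn.

(** * The inequality for sections *)

Section Layers.
Local Open Scope ereal_scope.
Context (R : realType) (n : nat).
Notation V := (borel_rV R n).
Notation leb := (@lebesgue_measure R).
Variable nu : 'I_n -> {sigma_finite_measure set (measurableTypeR R) -> \bar R}.
Hypothesis hnu : forall k, dec_measure (nu k).
Variable M : R.
Hypothesis M0 : (0 <= M)%R.

Notation orth := (@nonneg_orthant R n).
Notation hints := (pints nu (fun=> half R) (@upd R n : 'I_n -> V -> R -> V)).

Let mD (k : 'I_n) : measurable (half R). Proof. exact: measurable_half. Qed.
Let mupd := @measurable_upd2 R n.
Let updC := @upd_comm R n.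
Let orth0 : orth (0%R : 'rV[R]_n). Proof. by move=> k; rewrite mxE. Qed.

Variables (P : pred 'I_n) (Phi : V -> \bar R) (N : nat) (V0 : R).
Hypotheses (gPhi : good M P Phi) (cPhi : conc N Phi) (N0 : (0 < N)%N).
Hypotheses (Phi0 : Phi 0%R = V0%:E) (V00 : (0 < V0)%R).

Definition upper_level (s : R) : set V := [set x | ((s * V0)%:E <= Phi x)%E].

Let mPhi := good_mnonneg gPhi.

Lemma measurable_upper_level s : measurable (upper_level s).
Proof.
rewrite -[X in measurable X]setTI.
by apply: emeasurable_fun_c_infty => //; case: mPhi.
Qed.

Lemma good_set (S : set V) : measurable S ->
  (forall x, S x -> 0 < Phi x) ->
  (forall x y, orth x -> S y -> Phi y <= Phi x -> S x) -> good M P (eindic S).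
Proof.
move=> mS Spos Sup; split.
- exact: mnonneg_eindic.
- move=> k x Pk x0 Mx; rewrite /eindic indicE memNset// => /Spos.
  by rewrite (good_supp gPhi Pk x0 Mx) ltxx.
- move=> k x t x0 xt; rewrite lee_fin !indicE.
  have [uS|//] := boolP (upd k x t \in S); rewrite mem_set//.
  apply: (Sup _ (upd k x t)) => //; first by rewrite inE in uS.
  exact: (good_dec gPhi).
- by move=> x x0; rewrite ltry.
Qed.

Lemma good_upper_level s : (0 < s)%R -> good M P (eindic (upper_level s)).
Proof.
move=> s0; apply: good_set; first exact: measurable_upper_level.
- by move=> x; apply: lt_le_trans; rewrite lte_fin mulr_gt0.
- by move=> x y x0 yS yx; exact: le_trans yx.
Qed.

Lemma Phi_le x : orth x -> Phi x <= V0%:E.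
Proof.
move=> x0; rewrite -Phi0; apply: (good_mono gPhi orth0) => k.
by rewrite mxE.
Qed.

Definition layer_vol l (s : R) : \bar R := hints l (eindic (upper_level s)) 0%R.

Let F (y : V) (s : R) : \bar R := level (Phi y) V0 s.

Let FE y s : F y s = eindic (upper_level s) y.
Proof. by rewrite /F /level /eindic !indicE; congr (_%:R%:E); apply/idP/idP; rewrite !inE. Qed.

Let layer_volE l s : layer_vol l s = hints l (fun y => F y s) 0%R.
Proof. by apply: eq_pints => y _; rewrite FE. Qed.

Lemma measurable_layer_vol l :
  measurable_fun (setT : set (measurableTypeR R)) (layer_vol l).
Proof.
have := measurable_hints_param nu (F := F) (mnonneg_level V0 mPhi) l 0%R.
by congr measurable_fun; apply/funext => s; rewrite layer_volE.
Qed.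

(** [V0] is the maximum of [Phi] on the orthant, so the minimum in [integral_level] is [Phi] itself;
    it remains to exchange the height with the other variables. *)
Lemma hints_layer l :
  hints l Phi 0%R = V0%:E * \int[leb]_(s in unit_itv R) layer_vol l s.
Proof.
transitivity (hints l (fun y => V0%:E * \int[leb]_(s in unit_itv R) F y s) 0%R).
  apply: eq_pints => y /reachE[]// y0 _.
  by rewrite integral_level// ?mPhi.2// min_l// Phi_le.
rewrite (pintsZl _ mD mupd) ?lee_fin ?(ltW V00)//; last first.
  split; last by move=> x; apply: integral_ge0 => s _; exact: level_ge0.
  have -> : (fun y => \int[leb]_(s in unit_itv R) F y s) =
      (fun y => (V0^-1)%:E * Order.min (Phi y) V0%:E).
    apply/funext => y; rewrite -integral_level ?mPhi.2//.
    by rewrite muleA -EFinM mulVf ?gt_eqF// mul1e.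
  by apply: emeasurable_funM => //; apply: measurable_mine => //; case: mPhi.
rewrite (hints_integral nu (F := F) (mnonneg_level V0 mPhi)); congr (_ * _).
Qed.

Section OneList.
Variable l : seq 'I_n.
Hypotheses (ul : uniq l) (lP : {subset l <= P}).

Lemma layer_vol_ge0 s : 0 <= layer_vol l s.
Proof. by apply: pints_nonneg => x; rewrite lee_fin. Qed.

Lemma layer_vol_fin s : (0 < s)%R -> layer_vol l s \is a fin_num.
Proof.
move=> s0; rewrite ge0_fin_numE ?layer_vol_ge0//.
exact: (good_fin (good_hints hnu M0 ul lP (good_upper_level s0))).
Qed.

(** All these superlevel sets lie in the set where [Phi > 0], which has finite volume because the
    support is bounded. This supplies the hypothesis [wC] of [berwald]. *)
Lemma layer_vol_bounded : exists C : R, forall s, (0 < s)%R -> layer_vol l s <= C%:E.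
Proof.
pose S := [set x : V | (0 < Phi x)%E].
have mS : measurable S.
  rewrite -[X in measurable X]setTI; apply: emeasurable_fun_o_infty => //; exact: mPhi.1.
have gS : good M P (eindic S).
  by apply: good_set => // x y x0 yS yx; exact: lt_le_trans yx.
exists (fine (hints l (eindic S) 0%R)) => s s0.
rewrite fineK; last first.
  rewrite ge0_fin_numE; first exact: (good_fin (good_hints hnu M0 ul lP gS)).
  by apply: pints_nonneg => x; rewrite lee_fin.
apply: (le_pints _ mD mupd); [exact: mnonneg_eindic (measurable_upper_level s)|exact: mnonneg_eindic|].
move=> y _; rewrite lee_fin !indicE; have [yL|//] := boolP (y \in upper_level s).
rewrite mem_set//; move: yL; rewrite inE; apply: lt_le_trans.
by rewrite lte_fin mulr_gt0.
Qed.

Lemma depthK (s : R) : (0 <= s)%R -> ((1 - depth N s) ^+ N = s)%R.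
Proof.
move=> s0; rewrite /depth subKr -powR_mulrn ?powR_ge0// -powRrM mulVf ?powRr1//.
by rewrite pnatr_eq0 -lt0n.
Qed.

Lemma depth_ge0 (s : R) : (0 <= s)%R -> (s <= 1)%R -> (0 <= depth N s)%R.
Proof.
move=> s0 s1; rewrite /depth subr_ge0 [leRHS](_ : _ = 1 `^ N%:R^-1)%R; last by rewrite powR1.
by apply: ge0_ler_powR; rewrite ?nnegrE ?invr_ge0.
Qed.

Lemma depth_lt1 (s : R) : (0 < s)%R -> (depth N s < 1)%R.
Proof. by move=> s0; rewrite /depth ltrBlDr ltrDl powR_gt0. Qed.

Lemma depth_le (s s' : R) : (0 < s)%R -> (0 < s')%R ->
  (depth N s <= depth N s')%R -> (s' <= s)%R.
Proof.
move=> s0 s0' h; rewrite -(depthK (ltW s0)) -(depthK (ltW s0')).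
have := depth_lt1 s0; have := depth_lt1 s0'.
by move=> h' h''; rewrite lerXn2r ?nnegrE ?lerD2l ?lerN2 ?subr_ge0 ?(ltW h') ?(ltW h'').
Qed.

Lemma layer_vol_nd (s s' : R) : (0 < s)%R -> (0 < s')%R ->
  (depth N s <= depth N s')%R -> layer_vol l s <= layer_vol l s'.
Proof.
move=> s0 s0' h; apply: (le_pints _ mD mupd).
- exact: mnonneg_eindic (measurable_upper_level s).
- exact: mnonneg_eindic (measurable_upper_level s').
move=> y _; rewrite lee_fin !indicE; have [yL|//] := boolP (y \in upper_level s).
rewrite mem_set//; move: yL; rewrite inE; apply: le_trans.
by rewrite lee_fin ler_pM2r// depth_le.
Qed.

(** Concavity of [Phi ^ (1/N)] on the segment from 0, where [Phi = V0], to a point of level [s']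
    puts [t = depth s / depth s'] times that point in level [s]; by [hints_scale] volumes in
    [size l] variables lose at most the factor [t ^ size l]. This supplies the hypothesis [w_star]
    of [berwald]. *)
Lemma layer_vol_star (s s' : R) : (0 < size l)%N ->
  (0 < s)%R -> (s <= 1)%R -> (0 < s')%R -> (s' <= 1)%R ->
  (depth N s <= depth N s')%R ->
  layer_vol l s' * (depth N s ^+ size l)%:E <= layer_vol l s * (depth N s' ^+ size l)%:E.
Proof.
move=> sl s0 s1 s0' s1' h.
have d0 := depth_ge0 (ltW s0) s1; have d0' := depth_ge0 (ltW s0') s1'.
have [z|ds] := eqVneq (depth N s) 0%R.
  by rewrite z expr0n gtn_eqF// mule0 mule_ge0 ?layer_vol_ge0// lee_fin exprn_ge0.
have {}d0 : (0 < depth N s)%R by rewrite lt_neqAle eq_sym ds.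
have {}d0' : (0 < depth N s')%R by exact: lt_le_trans h.
set t := (depth N s / depth N s')%R.
have t0 : (0 < t)%R by exact: divr_gt0.
have t1 : (t <= 1)%R by rewrite ler_pdivrMr// mul1r.
have := @hints_scale R n nu hnu M M0 P (eindic (upper_level s')) (eindic (upper_level s)) l t
  (good_upper_level s0') ul lP (mnonneg_eindic (measurable_upper_level s)) t0 t1.
move=> /(_ _ 0%R orth0); rewrite scaler0 -/(layer_vol l s) -/(layer_vol l s') => hs.
have -> : (depth N s = t * depth N s')%R by rewrite /t divfK// gt_eqF.
rewrite exprMn EFinM muleA [_ * (t ^+ _)%:E]muleC; apply: lee_wpmul2r.
  by rewrite lee_fin exprn_ge0// ltW.
apply: hs => x x0; rewrite lee_fin !indicE.
have [xL|//] := boolP (x \in upper_level s'); rewrite mem_set//; move: xL; rewrite inE.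
rewrite /upper_level /= => xL.
have [r r0 rE] := exists_root N0 (ltW V00).
have {}r0 : (0 < r)%R.
  rewrite lt_neqAle r0 andbT; apply/eqP => r00; move: V00.
  by rewrite -rE -r00 expr0n gtn_eqF// ltxx.
have G0 : (0 < r * (1 - depth N s'))%R by rewrite mulr_gt0// subr_gt0 depth_lt1.
have Fx : (r ^+ N)%:E <= Phi 0%R by rewrite rE Phi0.
have Gx : ((r * (1 - depth N s')) ^+ N)%:E <= Phi x.
  by rewrite exprMn depthK ?(ltW s0')// rE mulrC.
have := cPhi orth0 x0 (ltW t0) t1 r0 G0 Fx Gx.
rewrite scaler0 add0r; apply: le_trans; rewrite lee_fin.
rewrite (_ : (1 - t) * r + t * (r * (1 - depth N s')) = r * (1 - t * depth N s'))%R; last by ring.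
by rewrite /t divfK ?gt_eqF// exprMn rE depthK ?(ltW s0)// mulrC.
Qed.

End OneList.

(** Each [i] is missing from exactly one of the [k.+1] lists. This supplies the relation [sum_p]
    between the exponents in [berwald]. *)
Lemma sum_size_filter (J : finType) (c : 'I_n -> J) (k : nat) (l : seq 'I_n) :
  #|J| = k.+1 -> (\sum_j size [seq i <- l | c i != j] = k * size l)%N.
Proof.
move=> cJ; elim: l => [|i l IH]; first by rewrite big1 ?muln0.
rewrite /= mulnS -IH (eq_bigr (fun j => (c i != j) + size [seq i <- l | c i != j])%N).
  rewrite big_split /=; congr (_ + _)%N.
  rewrite -big_mkcond /= sum1_card -[k]/(k.+1.-1) -cJ -(cardC1 (c i)).
  by apply: eq_card => j; rewrite !inE eq_sym.
by move=> j _; case: (c i != j).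
Qed.

(* Loomis-Whitney on every superlevel set of [Phi], then [berwald] in the height
   with [u = depth N]; the moments of [depth N] are the inverse binomials. *)
Lemma layers_ineq (J : finType) (c : 'I_n -> J) (k : nat) (l : seq 'I_n) :
  #|J| = k.+2 -> uniq l -> {subset l <= P} ->
  (forall j, (0 < size [seq i <- l | c i != j])%N) ->
  ((hints l Phi 0%R) ^+ k.+1 * V0%:E <=
   ((\prod_j 'C(N + size [seq i <- l | c i != j], N)%:R) /
      'C(N + size l, N)%:R ^+ k.+1)%R%:E *
   \prod_j hints [seq i <- l | c i != j] Phi 0%R)%E.
Proof.
move=> cJ ul lP lj0.
pose l_ j := [seq i <- l | c i != j].
have ul_ j : uniq (l_ j) by exact: filter_uniq.
have lP_ j : {subset l_ j <= P} by move=> i; rewrite mem_filter => /andP[_ /lP].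
have unit0 s : unit_itv R s -> (0 < s)%R /\ (s <= 1)%R.
  by rewrite /unit_itv /= in_itv /= => /andP.
have hfin l' : uniq l' -> {subset l' <= P} -> hints l' Phi 0%R \is a fin_num.
  move=> u' P'; rewrite ge0_fin_numE; last by apply: pints_nonneg; exact: mPhi.2.
  exact: (good_fin (good_hints hnu M0 u' P' gPhi)).
pose v l' s : R := fine (layer_vol l' s).
have vE l' s : uniq l' -> {subset l' <= P} -> (0 < s)%R -> layer_vol l' s = (v l' s)%:E.
  by move=> u' P' s0; rewrite /v fineK// layer_vol_fin.
have mv l' : measurable_fun (unit_itv R) (v l').
  apply: measurable_funTS; apply: measurableT_comp (measurable_layer_vol l').
  exact: fine_measurable.
have Xv l' : uniq l' -> {subset l' <= P} ->
    hints l' Phi 0%R = V0%:E * \int[leb]_(s in unit_itv R) (v l' s)%:E.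
  move=> u' P'; rewrite hints_layer; congr (_ * _); apply: eq_integral => s.
  by rewrite inE => /unit0[s0 _]; rewrite vE.
have X0 l' : 0 <= \int[leb]_(s in unit_itv R) (v l' s)%:E.
  by apply: integral_ge0 => s _; rewrite lee_fin fine_ge0// layer_vol_ge0.
have Xfin l' : uniq l' -> {subset l' <= P} ->
    \int[leb]_(s in unit_itv R) (v l' s)%:E \is a fin_num.
  move=> u' P'; have := hfin _ u' P'; rewrite Xv//.
  case: (\int[leb]_(s in _) _) (X0 l') => [//|_|//].
  by rewrite gt0_muley// lte_fin.
pose X l' := fine (\int[leb]_(s in unit_itv R) (v l' s)%:E).
have XE l' : uniq l' -> {subset l' <= P} ->
  \int[leb]_(s in unit_itv R) (v l' s)%:E = (X l')%:E.
  by move=> u' P'; rewrite /X fineK// Xfin.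
have hX l' : uniq l' -> {subset l' <= P} -> hints l' Phi 0%R = (V0 * X l')%:E.
  by move=> u' P'; rewrite Xv// XE// EFinM.
have X0' l' : (0 <= X l')%R by rewrite /X fine_ge0.
have v0 l' s : (0 <= v l' s)%R by rewrite fine_ge0// layer_vol_ge0.
have prod_v s : unit_itv R s -> (v l s ^+ k.+1 <= \prod_j v (l_ j) s)%R.
  move=> /unit0[s0 _]; rewrite -lee_fin EFin_expe -vE// -prodEFin.
  under eq_bigr do rewrite -vE//.
  exact: (loomis_whitney_set hnu M0 c cJ _ ul lP (good_upper_level s0)).
rewrite hX// (eq_bigr (fun j => (V0 * X (l_ j))%:E)) => [|j _]; last exact: hX (ul_ j) (lP_ j).
rewrite prodEFin -EFin_expe -!EFinM lee_fin.
have B0 r : (0 < 'C(N + r, N)%:R^-1 :> R)%R by rewrite invr_gt0 ltr0n bin_gt0 leq_addr.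
(* [berwald] asks for positive integrals; if one of them is 0, Loomis-Whitney on the levels forces
   the left side to be 0. *)
have [[j Xj]|nX] := pselect (exists j, X (l_ j) = 0%R).
  have Xl : X l = 0%R.
    apply/eqP; rewrite -eqe -XE//; apply/eqP.
    apply: (@integral_eq0_le _ (measurableTypeR R) R leb (unit_itv R) (@measurable_unit_itv R) (fun s => (v (l_ j) s)%:E) (fun s => (v l s)%:E)).
    - exact/measurable_EFinP.
    - exact/measurable_EFinP.
    - by move=> s _; rewrite lee_fin.
    - by move=> s _; rewrite lee_fin.
    - move=> s us [vj]; congr _%:E; have := prod_v s us.
      rewrite (bigD1 j)//= vj mul0r => h.
      by apply/eqP; rewrite -[_ == _](expf_eq0 _ k.+1) eq_le h exprn_ge0.
    - by rewrite XE// Xj.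
  rewrite Xl mulr0 expr0n mul0r mulr_ge0//.
    by rewrite divr_ge0 ?exprn_ge0// prodr_ge0.
  by apply: prodr_ge0 => i _; rewrite mulr_ge0// ltW.
have {}nX j : (0 < X (l_ j))%R.
  by rewrite lt_neqAle X0' andbT; apply/eqP => h; apply: nX; exists j.
have pq j : (size (l_ j) <= size l)%N by rewrite size_filter count_size.
have BW : ((\int[leb]_(s in unit_itv R) (v l s)%:E) ^+ k.+1 <=
    ((\prod_j (X (l_ j) / 'C(N + size (l_ j), N)%:R^-1)) *
       'C(N + size l, N)%:R^-1 ^+ k.+1)%R%:E)%E.
  apply: (@berwald _ _ R leb (unit_itv R) (@measurable_unit_itv R) J
    (fun j => size (l_ j)) (size l) k (depth N) (fun j => v (l_ j)) (v l)
    (fun j => X (l_ j)) (fun r => 'C(N + r, N)%:R^-1)%R cJ lj0 pq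
    (sum_size_filter c l cJ)) => //.
  - by apply: measurable_funTS; apply: measurable_funB => //; exact: measurable_powR.
  - by move=> s /unit0[s0 s1]; apply: depth_ge0 => //; exact: ltW.
  - move=> j; have [C HC] := layer_vol_bounded (ul_ j) (lP_ j).
    by exists C => s /unit0[s0 _]; rewrite -lee_fin -vE// HC.
  - move=> j s s' /unit0[s0 _] /unit0[s0' _] ss'; rewrite -lee_fin -!vE//.
    exact: layer_vol_nd.
  - move=> j s s' /unit0[s0 s1] /unit0[s0' s1'] ss'; rewrite -lee_fin !EFinM -!vE//.
    by apply: (layer_vol_star (ul_ j) (lP_ j)) => //; exact: lj0.
  - by move=> r; exact: integral_depth.
  - by move=> j; exact: XE.
move: BW; rewrite XE// -EFin_expe lee_fin => BW.
have -> : (\prod_j (V0 * X (l_ j)) = V0 ^+ k.+2 * \prod_j X (l_ j))%R.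
  by rewrite big_split /= prodr_const -cJ.
rewrite exprMn mulrAC -exprSr.
have -> : (\prod_j 'C(N + size (l_ j), N)%:R / 'C(N + size l, N)%:R ^+ k.+1 *
    (V0 ^+ k.+2 * \prod_j X (l_ j)) = V0 ^+ k.+2 *
    ((\prod_j (X (l_ j) / 'C(N + size (l_ j), N)%:R^-1)) *
       'C(N + size l, N)%:R^-1 ^+ k.+1))%R.
  under [in RHS]eq_bigr do rewrite invrK.
  by rewrite big_split /= exprVn; ring.
by rewrite ler_wpM2l// exprn_ge0// ltW.
Qed.

End Layers.

Section SectionVolumes.
Local Open Scope ereal_scope.
Context (R : realType) (n : nat).
Notation V := (borel_rV R n).
Variable nu : 'I_n -> {sigma_finite_measure set (measurableTypeR R) -> \bar R}.
Hypothesis hnu : forall k, dec_measure (nu k).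
Variable M : R.
Hypothesis M0 : (0 <= M)%R.

Notation orth := (@nonneg_orthant R n).
Notation hints := (pints nu (fun=> half R) (@upd R n : 'I_n -> V -> R -> V)).

Let mD (k : 'I_n) : measurable (half R). Proof. exact: measurable_half. Qed.
Let mupd := @measurable_upd2 R n.
Let updC := @upd_comm R n.
Let orth0 : orth (0%R : 'rV[R]_n). Proof. by move=> k; rewrite mxE. Qed.

(** This is [mu_F (A)]: the integration starts at the origin, so the coordinates outside [F] stay 0
    and a section is measured. *)
Definition secvol (A : set V) (F : {set 'I_n}) : \bar R := hints (enum F) (eindic A) 0%R.

Lemma secvol_ge0 A F : 0 <= secvol A F.
Proof. by apply: pints_nonneg => x; rewrite lee_fin. Qed.

Variable A : set V.
Hypotheses (gA : good M predT (eindic A)) (cA : conc 0 (eindic A)) (A0 : A 0%R).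

Lemma secvol_fin F : secvol A F \is a fin_num.
Proof.
rewrite ge0_fin_numE ?secvol_ge0//.
by apply: (good_fin (good_hints hnu M0 _ _ gA)); rewrite ?enum_uniq.
Qed.

Lemma eindicA0 : eindic A 0%R = 1.
Proof. by rewrite /eindic indicE mem_set. Qed.

Lemma secvolE l (F : {set 'I_n}) : uniq l -> l =i F -> secvol A F = hints l (eindic A) 0%R.
Proof.
move=> ul lF; rewrite /secvol; congr (_ 0%R).
apply: (perm_pints _ mD mupd updC (good_mnonneg gA)).
by apply: uniq_perm; rewrite ?enum_uniq// => k; rewrite mem_enum lF.
Qed.

(* [[set k | c k == None]] and [[set k | c k == Some i]] are the blocks [F_0] and
   [F_i] of a partition of the coordinates. *)
Lemma section_ineq (m N : nat) (c : 'I_n -> option 'I_m) : (0 < m)%N ->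
  N = #|[set k | c k == None]%SET| ->
  (secvol A [set: 'I_n] ^+ m.-1 * secvol A [set k | c k == None] <=
   ((\prod_(i < m) 'C(#|~: [set k | c k == Some i]|, N)%:R) / 'C(n, N)%:R ^+ m.-1)%R%:E *
   \prod_(i < m) secvol A (~: [set k | c k == Some i]))%E.
Proof.
move=> m0 NE.
have Nn : (N <= n)%N by rewrite NE -[leqRHS]card_ord max_card.
(* If one block [F_i] contains all coordinates outside [F_0], the list [l_ i] used below is empty,
   which [layers_ineq] excludes. Both sides then coincide, with constant 1. The case [m = 1] is
   always of this kind. *)
have [/existsP[i /forallP hi]|] := boolP [exists i : 'I_m, [forall k, (c k == None) || (c k == Some i)]].
  have Fi : ~: [set k | c k == Some i]%SET = [set k | c k == None]%SET.
    by apply/setP => k; rewrite !inE; case/orP: (hi k) => /eqP ->; rewrite ?eqxx.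
  have Fj j : j != i -> ~: [set k | c k == Some j]%SET = [set: 'I_n]%SET.
    move=> ji; apply/setP => k; rewrite !inE; case/orP: (hi k) => /eqP -> //.
    by apply: contra ji => /eqP[->].
  have cj : #|[pred j | j != i]| = m.-1.
    have := cardC1 i; rewrite card_ord => <-; apply: eq_card => j; by rewrite !inE.
  rewrite (bigD1 i)//= Fi -NE binn mul1r (eq_bigr (fun=> 'C(n, N)%:R : R)) => [|j ji]; last first.
    by rewrite Fj// cardsT card_ord.
  rewrite prodr_const cj divff; last first.
    by rewrite expf_neq0// pnatr_eq0 -lt0n bin_gt0.
  rewrite mul1e (bigD1 i)//= Fi (eq_bigr (fun=> secvol A [set: 'I_n])) => [|j ji]; last by rewrite Fj.
  rewrite muleC; apply: lee_wpmul2l; first exact: secvol_ge0.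
  rewrite -(fineK (secvol_fin [set: 'I_n])) prodEFin prodr_const cj.
  by rewrite EFin_expe.
rewrite negb_exists => /forallP nt.
case: m m0 c NE nt => // -[|k] _ c NE nt.
  have /negP[] := nt ord0; apply/forallP => k; case: (c k) => // i.
  by rewrite (ord1 i) eqxx orbT.
rewrite -[k.+2.-1]/(k.+1).
pose P := [pred i | c i != None].
pose l := enum P.
(* The default [ord0] is taken only on [F_0], which [l] avoids. *)
pose c' i := odflt ord0 (c i).
pose l_ (j : 'I_k.+2) := [seq i <- l | c' i != j].
have ul : uniq l by exact: enum_uniq.
have lP : {subset l <= P} by move=> i; rewrite mem_enum.
have l_0 j : (0 < size (l_ j))%N.
  have /forallPn[i] := nt j; rewrite negb_or => /andP[ci cj].
  suff : i \in l_ j by case: (l_ j).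
  rewrite mem_filter mem_enum /= inE ci andbT /c'.
  by case: (c i) ci cj => //= a _; apply: contra => /eqP ->.
have l_E j : l_ j ++ enum [set i | c i == None]%SET =i ~: [set i | c i == Some j]%SET.
  move=> i; rewrite mem_cat mem_filter !mem_enum !inE /c' /=.
  case: (c i) => [a|] /=; last by rewrite andbF eqxx.
  by rewrite andbT orbF; congr (~~ _); apply/eqP/eqP => [->|[->]].
have lE : l ++ enum [set i | c i == None]%SET =i [set: 'I_n]%SET.
  by move=> i; rewrite mem_cat !mem_enum !inE /=; case: (c i).
have ucat s : uniq s -> {subset s <= P} -> uniq (s ++ enum [set i | c i == None]%SET).
  move=> us sP; rewrite cat_uniq us enum_uniq andbT /=; apply/hasPn => i.
  rewrite mem_enum inE => /eqP ci; apply/negP => /sP; rewrite inE /= ci.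
  by [].
have ul_ j : uniq (l_ j) by exact: filter_uniq.
have lP_ j : {subset l_ j <= P} by move=> i; rewrite mem_filter => /andP[_ /lP].
rewrite (secvolE (ucat _ ul lP) lE).
have -> : \prod_(i < k.+2) secvol A (~: [set j | c j == Some i]) =
    \prod_(i < k.+2) hints (l_ i ++ enum [set i | c i == None]%SET) (eindic A) 0%R.
  by apply: eq_bigr => j _; rewrite (secvolE (ucat _ (ul_ j) (lP_ j)) (l_E j)).
have -> : (\prod_(i < k.+2) 'C(#|~: [set j | c j == Some i]|, N)%:R =
    \prod_(i < k.+2) 'C(N + size (l_ i), N)%:R :> R)%R.
  apply: eq_bigr => j _; congr ('C(_, _)%:R); rewrite -(eq_card (l_E j)).
  by rewrite (card_uniqP (ucat _ (ul_ j) (lP_ j))) size_cat -cardE -NE addnC.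
have nE : n = (N + size l)%N.
  rewrite -[LHS]card_ord -cardsT -(eq_card lE) (card_uniqP (ucat _ ul lP)).
  by rewrite size_cat -cardE -NE addnC.
rewrite [X in 'C(X, N)](nE).
rewrite pints_cat; under [X in _ <= _ * X]eq_bigr do rewrite pints_cat.
pose Phi := hints (enum [set i | c i == None]%SET) (eindic A).
rewrite -/Phi -[secvol _ _]/(Phi 0%R).
have gPhi : good M P Phi.
  have := good_hints hnu M0 (enum_uniq [set i | c i == None]%SET) _ gA.
  by move=> /(_ (fun _ _ => isT)); apply: eq_good => i /=; rewrite mem_enum inE.
have Phi_ge0 := (good_mnonneg gPhi).2.
have Phi_fin : Phi 0%R \is a fin_num by rewrite ge0_fin_numE//; exact: (good_fin gPhi).
have RHS0 a : (0 <= a)%R -> 0 <= a%:E * \prod_(i < k.+2) hints (l_ i) Phi 0%R.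
  by move=> a0; rewrite mule_ge0 ?lee_fin// prode_ge0// => j _; apply: pints_nonneg.
have [Phi0|Phi0] := eqVneq (Phi 0%R) 0.
  by rewrite Phi0 mule0 RHS0// divr_ge0 ?exprn_ge0// prodr_ge0.
have Phi_gt0 : (0 < fine (Phi 0%R))%R.
  by rewrite -lte_fin fineK// lt_neqAle eq_sym Phi0 Phi_ge0.
have cJ : #|'I_k.+2| = k.+2 by rewrite card_ord.
(* When [F_0] is empty, [Phi] is the indicator of [A] and the constant is 1: the claim is
   Loomis-Whitney for [A]. *)
have [N0|N0] := posnP N.
  have F0 : enum [set i | c i == None]%SET = [::].
    by apply: size0nil; rewrite -cardE -NE.
  have PhiE : Phi = eindic A by rewrite /Phi F0.
  rewrite N0 big1 ?bin0 ?expr1n ?divr1 ?mul1e => [|j _]; last by rewrite bin0.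
  rewrite PhiE eindicA0 mule1; move: gPhi; rewrite PhiE => gP.
  exact: (loomis_whitney_set hnu M0 c' cJ _ ul lP gP).
have cPhi : conc N Phi.
  rewrite NE cardE; apply: (conc_hints hnu M0 gA (enum_uniq _)) => //.
  by move=> x; rewrite /eindic indicE; case: (_ \in _); [right|left].
have := layers_ineq hnu M0 gPhi cPhi N0 (esym (fineK Phi_fin)) Phi_gt0 (c := c') cJ ul lP l_0.
by rewrite fineK.
Qed.

End SectionVolumes.

(** * Anti-blocking bodies *)

Section AntiBlocking.
Context (R : realType) (n : nat).
Notation V := (borel_rV R n).
Notation orth := (@nonneg_orthant R n).

(* [M] is a common bound for the coordinates. *)
Record antib (M : R) (K : set 'rV[R]_n) : Prop := AntiB {
  antib0 : K 0 ;
  antib_orth : K `<=` orth ;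
  antib_compact : compact K ;
  antib_le : forall x k, K x -> x 0 k <= M ;
  antib_down : forall x k t, K x -> 0 <= t -> t <= x 0 k -> K (upd k x t) ;
  antib_convex : forall x y t, K x -> K y -> 0 <= t -> t <= 1 ->
    K ((1 - t) *: x + t *: y) }.

Lemma compact_measurable_rV (K : set V) : compact (K : set 'rV[R]_n) -> measurable K.
Proof.
move=> /compact_closed => /(_ (@norm_hausdorff _ _)) cK.
rewrite -(setCK K); apply: measurableC; apply: sub_sigma_algebra.
exact: closed_openC.
Qed.

Lemma coord_subspace_coord (I : {set 'I_n}) (x : 'rV[R]_n) k :
  x \in coord_subspace R I -> k \notin I -> x 0 k = 0.
Proof.
move=> /coord_span -> kI; rewrite summxE big1// => i _; rewrite mxE.
have isz : (i < size (enum I))%N by rewrite -cardE ltn_ord.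
rewrite (nth_map k)// mxE eqxx /=; case: eqVneq => [ki|]; last by rewrite mulr0.
by move: kI; rewrite ki -mem_enum mem_nth.
Qed.

Lemma zero_on_coord_subspace (I : {set 'I_n}) (x : 'rV[R]_n) :
  zero_on [pred k | k \notin I] x \in coord_subspace R I.
Proof.
rewrite [zero_on _ _]matrix_sum_delta big_ord1; apply: memv_suml => k _.
rewrite mxE /=; case: (boolP (k \in I)) => kI /=; last by rewrite scale0r mem0v.
apply: memvZ; apply: memv_span; apply/mapP; exists k => //.
by rewrite mem_enum.
Qed.

Lemma anti_blocking_zero_on (K : set 'rV[R]_n) (I : {set 'I_n}) x :
  anti_blocking K -> K x -> K (zero_on [pred k | k \notin I] x).
Proof.
move=> [_ _ KI] Kx.
suff : (K `&` [set x | x \in coord_subspace R I]) (zero_on [pred k | k \notin I] x) by case.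
rewrite -KI; exists x => //; split; first exact: zero_on_coord_subspace.
move=> z zI; rewrite /dotv big1// => k _; rewrite !mxE /=.
by case: (boolP (k \in I)) => kI /=; [rewrite subrr mul0r|rewrite (coord_subspace_coord zI kI) mulr0].
Qed.

Lemma coord_le_norm (x : 'rV[R]_n) k : `|x 0 k| <= `|x|.
Proof.
rewrite [leRHS]/Num.norm /= mx_normrE.
by apply/bigmax_geP; right => /=; exists (0, k).
Qed.

(** The origin is the projection of any point onto the zero subspace. For closure downwards in
    coordinate [k], the projection of [y] that kills this coordinate is in [K], and the segment from
    it to [y] contains the required point. *)
Lemma anti_blocking_antib (K : set 'rV[R]_n) :
  anti_blocking K -> exists2 M : R, 0 <= M & antib M K.
Proof.
move=> aK; have [[[x Kx] cK vK] Ko _] := aK.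
have vK' y z t : K y -> K z -> 0 <= t -> t <= 1 -> K ((1 - t) *: y + t *: z).
  move=> Ky Kz t0 t1; have t0' : 0 <= 1 - t by lra.
  have t1' : 1 - t <= 1 by lra.
  have := vK y z (Itv01 t0' t1') (mem_set Ky) (mem_set Kz).
  by rewrite inE; congr K; rewrite /conv /= /unstable.onem subKr.
have [M [_ HM]] := compact_bounded cK.
exists (`|M| + 1); first by rewrite addr_ge0.
split => //.
- have := anti_blocking_zero_on finset.set0 aK Kx; congr K.
  by apply/rowP => k; rewrite !mxE /= inE.
- move=> y k Ky; have := HM (`|M| + 1) _ y Ky; rewrite ltr_pwDr ?ler_norm// => /(_ isT) h.
  apply: le_trans h; apply: le_trans (ler_norm _) _.
  exact: coord_le_norm.
- move=> y k t Ky t0 ty.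
  have [y0|yn0] := eqVneq (y 0 k) 0.
    rewrite (_ : t = y 0 k) ?upd_id//; apply/eqP; rewrite eq_le ty /=.
    by rewrite y0.
  have yp : 0 < y 0 k by rewrite lt_neqAle eq_sym yn0 (Ko _ Ky).
  have Kz := anti_blocking_zero_on (~: [set k])%SET aK Ky.
  have := vK' _ _ (t / y 0 k) Kz Ky (divr_ge0 t0 (ltW yp)).
  rewrite ler_pdivrMr// mul1r => /(_ ty); congr K.
  apply/rowP => j; rewrite !mxE /= !inE negbK; case: eqVneq => [->|jk].
    by rewrite mulr0 add0r divfK.
  by rewrite -mulrDl subrK mul1r.
Qed.

End AntiBlocking.

Section Intervals.
Local Open Scope ereal_scope.
Context (R : realType) (nu : {measure set (measurableTypeR R) -> \bar R}).
Hypothesis hnu : dec_measure nu.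

(** A concave function that is nonnegative at 0 is subadditive: [nu [0, c]] is at least the fraction
    [c / (a + b)] of [nu [0, a + b]], and the fractions for [a] and [b] add up to 1. *)
Lemma dec_measure_add (a b : R) : (0 <= a)%R -> (0 <= b)%R ->
  nu `[0%R, (a + b)%R]%classic <= nu `[0%R, a]%classic + nu `[0%R, b]%classic.
Proof.
move=> a0 b0; have [s0|sn0] := eqVneq (a + b)%R 0%R.
  have -> : b = 0%R by move: s0; lra.
  by rewrite addr0 leeDl.
have s0 : (0 < a + b)%R by rewrite lt_neqAle eq_sym sn0 addr_ge0.
have key c : (0 <= c)%R -> (c <= a + b)%R ->
    (c / (a + b))%:E * nu `[0%R, (a + b)%R]%classic <= nu `[0%R, c]%classic.
  move=> c0 cs; have t0 : (0 <= c / (a + b))%R by rewrite divr_ge0// ltW.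
  have t1 : (c / (a + b) <= 1)%R by rewrite ler_pdivrMr// mul1r.
  have := dec_concave hnu (lexx 0%R) (ltW s0) t0 t1.
  rewrite mulr0 add0r divfK ?gt_eqF//; apply: le_trans.
  by rewrite leeDr// mule_ge0// lee_fin subr_ge0.
apply: le_trans (leeD (key a a0 _) (key b b0 _)); rewrite ?lerDl ?lerDr//.
rewrite -ge0_muleDl; try by rewrite lee_fin divr_ge0// ltW.
by rewrite -EFinD -mulrDl divff// mul1e.
Qed.

Lemma dec_measure_sum (J : finType) (P : pred J) (a : J -> R) : (forall j, (0 <= a j)%R) ->
  nu `[0%R, (\sum_(j | P j) a j)%R]%classic <= \sum_(j | P j) nu `[0%R, a j]%classic.
Proof.
move=> a0; suff : (0 <= \sum_(j | P j) a j)%R /\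
   nu `[0%R, (\sum_(j | P j) a j)%R]%classic <= \sum_(j | P j) nu `[0%R, a j]%classic by case.
elim/big_rec2: _ => [|j x y _ [x0 xy]].
  by rewrite set_itv1 (dec_set1 hnu).
split; first by rewrite addr_ge0.
by apply: le_trans (dec_measure_add (a0 j) x0) _; rewrite leeD2l.
Qed.

Lemma dec_measure_symm (a b : R) : (0 <= a)%R -> (0 <= b)%R ->
  nu `[(- b)%R, a]%classic = nu `[0%R, b]%classic + nu `[0%R, a]%classic.
Proof.
move=> a0 b0; rewrite -(dec_even hnu b).
have -> : nu `[0%R, a]%classic = nu `]0%R, a]%classic.
  rewrite (_ : `[0%R, a]%classic = [set 0%R] `|` `]0%R, a]%classic); last first.
    apply/seteqP; split => x /=; rewrite !in_itv /=.
      by move=> /andP[]; rewrite le_eqVlt => /predU1P[->|-> ->]; [left|right].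
    by move=> [->|/andP[/ltW -> ->]//]; rewrite lexx.
  rewrite measureU//; first by rewrite [X in (X + _)%R](dec_set1 hnu 0%R) add0e.
  by apply/seteqP; split => // x /= [->]; rewrite in_itv /= ltxx.
rewrite -measureU//.
  congr (nu _); apply/seteqP; split => x /=; rewrite !in_itv /=; last by case; lra.
  by move=> /andP[bx xa]; have [x0|x0] := leP x 0%R; [left|right]; rewrite ?bx ?xa.
by apply/seteqP; split => // x /=; rewrite !in_itv /=; lra.
Qed.

Lemma measure_setD_null (X Y N : set (measurableTypeR R)) :
  measurable X -> measurable Y -> measurable N -> nu N = 0 ->
  X `<=` Y `|` N -> nu X <= nu Y.
Proof.
move=> mX mY mN N0 XY; apply: (@le_trans _ _ (nu (Y `|` N))).
  by apply: le_measure; rewrite ?inE//; exact: measurableU.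
by apply: le_trans (measureU2 _ mY mN) _; rewrite [X in (_ + X)%R]N0 adde0.
Qed.

End Intervals.

(** * Expansion of signed Minkowski sums *)

Section ProductSlices.
Local Open Scope ereal_scope.
Context (R : realType) (n : nat).
Notation V := (borel_rV R n).
Variable nu : 'I_n -> {sigma_finite_measure set (measurableTypeR R) -> \bar R}.
Notation fullints := (pints nu (fun=> setT) (@upd R n : 'I_n -> V -> R -> V)).
Notation fullint := (pint nu (fun=> setT) (@upd R n : 'I_n -> V -> R -> V)).
Let mT (k : 'I_n) : measurable (setT : set (measurableTypeR R)).
Proof. exact: measurableT. Qed.
Let mupd := @measurable_upd2 R n.
Let updC := @upd_comm R n.

Lemma prodmeas_slice k (S : set V) : measurable S ->
  prodmeas nu S = fullints [seq i <- enum 'I_n | i != k] (fullint k (eindic S)) 0%R.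
Proof.
move=> mS; rewrite /prodmeas -[fullint k _]/(fullints [:: k] (eindic S)) -pints_cat.
congr (_ 0%R); apply: (perm_pints _ mT mupd updC (mnonneg_eindic mS)).
apply: uniq_perm; rewrite ?enum_uniq//.
  by rewrite cat_uniq filter_uniq ?enum_uniq//= mem_filter eqxx.
by move=> i; rewrite mem_cat mem_enum [in RHS]mem_filter mem_enum inE andbT mem_seq1 orNb.
Qed.

Lemma fullint_eindic k (S : set V) x : measurable S ->
  fullint k (eindic S) x = nu k [set t | S (upd k x t)].
Proof.
move=> mS; have mSx : measurable ([set t | S (upd k x t)] : set (measurableTypeR R)).
  by rewrite -[X in measurable X]setTI; apply: (measurable_upd mupd k x).
rewrite -[in RHS](setIT [set t | S (upd k x t)]) -integral_indic//.
Qed.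

(** Coordinate [k] is made the innermost variable, so that an inequality between the measures of
    slices in direction [k] can be integrated over the others. *)
Lemma prodmeas_le_sum (J : finType) k (S : set V) (S_ : J -> set V) :
  measurable S -> (forall j, measurable (S_ j)) ->
  (forall x, nu k [set t | S (upd k x t)] <= \sum_j nu k [set t | S_ j (upd k x t)]) ->
  prodmeas nu S <= \sum_j prodmeas nu (S_ j).
Proof.
move=> mS mS_ h; rewrite (prodmeas_slice k mS).
rewrite (eq_bigr (fun j => fullints [seq i <- enum 'I_n | i != k] (fullint k (eindic (S_ j))) 0%R)).
  rewrite -(pints_sum _ mT mupd); last first.
    by move=> j; apply: (mnonneg_pint _ mT mupd); exact: mnonneg_eindic.
  apply: (le_pints _ mT mupd).
  - by apply: (mnonneg_pint _ mT mupd); exact: mnonneg_eindic.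
  - by apply: mnonneg_sum => j; apply: (mnonneg_pint _ mT mupd); exact: mnonneg_eindic.
  by move=> y _; rewrite fullint_eindic//; under eq_bigr do rewrite fullint_eindic//.
by move=> j _; exact: prodmeas_slice.
Qed.

Lemma prodmeas_ge_sum (J : finType) k (S : set V) (S_ : J -> set V) :
  measurable S -> (forall j, measurable (S_ j)) ->
  (forall x, \sum_j nu k [set t | S_ j (upd k x t)] <= nu k [set t | S (upd k x t)]) ->
  \sum_j prodmeas nu (S_ j) <= prodmeas nu S.
Proof.
move=> mS mS_ h; rewrite (prodmeas_slice k mS).
rewrite (eq_bigr (fun j => fullints [seq i <- enum 'I_n | i != k] (fullint k (eindic (S_ j))) 0%R)).
  rewrite -(pints_sum _ mT mupd); last first.
    by move=> j; apply: (mnonneg_pint _ mT mupd); exact: mnonneg_eindic.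
  apply: (le_pints _ mT mupd).
  - by apply: mnonneg_sum => j; apply: (mnonneg_pint _ mT mupd); exact: mnonneg_eindic.
  - by apply: (mnonneg_pint _ mT mupd); exact: mnonneg_eindic.
  by move=> y _; rewrite fullint_eindic//; under eq_bigr do rewrite fullint_eindic//.
by move=> j _; exact: prodmeas_slice.
Qed.

End ProductSlices.

Lemma continuous_rV (R : realType) n (T : topologicalType) (g : T -> 'rV[R]_n) :
  (forall k, continuous (fun x => g x 0%R k)) -> continuous g.
Proof.
move=> cg x U [P PP PU]; rewrite /nbhs /=.
have h k : nbhs x [set y | P 0%R k (g y 0%R k)].
  have := PP 0%R k; exact: (cg k x).
have : nbhs x (\bigcap_(k in setT) [set y | P 0%R k (g y 0%R k)]).
  have := filter_forall (nbhs_filter x) h; apply: filterS => y yP k _; exact: yP.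
apply: filterS => y yP; apply: PU => i j; rewrite (ord1 i); exact: (yP j).
Qed.

Lemma continuous_sum (R : realType) (T : topologicalType) (J : Type) (l : seq J)
    (f : J -> T -> R) :
  (forall j, continuous (f j)) -> continuous (fun z => \sum_(j <- l) f j z).
Proof.
move=> cf; elim: l => [|j l IH].
  rewrite (_ : (fun x => _) = fun=> 0); first exact: cst_continuous.
  by apply/funext => z; rewrite big_nil.
rewrite (_ : (fun x => _) = fun z => f j z + \sum_(j <- l) f j z); last first.
  by apply/funext => z; rewrite big_cons.
by move=> z; apply: continuousD; [exact: cf|exact: IH].
Qed.

Section Mixed.
Context (R : realType) (n : nat) (J : finType) (e : J -> bool).
Notation V := (borel_rV R n).
Variable M : R.
Variable K : J -> set 'rV[R]_n.
Hypothesis aK : forall j, antib M (K j).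

(* Coordinate [k] of the signed sum is kept where [c k = None] and replaced by that
   of the summand [j] where [c k = Some j]; [e j] is the sign in front of [K j]. *)
Definition comb (c : 'I_n -> option J) (z : J -> 'rV[R]_n) : 'rV[R]_n :=
  \row_k (if c k is Some j then z j 0 k
          else \sum_j (if e j then - z j 0 k else z j 0 k)).

Definition mixed (c : 'I_n -> option J) : set 'rV[R]_n :=
  [set comb c z | z in [set z | forall j, K j (z j)]].

(** A continuous image of a product of compact sets. Compactness is what makes all these sets, in
    particular the Minkowski sums, measurable. *)
Lemma compact_mixed c : compact (mixed c).
Proof.
rewrite /mixed.
apply: (@continuous_compact (prod_topology (fun _ : J => 'rV[R]_n)) 'rV[R]_n (comb c)); last first.
  by apply: (@tychonoff J (fun=> 'rV[R]_n) K) => j; exact: (antib_compact (aK j)).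
apply: continuous_subspaceT.
apply: (@continuous_rV R n (prod_topology (fun _ : J => 'rV[R]_n)) (comb c)) => k.
have pc j : continuous (fun z : prod_topology (fun _ : J => 'rV[R]_n) => z j 0 k).
  move=> z; apply: (@continuous_comp _ _ _ (fun z : prod_topology (fun _ : J => 'rV[R]_n) => z j) (fun x : 'rV[R]_n => x 0 k)).
    exact: (@proj_continuous J (fun=> 'rV[R]_n) j).
  exact: coord_continuous.
rewrite (_ : (fun x => _) = fun z : prod_topology (fun _ : J => 'rV[R]_n) =>
  if c k is Some j then z j 0 k else \sum_j (if e j then - z j 0 k else z j 0 k)); last first.
  by apply/funext => z; rewrite mxE.
case: (c k) => [j|]; first exact: pc.
apply: (@continuous_sum R _ J (index_enum J) (fun j (z : prod_topology (fun _ : J => 'rV[R]_n)) => if e j then - z j 0 k else z j 0 k)) => j z.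
by case: (e j); [apply: continuousN|]; exact: (pc j z).
Qed.

Lemma measurable_mixed c : measurable (mixed c : set V).
Proof. by apply: compact_measurable_rV; exact: compact_mixed. Qed.

Section Slice.
Variables (c : 'I_n -> option J) (k : 'I_n) (x : 'rV[R]_n).
Hypothesis ck : c k = None.

Let c_ j i := if i == k then Some j else c i.

(** Parametrizes the slice through [x] in direction [k]. Since [c] and all the [c_ j] differ only at
    [k], one set of tuples serves all the slices to be compared. *)
Let Z : set (J -> 'rV[R]_n) := [set z | (forall j, K j (z j)) /\
  forall i, i != k -> comb c z 0 i = x 0 i].

Let slice_None : [set t | mixed c (upd k x t)] =
  [set \sum_j (if e j then - z j 0 k else z j 0 k) | z in Z].
Proof.
apply/seteqP; split => t /=.
  move=> [z Kz zt]; exists z.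
    by split => // i ik; rewrite zt updE (negbTE ik).
  by have := congr1 (fun y : 'rV_n => y 0 k) zt; rewrite updE eqxx mxE ck.
move=> [z [Kz zx] <-]; exists z => //; apply/rowP => i; rewrite updE.
by case: eqVneq => [->|ik]; [rewrite mxE ck|rewrite zx].
Qed.

Let slice_Some j : [set t | mixed (c_ j) (upd k x t)] = [set z j 0 k | z in Z].
Proof.
have cE z i : i != k -> comb (c_ j) z 0 i = comb c z 0 i.
  by move=> ik; rewrite !mxE /c_ (negbTE ik).
apply/seteqP; split => t /=.
  move=> [z Kz zt]; exists z.
    by split => // i ik; rewrite -cE// zt updE (negbTE ik).
  by have := congr1 (fun y : 'rV_n => y 0 k) zt; rewrite updE eqxx mxE /c_ eqxx.
move=> [z [Kz zx] <-]; exists z => //; apply/rowP => i; rewrite updE.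
by case: eqVneq => [->|ik]; [rewrite mxE /c_ eqxx|rewrite cE// zx].
Qed.

(** The [k]-th coordinates of the points can be lowered independently: the bodies are closed
    downwards, and the other coordinates of the combination are untouched. *)
Let Z_down z (s : J -> R) : Z z -> (forall j, 0 <= s j <= z j 0 k) ->
  Z (fun j => upd k (z j) (s j)).
Proof.
move=> [Kz zx] sz; split => [j|i ik].
  by have /andP[s0 s1] := sz j; exact: (antib_down (aK j)).
rewrite -zx// !mxE; case: (c i) => [j|]; first by rewrite updE (negbTE ik).
by apply: eq_bigr => j _; rewrite updE (negbTE ik).
Qed.

Let Z_ge0 z j : Z z -> 0 <= z j 0 k.
Proof. by move=> [Kz _]; exact: (antib_orth (aK j)). Qed.

Let Z_le z j : Z z -> z j 0 k <= M.
Proof. by move=> [Kz _]; exact: (antib_le (aK j)). Qed.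

Let b j := sup [set z j 0 k | z in Z].

Let Z_sup j : Z !=set0 -> has_sup [set z j 0 k | z in Z].
Proof.
move=> [z Zz]; split; first by exists (z j 0 k); exists z.
by exists M => _ [y Zy <-]; exact: Z_le.
Qed.

Let Z_leb j z : Z z -> z j 0 k <= b j.
Proof. by move=> Zz; apply: ub_le_sup; [case: (Z_sup j) => //; exists z|exists z]. Qed.

Let b_ge0 j : Z !=set0 -> 0 <= b j.
Proof. by move=> [z Zz]; apply: le_trans (Z_leb j Zz); exact: Z_ge0. Qed.

(** A tuple whose [j]-th point exceeds [t] at [k] is lowered to [t] there, and all its other points
    are lowered to 0; the signed sum at [k] then consists of [t] alone. *)
Let lt_b j t : Z !=set0 -> 0 <= t -> t < b j ->
  exists z, [/\ Z z, z j 0 k = t & forall i, i != j -> z i 0 k = 0].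
Proof.
move=> Z0 t0 tb; have [_ [z Zz <-] tz] := sup_gt (Z_sup j Z0).1 tb.
exists (fun i => upd k (z i) (if i == j then t else 0)); split.
- apply: Z_down => // i; case: eqVneq => [->|_]; first by rewrite t0 ltW.
  by rewrite lexx Z_ge0.
- by rewrite eqxx updE eqxx.
- by move=> i ij; rewrite (negbTE ij) updE eqxx.
Qed.

Variable nu : {measure set (measurableTypeR R) -> \bar R}.
Hypothesis hnu : dec_measure nu.

Let mslice (c' : 'I_n -> option J) :
  measurable ([set t | mixed c' (upd k x t)] : set (measurableTypeR R)).
Proof.
rewrite -[X in measurable X]setTI.
exact: (measurable_upd (@measurable_upd2 R n) k x) (measurable_mixed c').
Qed.

Let nu_b j : Z !=set0 -> nu [set t | mixed (c_ j) (upd k x t)] = nu `[0, b j]%classic.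
Proof.
move=> Z0; apply/eqP; rewrite eq_le; apply/andP; split.
  apply: le_measure; rewrite ?inE//.
  rewrite slice_Some => _ [z Zz <-] /=; rewrite in_itv /=.
  by rewrite Z_ge0//= Z_leb.
apply: (measure_setD_null (N := [set b j])) => //.
  exact: (dec_set1 hnu).
move=> t; rewrite /= in_itv /= => /andP[t0].
rewrite le_eqVlt => /predU1P[->|tb]; [by right|left].
have [z [Zz zt _]] := lt_b Z0 t0 tb.
suff : [set z j 0 k | z in Z] t by rewrite -slice_Some.
by exists z.
Qed.

(** Each [z j 0 k] lies in [[0, b j]], so the slice is contained in an interval around 0 whose ends
    are sums of the [b j] of either sign. Evenness splits this interval at 0, and subadditivity
    splits the two halves. *)
Lemma slice_mixed_le : (nu [set t | mixed c (upd k x t)] <=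
  \sum_j nu [set t | mixed (c_ j) (upd k x t)])%E.
Proof.
have [Z0|/nonemptyPn Z0] := pselect (Z !=set0); last first.
  by rewrite slice_None Z0 image_set0 measure0 sume_ge0.
under eq_bigr do rewrite nu_b//.
apply: (@le_trans _ _ (nu `[- (\sum_(j | e j) b j), \sum_(j | ~~ e j) b j]%classic)).
  apply: le_measure; rewrite ?inE//.
  rewrite slice_None => _ [z Zz <-] /=; rewrite in_itv /=.
  have -> : \sum_j (if e j then - z j 0 k else z j 0 k) =
      - (\sum_(j | e j) z j 0 k) + \sum_(j | ~~ e j) z j 0 k.
    rewrite (bigID e) /= -sumrN; congr (_ + _); apply: eq_bigr => j; first by move=> ->.
    by move=> /negbTE ->.
  have h1 : \sum_(j | e j) z j 0 k <= \sum_(j | e j) b j by apply: ler_sum => j _; exact: Z_leb.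
  have h2 : \sum_(j | ~~ e j) z j 0 k <= \sum_(j | ~~ e j) b j by apply: ler_sum => j _; exact: Z_leb.
  have h3 : 0 <= \sum_(j | e j) z j 0 k by apply: sumr_ge0 => j _; exact: Z_ge0.
  have h4 : 0 <= \sum_(j | ~~ e j) z j 0 k by apply: sumr_ge0 => j _; exact: Z_ge0.
  by apply/andP; split; lra.
rewrite (dec_measure_symm hnu) ?sumr_ge0//; try by move=> j _; exact: b_ge0.
rewrite [leRHS](bigID e) /=; apply: leeD; exact: (dec_measure_sum hnu _ (fun j => b_ge0 j Z0)).
Qed.

(** With one summand of each sign the slice contains the open interval []- b i2, b i1[]: every value
    in it is produced by one summand alone, the other being 0 at [k]. Hence the two suprema need not
    be approached by the same tuple. *)
Lemma slice_mixed_ge (i1 i2 : J) : i1 != i2 -> ~~ e i1 -> e i2 ->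
  (forall j, (j == i1) || (j == i2)) ->
  (\sum_j nu [set t | mixed (c_ j) (upd k x t)] <=
   nu [set t | mixed c (upd k x t)])%E.
Proof.
move=> i12 e1 e2 J12.
have [Z0|/nonemptyPn Z0] := pselect (Z !=set0); last first.
  by rewrite big1// => j _; rewrite slice_Some Z0 image_set0 measure0.
under eq_bigr do rewrite nu_b//.
have sumE (S : nmodType) (F : J -> S) : \sum_j F j = F i2 + F i1.
  rewrite (bigD1 i2)//= (bigD1 i1)//= big1 ?addr0// => j /andP[/negbTE j2 /negbTE j1].
  by have := J12 j; rewrite j1 j2.
rewrite sumE -(dec_measure_symm hnu)//; try exact: b_ge0.
apply: (measure_setD_null (N := [set - b i2; b i1])) => //.
  by apply: measurableU; exact: measurable_set1.
  apply/eqP; rewrite eq_le measure_ge0 andbT.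
  have := measureU2 nu (measurable_set1 (- b i2)) (measurable_set1 (b i1)).
  by rewrite [X in (X + _)%R](dec_set1 hnu) [X in (_ + X)%R](dec_set1 hnu) addr0.
move=> t; rewrite /= in_itv /= => /andP[].
rewrite le_eqVlt => /predU1P[<-|bt]; first by right; left.
rewrite le_eqVlt => /predU1P[->|tb]; first by right; right.
left; suff : [set \sum_j (if e j then - z j 0 k else z j 0 k) | z in Z] t by rewrite -slice_None.
have [t0|t0] := leP 0 t.
  have [z [Zz zt z0]] := lt_b Z0 t0 tb; exists z => //.
  by rewrite sumE e2 (negbTE e1) zt z0 1?eq_sym// oppr0 add0r.
have nt0 : 0 <= - t by lra.
have ntb : - t < b i2 by lra.
have [z [Zz zt z0]] := lt_b Z0 nt0 ntb; exists z => //.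
by rewrite sumE e2 (negbTE e1) zt z0// opprK addr0.
Qed.

End Slice.
End Mixed.

Section Expand.
Local Open Scope ereal_scope.
Context (R : realType) (I J : finType).

Definition assigned (l : seq I) (f : {ffun I -> option J}) : bool :=
  [forall i, (f i != None) == (i \in l)].

(** Clearing the value at [k] maps assignments on [k :: l] to assignments on [l], and each fibre is
    parametrized by the value cleared. *)
Lemma assigned_cons (P : (I -> option J) -> \bar R) k l : k \notin l ->
  \sum_(f | assigned (k :: l) f) P f =
  \sum_(f | assigned l f) \sum_j P (fun i => if i == k then Some j else f i).
Proof.
move=> kl; pose clear (f : {ffun I -> option J}) : {ffun I -> option J} :=
  [ffun i => if i == k then None else f i].
rewrite (partition_big clear (assigned l)) /=; last first.
  move=> f /forallP sf; apply/forallP => i; rewrite ffunE.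
  have := sf i; rewrite in_cons; case: (eqVneq i k) => [->|//].
  by rewrite (negbTE kl).
apply: eq_bigr => f sf.
pose h j : {ffun I -> option J} := [ffun i => if i == k then Some j else f i].
rewrite (reindex_omap h (fun g : {ffun I -> option J} => g k)) /=; last first.
  move=> g /andP[/forallP/(_ k)]; rewrite mem_head eqb_id.
  case gk : (g k) => [j|//] _ /eqP gf /=; congr Some; apply/ffunP => i.
  by rewrite ffunE -gf ffunE; case: (eqVneq i k) => [->|].
apply: eq_big => [j|j _].
  rewrite [h j k]ffunE eqxx eqxx andbT; apply/andP; split.
    apply/forallP => i; rewrite ffunE in_cons; case: (eqVneq i k) => //= _.
    exact: (forallP sf).
  apply/eqP/ffunP => i; rewrite !ffunE; case: (eqVneq i k) => // ->.
  by have := forallP sf k; rewrite (negbTE kl) eqbF_neg negbK => /eqP ->.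
by congr P; apply/funext => i; rewrite ffunE.
Qed.

Lemma assigned_nil (P : (I -> option J) -> \bar R) :
  \sum_(f | assigned [::] f) P f = P (fun=> None).
Proof.
rewrite (big_pred1 [ffun=> None]) => [|f].
  by congr P; apply/funext => i; rewrite ffunE.
apply/forallP/eqP => [sf|->] => [|i]; last by rewrite ffunE.
by apply/ffunP => i; rewrite ffunE; have := sf i; rewrite in_nil eqbF_neg negbK => /eqP.
Qed.

Lemma assigned_enum (P : (I -> option J) -> \bar R) (j0 : J) :
  \sum_(f | assigned (enum I) f) P f = \sum_(f : {ffun I -> J}) P (fun i => Some (f i)).
Proof.
(* The default [j0] is never reached, since an assignment on [enum I] has no value [None]. *)
rewrite (reindex_onto (fun f : {ffun I -> J} => [ffun i => Some (f i)])
  (fun f => [ffun i => odflt j0 (f i)])) /=; last first.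
  move=> f /forallP sf; apply/ffunP => i; rewrite !ffunE.
  by have := sf i; rewrite mem_enum inE eqb_id; case: (f i).
apply: eq_big => [f|f _].
  apply/andP; split; first by apply/forallP => i; rewrite ffunE mem_enum.
  by apply/eqP/ffunP => i; rewrite !ffunE.
by congr P; apply/funext => i; rewrite ffunE.
Qed.

Lemma le_expand (P : (I -> option J) -> \bar R) (j0 : J) :
  (forall c k, c k = None -> P c <= \sum_j P (fun i => if i == k then Some j else c i)) ->
  P (fun=> None) <= \sum_(f : {ffun I -> J}) P (fun i => Some (f i)).
Proof.
move=> hP; rewrite -(assigned_enum _ j0) -assigned_nil.
elim: (enum I) (enum_uniq I) => [//|k l IH] /= /andP[kl /IH]; move=> /le_trans; apply.
rewrite assigned_cons//; apply: lee_sum => f sf; apply: hP.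
by have := forallP sf k; rewrite (negbTE kl) eqbF_neg negbK => /eqP ->.
Qed.

Lemma ge_expand (P : (I -> option J) -> \bar R) (j0 : J) :
  (forall c k, c k = None -> \sum_j P (fun i => if i == k then Some j else c i) <= P c) ->
  \sum_(f : {ffun I -> J}) P (fun i => Some (f i)) <= P (fun=> None).
Proof.
move=> hP; rewrite -(assigned_enum _ j0) -assigned_nil.
elim: (enum I) (enum_uniq I) => [//|k l IH] /= /andP[kl /IH]; apply: le_trans.
rewrite assigned_cons//; apply: lee_sum => f sf; apply: hP.
by have := forallP sf k; rewrite (negbTE kl) eqbF_neg negbK => /eqP ->.
Qed.

End Expand.

Section MixedExpand.
Local Open Scope ereal_scope.
Context (R : realType) (n : nat) (J : finType) (e : J -> bool).
Variable nu : 'I_n -> {sigma_finite_measure set (measurableTypeR R) -> \bar R}.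
Hypothesis hnu : forall k, dec_measure (nu k).
Variables (M : R) (K : J -> set 'rV[R]_n).
Hypothesis aK : forall j, antib M (K j).

Lemma prodmeas_mixed_le (j0 : J) : prodmeas nu (mixed e K (fun=> None)) <=
  \sum_(f : {ffun 'I_n -> J}) prodmeas nu (mixed e K (fun i => Some (f i))).
Proof.
apply: (@le_expand R 'I_n J (fun c => prodmeas nu (mixed e K c)) j0) => c k ck.
apply: (@prodmeas_le_sum R n nu J k (mixed e K c)
  (fun j => mixed e K (fun i => if i == k then Some j else c i))).
- exact: measurable_mixed aK _.
- by move=> j; exact: measurable_mixed aK _.
- by move=> x; exact: (@slice_mixed_le R n J e M K aK c k x ck (nu k) (hnu k)).
Qed.

Lemma prodmeas_mixed_ge (i1 i2 : J) : i1 != i2 -> ~~ e i1 -> e i2 ->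
  (forall j, (j == i1) || (j == i2)) ->
  \sum_(f : {ffun 'I_n -> J}) prodmeas nu (mixed e K (fun i => Some (f i))) <=
  prodmeas nu (mixed e K (fun=> None)).
Proof.
move=> i12 e1 e2 J12; apply: (@ge_expand R 'I_n J (fun c => prodmeas nu (mixed e K c)) i1) => c k ck.
apply: (@prodmeas_ge_sum R n nu J k (mixed e K c)
  (fun j => mixed e K (fun i => if i == k then Some j else c i))).
- exact: measurable_mixed aK _.
- by move=> j; exact: measurable_mixed aK _.
- by move=> x; exact: (@slice_mixed_ge R n J e M K aK c k x ck (nu k) (hnu k) i1 i2).
Qed.

End MixedExpand.

Section AntiBlockingSections.
Local Open Scope ereal_scope.
Context (R : realType) (n : nat).
Notation V := (borel_rV R n).
Variable nu : 'I_n -> {sigma_finite_measure set (measurableTypeR R) -> \bar R}.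
Variable M : R.
Notation hints := (pints nu (fun=> half R) (@upd R n : 'I_n -> V -> R -> V)).
Notation fullints := (pints nu (fun=> setT) (@upd R n : 'I_n -> V -> R -> V)).

Lemma eindic_in (S : set V) x : S x -> eindic S x = 1.
Proof. by move=> Sx; rewrite /eindic indicE mem_set. Qed.

Lemma eindic_notin (S : set V) x : ~ S x -> eindic S x = 0.
Proof. by move=> Sx; rewrite /eindic indicE memNset. Qed.

Lemma eindic_eq1 (S : set V) x : 0 < eindic S x -> S x.
Proof.
rewrite /eindic lte_fin indicE; case: (boolP (x \in S)) => [|_].
  by rewrite inE.
by rewrite ltxx.
Qed.

Lemma antib_mono (M' : R) (K : set 'rV[R]_n) : (M <= M')%R -> antib M K -> antib M' K.
Proof.
move=> MM' [k0 ko kc kl kd kv]; split => // x k Kx.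
exact: le_trans (kl x k Kx) MM'.
Qed.

Lemma antib_good (K : set V) : antib M K -> good M predT (eindic K).
Proof.
move=> aK; split.
- by apply: mnonneg_eindic; apply: compact_measurable_rV; exact: antib_compact aK.
- move=> k x _ _ Mx; apply: eindic_notin => Kx.
  by have := antib_le aK k Kx; rewrite leNgt Mx.
- move=> k x t x0 xt; have [Kx|Kx] := pselect (K (upd k x t)); last first.
    by rewrite (eindic_notin Kx) lee_fin.
  rewrite !eindic_in//; have := antib_down (k := k) aK Kx (x0 k).
  by rewrite updE eqxx => /(_ xt); rewrite upd_upd upd_id.
- by move=> x _; rewrite ltry.
Qed.

Lemma antib_conc (K : set V) : antib M K -> conc 0 (eindic K).
Proof.
move=> aK x y t F G x0 y0 t0 t1 F0 G0; rewrite !expr0 => hx hy.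
rewrite eindic_in//; apply: (antib_convex aK) => //; apply: eindic_eq1.
  exact: lt_le_trans hx.
exact: lt_le_trans hy.
Qed.

Lemma antib_zero_on (K : set V) P x : antib M K -> K x -> K (zero_on P x).
Proof.
move=> aK Kx; apply: eindic_eq1.
have x0 := antib_orth aK Kx.
apply: lt_le_trans (good_mono (antib_good aK) (orth_zero_on P x0) (y := x) _).
  by rewrite eindic_in.
by move=> k; rewrite mxE; case: ifP.
Qed.

Lemma hints_eq0 (l : seq 'I_n) k (g : V -> \bar R) (y : V) : k \notin l -> (y 0%R k < 0)%R ->
  (forall y : V, (y 0%R k < 0)%R -> g y = 0) -> hints l g y = 0.
Proof.
move=> + + g0; elim: l y => [|i l IH] y /=; first by move=> _; exact: g0.
rewrite in_cons negb_or => /andP[ki kl] yk.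
by apply: integral0_eq => t _; rewrite IH// updE (negbTE ki).
Qed.

(** The integrand vanishes once an integrated coordinate is negative. This links the product measure
    on the whole space to the half-line integrals used for sections. *)
Lemma fullints_half (l : seq 'I_n) (g : V -> \bar R) (x : V) : uniq l ->
  (forall k (y : V), k \in l -> (y 0%R k < 0)%R -> g y = 0) -> fullints l g x = hints l g x.
Proof.
elim: l x => [//|k l IH] x /= /andP[kl ul] g0.
rewrite /pint [RHS]integral_mkcond; apply: eq_integral => t _.
rewrite patchE IH//; last by move=> i y il; apply: g0; rewrite in_cons il orbT.
have [//|] := boolP (t \in half R); rewrite notin_setE halfE => /negP; rewrite -ltNge => t0.
apply: (hints_eq0 kl); first by rewrite updE eqxx.
by move=> y; apply: g0; exact: mem_head.
Qed.

(* When no coordinate is left unassigned, [mixed] is a product of coordinate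
   projections, which for anti-blocking bodies are sections. *)
Lemma prodmeas_mixed_total (J : finType) (e : J -> bool) (K : J -> set V)
    (f : 'I_n -> J) : (forall j, antib M (K j)) ->
  prodmeas nu (mixed e K (fun k => Some (f k))) =
  \prod_j secvol nu (K j) [set k | f k == j].
Proof.
move=> aK.
have uf j : uniq [seq k <- enum 'I_n | f k == j] by apply: filter_uniq; exact: enum_uniq.
pose g j (x : V) : \bar R := eindic (K j) (zero_on [pred k | f k != j] x).
have mixedE x : eindic (mixed e K (fun k => Some (f k))) x = \prod_j g j x.
  have [[z Kz zx]|Nx] := pselect (mixed e K (fun k => Some (f k)) x).
    rewrite eindic_in; last by exists z.
    rewrite big1// => j _; rewrite /g eindic_in//.
    rewrite (_ : zero_on _ _ = zero_on [pred k | f k != j] (z j)).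
      exact: (antib_zero_on _ (aK j) (Kz j)).
    by apply/rowP => k; rewrite -zx !mxE /=; case: eqVneq => //= ->.
  rewrite eindic_notin//; have [/existsP[j]|] := boolP [exists j, g j x == 0].
    by move=> /eqP gj; rewrite (bigD1 j)//= gj mul0e.
  rewrite negb_exists => /forallP gx; case: Nx.
  (* Each block supplies its own point: the projection of [x] onto block [j] lies in [K j], and
     these projections recombine to [x]. *)
  exists (fun j => zero_on [pred k | f k != j] x).
    move=> j; apply: eindic_eq1; rewrite lt_neqAle eq_sym; have := gx j.
    by rewrite /g => -> /=; rewrite /eindic lee_fin.
  by apply/rowP => k; rewrite !mxE /= eqxx.
rewrite /prodmeas; transitivity (fullints (enum 'I_n) (fun x => \prod_j g j x) 0%R).
  by apply: eq_pints => y _; exact: mixedE.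
rewrite (pints_prod nu (fun k => measurableT) (@measurable_upd2 R n) (@upd_comm R n) (c := f)).
- apply: eq_bigr => j _; rewrite (fullints_half _ (uf j)); last first.
    move=> k y; rewrite mem_filter => /andP[/eqP fk _] yk.
    rewrite /g eindic_notin// => Ky; have := antib_orth (aK j) Ky k.
    by rewrite mxE /= fk eqxx leNgt yk.
  rewrite (secvolE nu (antib_good (aK j)) (l := [seq k <- enum 'I_n | f k == j])).
  + apply: eq_pints => y /reachE[|_ yE]; first by move=> k; rewrite mxE.
    rewrite /g; congr (eindic _ _); apply/rowP => k; rewrite mxE /=.
    by case: eqVneq => //= fk; rewrite yE ?mxE// mem_filter (negbTE fk).
  + exact: uf.
  + by move=> k; rewrite [LHS]mem_filter mem_enum andbT [RHS]inE.
- move=> j; split; last by move=> x; rewrite lee_fin.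
  exact: measurableT_comp (good_mnonneg (antib_good (aK j))).1 (@measurable_zero_on R n _).
- move=> j k y t fk; rewrite /g; congr (eindic _ _); apply/rowP => i.
  by rewrite !mxE /=; case: (eqVneq i k) => [->|//]; rewrite fk.
Qed.

End AntiBlockingSections.

(** * The constant [zeta] and the final comparison *)

Lemma ler_sum_inj (R : numDomainType) (I J : finType) (h : I -> J) (G : J -> R) :
  injective h -> (forall j, 0 <= G j) -> \sum_i G (h i) <= \sum_j G j.
Proof.
move=> hi G0.
rewrite (bigID (mem [set h x | x in [set: I]]%SET) xpredT) /=.
have -> : \sum_(i | i \in [set h x | x in [set: I]]%SET) G i = \sum_i G (h i).
  rewrite big_imset /=; last by move=> x y _ _; exact: hi.
  by apply: eq_bigl => i; rewrite inE.
by rewrite lerDl sumr_ge0.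
Qed.

Lemma big_option_sum (V : nmodType) (I : finType) (F : option I -> V) :
  \sum_j F j = F None + \sum_i F (Some i).
Proof.
rewrite (bigD1 None)//=; congr (_ + _).
rewrite (reindex_omap Some id) /=; last by case.
by apply: eq_bigl => i; rewrite eqxx.
Qed.

Lemma big_option_prode (R : realDomainType) (I : finType) (F : option I -> \bar R) :
  (\prod_j F j = F None * \prod_i F (Some i))%E.
Proof.
rewrite (bigD1 None)//=; congr (_ * _)%E.
rewrite (reindex_omap Some id) /=; last by case.
by apply: eq_bigl => i; rewrite eqxx.
Qed.

Lemma lee_prod (R : realDomainType) (I : finType) (F G : I -> \bar R) :
  (forall i, 0 <= F i)%E -> (forall i, F i <= G i)%E -> (\prod_i F i <= \prod_i G i)%E.
Proof.
move=> F0 FG; suff : (0 <= \prod_i F i <= \prod_i G i)%E by case/andP.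
elim/big_ind2: _ => [|x1 x2 y1 y2 /andP[x0 xx] /andP[y0 yy]|i _].
- by rewrite lee01 lexx.
- by rewrite mule_ge0// lee_pmul.
- by rewrite F0 FG.
Qed.

Section Zeta.
Variables (R : realType) (n m : nat).

(** The witness is [alpha_i = #|F_i^c|]. As [F_0, ..., F_m] partition the [n] coordinates, these
    numbers add up to [n * m - (n - N) = n * (m - 1) + N]. *)
Lemma zeta_ge (c : {ffun 'I_n -> option 'I_m}) (N := #|[set k | c k == None]%SET|) :
  (0 < m)%N ->
  (\prod_(i < m) 'C(#|~: [set k | c k == Some i]%SET|, N)%:R) / 'C(n, N)%:R ^+ m.-1
  <= zeta R n m.
Proof.
move=> m0.
have cn (F : {set 'I_n}) : (#|F| < n.+1)%N by rewrite ltnS -[leqRHS]card_ord max_card.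
pose alpha : {ffun 'I_m -> 'I_n.+1} := [ffun i => Ordinal (cn (~: [set k | c k == Some i])%SET)].
have sumE : (\sum_(i < m) alpha i = n * m.-1 + N)%N.
  have h : (\sum_(i < m) alpha i + \sum_(i < m) #|[set k | c k == Some i]%SET| = n * m)%N.
    rewrite -big_split /= (eq_bigr (fun=> n)) => [|i _]; last first.
      by rewrite ffunE /= addnC cardsC card_ord.
    by rewrite sum_nat_const card_ord mulnC.
  have h2 : (N + \sum_(i < m) #|[set k | c k == Some i]%SET| = n)%N.
    transitivity (\sum_(k < n) 1)%N; last by rewrite sum1_card card_ord.
    rewrite (partition_big c xpredT)//= (bigD1 None)//=; congr addn.
      by rewrite sum1_card /N; apply: eq_card => k; rewrite !inE.
    rewrite (reindex_omap Some id) /=; last by case.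
    apply: eq_big => i; first by rewrite eqxx.
    by move=> _; rewrite sum1_card; apply: eq_card => k; rewrite !inE.
  have h3 : (n * m = n * m.-1 + n)%N by rewrite -[in LHS](prednK m0) mulnS addnC.
  by move: h h2 h3; clear; lia.
have NE : zeta_N alpha = N by rewrite /zeta_N sumE addKn.
have adm : zeta_adm alpha by rewrite /zeta_adm sumE leq_addr.
have := le_bigmax_cond 0 (fun a : {ffun 'I_m -> 'I_n.+1} =>
  (\prod_(i < m) 'C(a i, zeta_N a)%:R) / 'C(n, zeta_N a)%:R ^+ m.-1 : R) adm.
rewrite NE; apply: le_trans; rewrite le_eqVlt; apply/orP; left; apply/eqP; congr (_ / _).
by apply: eq_bigr => i _; rewrite ffunE.
Qed.

Lemma zeta_ge0 : 0 <= zeta R n m.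
Proof.
rewrite /zeta; elim/big_ind: _ => // [x y x0 y0|a _]; first by rewrite le_max x0.
by rewrite divr_ge0 ?exprn_ge0// prodr_ge0.
Qed.

End Zeta.

Section MinkowskiSums.
Context (R : realType) (n m : nat).
Variables (A : set 'rV[R]_n) (B : 'I_m -> set 'rV[R]_n).

(** The fold is unrolled with families [z] over all indices, including those not yet summed; the
    origin of each [B i] fills these entries. *)
Lemma minkowski_signed_mixed (s : 'I_m -> bool) : (forall i, B i 0) ->
  minkowski_signed s A B =
  mixed (fun j => if j is Some i then s i else false)
        (fun j => if j is Some i then B i else A) (fun=> None).
Proof.
move=> B0.
have key (l : seq 'I_m) : uniq l ->
    foldl (fun K i => if s i then minkowski_sub K (B i) else minkowski_add K (B i)) A l =
    [set a + \sum_(i <- l) (if s i then - z i else z i) | a in A & z in [set z | forall i, B i (z i)]].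
  elim/last_ind: l => [_|l i IH]; first apply/seteqP; first split => x /=.
  - by move=> Ax; exists x => //; exists (fun=> 0) => //; rewrite big_nil addr0.
  - by move=> [a Aa [z _ <-]]; rewrite big_nil addr0.
  rewrite rcons_uniq foldl_rcons => /andP[il /IH ->].
  have step (a : 'rV[R]_n) (z : 'I_m -> 'rV[R]_n) :
      a + \sum_(j <- rcons l i) (if s j then - z j else z j) =
      (a + \sum_(j <- l) (if s j then - z j else z j)) + (if s i then - z i else z i).
    by rewrite -cats1 big_cat big_seq1 addrA.
  (* Changing the family at [i] leaves the partial sum over [l] unaltered, because [i] is not in
     [l]. *)
  have glue (a y : 'rV[R]_n) (z : 'I_m -> 'rV[R]_n) : B i y -> (forall j, B j (z j)) ->
      exists2 z' : 'I_m -> 'rV[R]_n, forall j, B j (z' j) &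
      a + \sum_(j <- rcons l i) (if s j then - z' j else z' j) =
      (a + \sum_(j <- l) (if s j then - z j else z j)) + (if s i then - y else y).
    move=> By Bz; exists (fun j => if j == i then y else z j).
      by move=> j; case: eqVneq => [->|].
    rewrite step eqxx; congr (_ + _ + _); rewrite !big_seq; apply: eq_bigr => j jl.
    by case: eqVneq => // ji; move: il; rewrite -ji jl.
  case si : (s i); apply/seteqP; split => x /=.
  - move=> [_ [a Aa [z Bz <-]] [y By <-]]; have [z' Bz' zE] := glue a y z By Bz.
    by exists a => //; exists z' => //; rewrite zE si.
  - move=> [a Aa [z Bz <-]]; rewrite step si.
    by exists (a + \sum_(j <- l) (if s j then - z j else z j)); [exists a => //; exists z|exists (z i)].
  - move=> [_ [a Aa [z Bz <-]] [y By <-]]; have [z' Bz' zE] := glue a y z By Bz.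
    by exists a => //; exists z' => //; rewrite zE si.
  - move=> [a Aa [z Bz <-]]; rewrite step si.
    by exists (a + \sum_(j <- l) (if s j then - z j else z j)); [exists a => //; exists z|exists (z i)].
rewrite /minkowski_signed key ?enum_uniq//; apply/seteqP; split => x /=.
  move=> [a Aa [z Bz <-]]; exists (fun j => if j is Some i then z i else a).
    by case.
  apply/rowP => k; rewrite !mxE big_option_sum summxE big_enum /=; congr (_ + _).
  by apply: eq_bigr => i _; case: (s i); rewrite ?mxE.
move=> [z Kz <-]; exists (z None); first exact: (Kz None).
exists (fun i => z (Some i)); first by move=> i; exact: (Kz (Some i)).
apply/rowP => k; rewrite !mxE big_option_sum summxE big_enum /=; congr (_ + _).
by apply: eq_bigr => i _; case: (s i); rewrite ?mxE.
Qed.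

Lemma minkowski_sub_mixed (C : set 'rV[R]_n) :
  minkowski_sub A C = mixed negb (fun b : bool => if b then A else C) (fun=> None).
Proof.
apply/seteqP; split => x /=.
  move=> [a Aa [y Cy <-]]; exists (fun b : bool => if b then a else y); first by case.
  by apply/rowP => k; rewrite !mxE big_bool.
move=> [z Kz <-]; exists (z true); first exact: (Kz true).
exists (z false); first exact: (Kz false).
by apply/rowP => k; rewrite !mxE big_bool.
Qed.

End MinkowskiSums.

Section Core.
Local Open Scope ereal_scope.
Context (R : realType) (n m : nat).
Variable nu : 'I_n -> {sigma_finite_measure set (measurableTypeR R) -> \bar R}.
Hypothesis hnu : forall k, dec_measure (nu k).
Variables (M : R) (M0 : (0 <= M)%R).
Variables (A : set 'rV[R]_n) (B : 'I_m -> set 'rV[R]_n).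
Hypotheses (aA : antib M A) (aB : forall i, antib M (B i)).

Lemma prodmeas_secvol (K : set 'rV[R]_n) : antib M K ->
  prodmeas nu K = secvol nu K [set: 'I_n]%SET.
Proof.
move=> aK; rewrite (secvolE nu (antib_good aK) (l := enum 'I_n)) ?enum_uniq//; last first.
  by move=> k; rewrite mem_enum !inE.
rewrite /prodmeas fullints_half ?enum_uniq// => k y _ yk.
by apply: eindic_notin => Ky; have := antib_orth aK Ky k; rewrite leNgt yk.
Qed.

(* Sending [c] to the family of the complements of its blocks [F_i] embeds the
   sum over partitions into the expanded product. *)
Lemma section_sum_ineq (a : {set 'I_n} -> R) (b : 'I_m -> {set 'I_n} -> R) (C z : R) :
  (forall F, 0 <= a F)%R -> (forall i F, 0 <= b i F)%R -> (0 <= z)%R ->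
  (forall c : {ffun 'I_n -> option 'I_m}, C * a [set k | c k == None]%SET <=
     z * \prod_(i < m) a (~: [set k | c k == Some i]%SET))%R ->
  (C * (\sum_(c : {ffun 'I_n -> option 'I_m}) a [set k | c k == None]%SET *
      \prod_(i < m) b i [set k | c k == Some i]%SET) <=
   z * \prod_(i < m) \sum_(g : {ffun 'I_n -> bool})
      a [set k | g k == true]%SET * b i [set k | g k == false]%SET)%R.
Proof.
move=> a0 b0 z0 h; rewrite bigA_distr_bigA.
pose H (c : {ffun 'I_n -> option 'I_m}) : {ffun 'I_m -> {ffun 'I_n -> bool}} :=
  [ffun i => [ffun k => c k != Some i]].
have Hinj : injective H.
  move=> c c' /ffunP cc'; apply/ffunP => k.
  have {cc'}cc' i : (c k == Some i) = (c' k == Some i).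
    by have /ffunP/(_ k) := cc' i; rewrite !ffunE => /negb_inj.
  case ck : (c k) cc' => [i|] cc'; first by apply/esym/eqP; rewrite -cc'.
  case ck' : (c' k) cc' => [i|//] cc'; by have := cc' i; rewrite eqxx.
pose G (u : {ffun 'I_m -> {ffun 'I_n -> bool}}) :=
  (\prod_(i < m) (a [set k | u i k == true]%SET * b i [set k | u i k == false]%SET))%R.
have G0 u : (0 <= G u)%R by apply: prodr_ge0 => i _; rewrite mulr_ge0.
apply: le_trans (ler_wpM2l z0 (ler_sum_inj Hinj G0)).
rewrite !mulr_sumr; apply: ler_sum => c _; rewrite mulrA /G big_split /= mulrA.
have -> : (\prod_(i < m) b i [set k | c k == Some i]%SET =
    \prod_(i < m) b i [set k | H c i k == false]%SET)%R.
  by apply: eq_bigr => i _; congr (b i _); apply/setP => k; rewrite !inE !ffunE eqbF_neg negbK.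
apply: ler_wpM2r; first by apply: prodr_ge0 => i _.
apply: le_trans (h c) _; rewrite le_eqVlt; apply/orP; left; apply/eqP; congr (_ * _)%R.
by apply: eq_bigr => i _; congr (a _); apply/setP => k; rewrite !inE !ffunE eqb_id.
Qed.

(** All section volumes are finite, so after both expansions the comparison takes place in [R],
    where [section_sum_ineq] applies with [C] the power [m.-1] of the measure of [A] and [z] the
    constant [zeta]; its hypothesis is [section_ineq] followed by [zeta_ge]. *)
Lemma prodmeas_minkowski (s : 'I_m -> bool) : (0 < m)%N ->
  prodmeas nu A ^+ m.-1 * prodmeas nu (minkowski_signed s A B) <=
  (zeta R n m)%:E * \prod_(i < m) prodmeas nu (minkowski_sub A (B i)).
Proof.
move=> m0.
pose a F := fine (secvol nu A F); pose b i F := fine (secvol nu (B i) F).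
have aE F : secvol nu A F = (a F)%:E.
  by rewrite fineK//; exact: (secvol_fin hnu M0 (antib_good aA)).
have bE i F : secvol nu (B i) F = (b i F)%:E.
  by rewrite fineK//; exact: (secvol_fin hnu M0 (antib_good (aB i))).
have a0 F : (0 <= a F)%R by rewrite -lee_fin -aE secvol_ge0.
have b0 i F : (0 <= b i F)%R by rewrite -lee_fin -bE secvol_ge0.
have up : prodmeas nu (minkowski_signed s A B) <=
    (\sum_(c : {ffun 'I_n -> option 'I_m}) a [set k | c k == None]%SET *
      \prod_(i < m) b i [set k | c k == Some i]%SET)%R%:E.
  have aK (j : option 'I_m) : antib M (if j is Some i then B i else A) by case: j.
  rewrite minkowski_signed_mixed; last by move=> i; exact: antib0 (aB i).
  apply: le_trans (prodmeas_mixed_le _ hnu aK None) _.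
  rewrite -sumEFin; apply: lee_sum => c _.
  rewrite (prodmeas_mixed_total _ _ _ aK) big_option_prode /= aE EFinM -prodEFin.
  by under eq_bigr do rewrite bE.
have lo i : (\sum_(g : {ffun 'I_n -> bool})
      a [set k | g k == true]%SET * b i [set k | g k == false]%SET)%R%:E <=
    prodmeas nu (minkowski_sub A (B i)).
  have aK (j : bool) : antib M (if j then A else B i) by case: j.
  rewrite minkowski_sub_mixed.
  apply: le_trans (prodmeas_mixed_ge hnu aK (i1 := true) (i2 := false) _ _ _ _) => //; last by case.
  rewrite -sumEFin; apply: lee_sum => g _.
  by rewrite (prodmeas_mixed_total _ _ _ aK) big_bool /= aE bE.
rewrite prodmeas_secvol// aE -EFin_expe.
apply: (@le_trans _ _ ((zeta R n m)%:E * \prod_(i < m) (\sum_(g : {ffun 'I_n -> bool})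
      a [set k | g k == true]%SET * b i [set k | g k == false]%SET)%R%:E)); last first.
  apply: lee_wpmul2l; first by rewrite lee_fin zeta_ge0.
  by apply: lee_prod => // i; rewrite lee_fin sumr_ge0// => g _; rewrite mulr_ge0.
apply: (@le_trans _ _ ((a [set: 'I_n]%SET ^+ m.-1)%:E *
   (\sum_(c : {ffun 'I_n -> option 'I_m}) a [set k | c k == None]%SET *
      \prod_(i < m) b i [set k | c k == Some i]%SET)%R%:E)).
  by apply: lee_wpmul2l => //; rewrite lee_fin exprn_ge0.
rewrite prodEFin -!EFinM lee_fin.
apply: section_sum_ineq => // [|c]; first exact: zeta_ge0.
have := section_ineq hnu M0 (antib_good aA) (antib_conc aA) (antib0 aA) (c := c) m0 erefl.
rewrite !aE (eq_bigr (fun i => (a (~: [set k | c k == Some i])%SET)%:E)); last by move=> i _.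
rewrite prodEFin -EFin_expe -!EFinM lee_fin => /le_trans; apply.
apply: ler_wpM2r; first by apply: prodr_ge0.
exact: zeta_ge.
Qed.

End Core.

Theorem theorem29 (R : realType) (n m : nat) (hn : (1 <= n)%N) (hm : (1 <= m)%N)
  (mu : {measure set (borel_rV R n) -> \bar R})
  (hmu : unconditional_decreasing_product mu)
  (A : set 'rV[R]_n) (B : 'I_m -> set 'rV[R]_n)
  (hA : anti_blocking A) (hB : forall i, anti_blocking (B i))
  (s : 'I_m -> bool) :
  (mu A ^+ m.-1 * mu (minkowski_signed s A B)
    <= (zeta R n m)%:E * \prod_(i < m) mu (minkowski_sub A (B i)))%E.
Proof.
have [mu_ hd hp] := hmu.
have nuP k : exists nu' : {sigma_finite_measure set (measurableTypeR R) -> \bar R},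
    nu' = mu_ k :> (set _ -> \bar R).
  have [phi hphi hdphi] := hd k.
  exact: sigma_finite_copy_exists (density_sigma_finite hphi hdphi).
have [nu nuE] := choice nuP.
have hnu k : dec_measure (nu k).
  have [phi hphi hdphi] := hd k; rewrite nuE; exact: density_dec_measure hphi hdphi.
have muE S : measurable S -> mu S = prodmeas nu S.
  apply: prodmeas_unique => // C mC; rewrite -[box C]/[set x : 'rV[R]_n | forall k, C k (x 0 k)].
  by rewrite hp//; apply: eq_bigr => k _; rewrite nuE.
have [MA MA0 aA] := anti_blocking_antib hA.
have MBP i : exists M : R, 0 <= M /\ antib M (B i).
  by have [M M0 aM] := anti_blocking_antib (hB i); exists M.
have [MB MBa] := choice MBP.
(* A single bound has to serve all the bodies at once. *)
pose M := MA + \sum_i MB i.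
have SB0 : 0 <= \sum_i MB i by apply: sumr_ge0 => i _; case: (MBa i).
have M0 : 0 <= M by rewrite addr_ge0.
have {}aA : antib M A by apply: antib_mono aA; rewrite lerDl.
have aB i : antib M (B i).
  apply: antib_mono (MBa i).2; rewrite /M (bigD1 i)//= addrCA lerDl addr_ge0//.
  by apply: sumr_ge0 => j _; case: (MBa j).
(* [mu] and [prodmeas] are known to agree on measurable sets only, so the Minkowski sums are treated
   as mixed sets, whose compactness gives measurability. *)
have mM (J : finType) e (K : J -> set 'rV[R]_n) : (forall j, antib M (K j)) ->
    measurable (mixed e K (fun=> None) : set (borel_rV R n)).
  by move=> aK; exact: measurable_mixed aK _.
rewrite !muE; first 1 last.
- rewrite minkowski_signed_mixed; last by move=> i; exact: antib0 (aB i).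
  by apply: mM; case.
- by apply: compact_measurable_rV; exact: antib_compact aA.
rewrite (eq_bigr (fun i => prodmeas nu (minkowski_sub A (B i)))) => [|i _]; last first.
  by rewrite muE// minkowski_sub_mixed; apply: mM; case.
exact: (prodmeas_minkowski hnu M0 aA aB s hm).
Qed.
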